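(* Fix $\tau\in\mathbb{H}=\{\tau\in\mathbb{C}:\operatorname{Im}\tau>0\}$ and $p\in\mathbb{C}$ with $p\notin E_\tau[2]$. For $A\in\mathbb{C}$ consider the equation $$y''(z)=\Big[2\wp(z)+\tfrac34\big(\wp(z+p)+\wp(z-p)\big)+A\big(\zeta(z+p)-\zeta(z-p)\big)+B\Big]y(z)\quad\text{in }E_\tau,\qquad(\ast)$$ where $B=A^2-\zeta(2p)A-\tfrac34\wp(2p)-2\wp(p)$ (so that $\pm p$ are apparent singularities) and $\wp,\zeta$ are the Weierstrass functions of $\Lambda_\tau$. (1) If $C\in\mathbb{C}\cup\{\infty\}$ satisfies $$\wp(p|\tau)=\frac{2g_3(C-\tau)^3-4(C\eta_1-\eta_2)^3-g_2(C\eta_1-\eta_2)(C-\tau)^2}{(C-\tau)\left[12(C\eta_1-\eta_2)^2-g_2(C-\tau)^2\right]},$$ then there exists $A\in\mathbb{C}$ such that for the corresponding equation $(\ast)$, up to a common conjugation, $$\rho(\ell_1)=\begin{pmatrix}1&0\\1&1\end{pmatrix},\qquad \rho(\ell_2)=\begin{pmatrix}1&0\\C&1\end{pmatrix}.$$ (2) Fix $k\in\{1,2,3\}$. If $C\in\mathbb{C}\cup\{\infty\}$ satisfies $$\wp(p|\tau)=\frac{(\frac{g_2}{2}-3e_k^2)(C\eta_1-\eta_2)+\frac{g_2}{4}e_k(C-\tau)}{3e_k(C\eta_1-\eta_2)+(\frac{g_2}{2}-3e_k^2)(C-\tau)},$$ then there exists $A\in\mathbb{C}$ such that for the corresponding equation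 $(\ast)$, up to a common conjugation, $$\rho(\ell_1)=\varepsilon_1\begin{pmatrix}1&0\\1&1\end{pmatrix},\qquad \rho(\ell_2)=\varepsilon_2\begin{pmatrix}1&0\\C&1\end{pmatrix},$$ where $$(\varepsilon_1,\varepsilon_2)=\begin{cases}(1,-1)&\text{if }k=1,\\(-1,1)&\text{if }k=2,\\(-1,-1)&\text{if }k=3.\end{cases}$$ (For $C=\infty$ the matrices are understood by the convention given in the context.)
   Context: Notation: $\omega_0=0,\ \omega_1=1,\ \omega_2=\tau,\ \omega_3=1+\tau$; $\Lambda_\tau=\mathbb{Z}+\mathbb{Z}\tau$; $E_\tau=\mathbb{C}/\Lambda_\tau$; $E_\tau[2]=\{\omega_k/2: 0\le k\le 3\}+\Lambda_\tau$. $\wp(z)=\wp(z|\tau)$ is the Weierstrass function with period lattice $\Lambda_\tau$, $e_k=\wp(\omega_k/2|\tau)$ for $k=1,2,3$, and $g_2=g_2(\tau)$, $g_3=g_3(\tau)$ are defined by $\wp'^2=4\wp^3-g_2\wp-g_3=4\prod_{k=1}^3(\wp-e_k)$. $\zeta(z)=\zeta(z|\tau)$ is the Weierstrass zeta function (odd, $\zeta'=-\wp$), with quasi-periods $\eta_1=\zeta(z+1)-\zeta(z)$, $\eta_2=\zeta(z+\tau)-\zeta(z)$. Apparent singularities: the local exponents of the equation at $\pm p$ are $-\frac12,\frac32$; $\pm p$ are called apparent if the local solutions there contain no logarithms; this holds exactly when $B$ is given by the stated formula. Monodromy: Let $q_0\notin E_\tau[2]\cup(\{\pm p\}+\Lambda_\tau)$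 be a base point, and $\rho:\pi_1(E_\tau\setminus(E_\tau[2]\cup(\{\pm p\}+\Lambda_\tau)),q_0)\to SL(2,\mathbb{C})$ the monodromy representation: for a basis $(y_1,y_2)$ of local solutions at $q_0$, analytic continuation along $\ell$ gives $\ell^*\binom{y_1}{y_2}=\rho(\ell)\binom{y_1}{y_2}$. Let $\gamma_\pm$ be simple loops encircling $\pm p$ counterclockwise, let $L$ be the straight segment connecting $p$ and $-p$, and let $\ell_j$ ($j=1,2$) be fundamental cycles of $E_\tau$ connecting $q_0$ with $q_0+\omega_j$ such that $\ell_j$ does not intersect $L+\Lambda_\tau$ and $\gamma_+\gamma_-=\ell_1\ell_2\ell_1^{-1}\ell_2^{-1}$ in $\pi_1(E_\tau\setminus(\{\pm p\}+\Lambda_\tau),q_0)$. The lift $p\in\mathbb{C}$ is assumed to be chosen so that such $\ell_1,\ell_2$ exist (for instance $p=a+b\tau$ with real $|a|,|b|\le\frac12$). Known facts: $\rho(\gamma_\pm)=-I_2$, the local monodromy at each point of $E_\tau[2]$ is $I_2$, and the monodromy group is abelian, generated by $-I_2,\rho(\ell_1),\rho(\ell_2)$. Convention for $C=\infty$: the statement ''$\rho(\ell_1)=\varepsilon_1\begin{pmatrix}1&0\\1&1\end{pmatrix}$, $\rho(\ell_2)=\varepsilon_2\begin{pmatrix}1&0\\C&1\end{pmatrix}$'' is to be understood as $\rho(\ell_1)=\varepsilon_1 I_2$ and $\rho(\ell_2)=\varepsilon_2\begin{pmatrix}1&0\\1&1\end{pmatrix}$ (in part (1), $\varepsilon_1=\varepsilon_2=1$).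 The right-hand sides of the formulas for $\wp(p|\tau)$ are regarded as rational functions of $C\in\mathbb{C}\cup\{\infty\}$ (at $C=\infty$ they are taken as the limit $C\to\infty$). *)

(* Defs.v *)
From HB Require Import structures.
From mathcomp Require Import all_boot all_order all_algebra complex.
From mathcomp Require Import all_classical all_reals all_analysis.

Set Implicit Arguments.
Unset Strict Implicit.
Unset Printing Implicit Defensive.

Import Order.TTheory GRing.Theory Num.Theory.
Import numFieldNormedType.Exports.

Local Open Scope classical_set_scope.
Local Open Scope ring_scope.
Local Open Scope complex_scope.

(* R[i] itself carries no topology in the library; seen as a                  *)
(* numClosedFieldType it gets the one given by its norm, and `derivable f z 1`*)
(* is then complex differentiability.                                         *)
Definition cplx (R : realType) : numClosedFieldType := R[i].

Section Weierstrass.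
Context {R : realType}.
Notation C := (cplx R).
Implicit Types (tau z c : C) (k : nat).

Definition lattice tau : set C :=
  [set w | exists m n : int, w = m%:~R + n%:~R * tau].

(* Sum over the nonzero lattice points m + n tau, with |m|, |n| <= N and      *)
(* N -> oo (m = i - N, n = j - N). The two series below converge absolutely,  *)
(* so the order of summation is immaterial.                                   *)
Definition lattice_sum tau (f : C -> C) : C :=
  lim ((fun N : nat => \sum_(i < N.*2.+1)
         \sum_(j < N.*2.+1 | ~~ ((i == N :> nat) && (j == N :> nat)))
           f ((i%:R - N%:R) + (j%:R - N%:R) * tau)) @ \oo).

Definition wp tau z : C :=
  z ^- 2 + lattice_sum tau (fun w => (z - w) ^- 2 - w ^- 2).

Definition zeta tau z : C :=
  z^-1 + lattice_sum tau (fun w => (z - w)^-1 + w^-1 + z * w ^- 2).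

Definition omega tau k : C := [:: 0; 1; tau; 1 + tau]`_k.

Definition ek tau k : C := wp tau (omega tau k / 2).

Definition quasi_period tau k : C :=
  get [set c : C | forall z, ~ lattice tau z ->
    zeta tau (z + omega tau k) - zeta tau z = c].

Definition invariants tau : C * C :=
  get [set g : C * C | forall z, ~ lattice tau z ->
    derive1 (wp tau) z ^+ 2 = 4 * wp tau z ^+ 3 - g.1 * wp tau z - g.2].

Definition g2 tau : C := (invariants tau).1.
Definition g3 tau : C := (invariants tau).2.

End Weierstrass.

(* Subsets of E_tau = C / (Z + Z tau), given by their preimages in C.         *)
Section Punctures.
Context {R : realType}.
Notation C := (cplx R).
Implicit Types (tau p : C).

Definition torsion2 tau : set C :=
  [set z | exists2 k : nat, (k <= 3)%N & lattice tau (z - omega tau k / 2)].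

Definition pm_points tau p : set C :=
  [set z | lattice tau (z - p) \/ lattice tau (z + p)].

Definition singular_points tau p : set C := torsion2 tau `|` pm_points tau p.

(* L + Lambda_tau, for L the straight segment from p to -p. *)
Definition segment_translates tau p : set C :=
  [set z | exists2 s : R, 0 <= s <= 1 &
     lattice tau (z - ((1 - s%:C) * p + s%:C * - p))].

End Punctures.

Section Equation.
Context {R : realType}.
Notation C := (cplx R).
Variables (tau p A : C).

Definition B_apparent : C :=
  A ^+ 2 - zeta tau (2 * p) * A - 3 / 4 * wp tau (2 * p) - 2 * wp tau p.

Definition potential (z : C) : C :=
  2 * wp tau z + 3 / 4 * (wp tau (z + p) + wp tau (z - p))
  + A * (zeta tau (z + p) - zeta tau (z - p)) + B_apparent.

Definition local_solution (q0 : C) (y : C -> C) : Prop :=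
  \forall z \near q0, [/\ derivable y z 1, derivable (derive1 y) z 1 &
    derive1 (derive1 y) z = potential z * y z].

(* Basis of the space of germs at q0 of solutions. *)
Definition local_basis (q0 : C) (y : 'I_2 -> C -> C) : Prop :=
  (forall i, local_solution q0 (y i)) /\
  (forall f, local_solution q0 f ->
    exists! c : 'rV[C]_2, \forall z \near q0, f z = \sum_j c 0 j * y j z).

End Equation.

(* A loop of E_tau based at (the class of) q0 is represented by its lift to C *)
(* starting at q0, a function on [0, 1] (the values elsewhere are irrelevant).*)
Section Paths.
Context {R : realType}.
Notation C := (cplx R).
Implicit Types (tau : C) (D : set C) (f g l : R -> C).

Definition torus_loop tau D (q0 : C) l : Prop :=
  [/\ {within `[0, 1], continuous l}, l 0 = q0, lattice tau (l 1 - q0) &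
      forall t : R, 0 <= t <= 1 -> D (l t)].

(* Lift of the composite loop "f, then g": the lift of g is translated so as  *)
(* to start where that of f ends.                                             *)
Definition loop_cat f g : R -> C :=
  fun t => if t <= 2^-1 then f (2 * t) else g (2 * t - 1) + (f 1 - g 0).

(* Lift of the inverse loop, starting at f 0. *)
Definition loop_inv f : R -> C := fun t => f (1 - t) + (f 0 - f 1).

Definition loop_comm f g : R -> C :=
  loop_cat (loop_cat (loop_cat f g) (loop_inv f)) (loop_inv g).

(* Homotopy in D with fixed end points. For D the preimage of an open subset  *)
(* of E_tau, it is equivalent to homotopy of the projections to E_tau.        *)
Definition homotopic D f g : Prop :=
  exists H : R * R -> C,
    [/\ {within `[0, 1] `*` `[0, 1], continuous H},
        forall s t : R, 0 <= s <= 1 -> 0 <= t <= 1 -> D (H (s, t)),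
        forall t : R, 0 <= t <= 1 -> H (0, t) = f t,
        forall t : R, 0 <= t <= 1 -> H (1, t) = g t &
        forall s : R, 0 <= s <= 1 -> H (s, 0) = f 0 /\ H (s, 1) = f 1].

(* The winding number of the closed curve l about a is n. *)
Definition winding l (a : C) (n : int) : Prop :=
  exists theta : R -> R,
    [/\ {within `[0, 1], continuous theta},
        forall t : R, 0 <= t <= 1 ->
          0 < `|l t - a| /\
          l t - a = `|l t - a| * (cos (theta t) +i* sin (theta t)) &
        theta 1 - theta 0 = 2 * pi * n%:~R].

(* l is a simple loop of E_tau minus the singular points encircling once,     *)
(* counterclockwise, the class of a, and no other class of +-p: its lift is   *)
(* closed, injective modulo the lattice, and turns once around one            *)
(* representative of a and not around the other points of +-p + Lambda_tau.   *)
Definition simple_loop_around tau p (q0 a : C) l : Prop :=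
  [/\ torus_loop tau (~` singular_points tau p) q0 l, l 1 = q0,
      forall s t : R, 0 <= s < 1 -> 0 <= t < 1 -> lattice tau (l s - l t) -> s = t &
      exists2 w, lattice tau w & winding l (a + w) 1 /\
        forall b, pm_points tau p b -> b != a + w -> winding l b 0].

(* l1, l2 are fundamental cycles of E_tau joining q0 to q0 + omega_j, off     *)
(* L + Lambda_tau, with gamma_+ gamma_- = l1 l2 l1^-1 l2^-1 in the            *)
(* fundamental group of E_tau minus {+-p}.                                    *)
Definition fundamental_cycles tau p (q0 : C) (l1 l2 : R -> C) : Prop :=
  let X := ~` singular_points tau p `&` ~` segment_translates tau p in
  [/\ torus_loop tau X q0 l1 /\ l1 1 = q0 + omega tau 1,
      torus_loop tau X q0 l2 /\ l2 1 = q0 + omega tau 2 &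
      exists gp gm : R -> C,
        [/\ simple_loop_around tau p q0 p gp,
            simple_loop_around tau p q0 (- p) gm &
            homotopic (~` pm_points tau p) (loop_cat gp gm) (loop_comm l1 l2)]].

End Paths.

Section Monodromy.
Context {R : realType}.
Notation C := (cplx R).

(* The germ of g at l 1 is the analytic continuation along l of the germ of f *)
(* at l 0: F t is a holomorphic germ at l t for all t, and F s and F t agree  *)
(* near l s when s is close to t.                                             *)
Definition continuation (l : R -> C) (f g : C -> C) : Prop :=
  exists F : R -> C -> C,
    [/\ forall t : R, 0 <= t <= 1 -> \forall z \near l t, derivable (F t) z 1,
        \forall z \near l 0, F 0 z = f z,
        \forall z \near l 1, F 1 z = g z &
        forall t : R, 0 <= t <= 1 -> \forall s \near t, 0 <= s <= 1 ->
          \forall z \near l s, F s z = F t z].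

(* l^* (y_0, y_1)^T = rho(l) (y_0, y_1)^T for all loops l based at q0. The    *)
(* continuation of y_i along the lift l lives near l 1, and is compared with  *)
(* the basis (y_0, y_1) at q0 = l 0 through the translation by l 1 - l 0.     *)
Definition monodromy_rep (tau p q0 : C) (y : 'I_2 -> C -> C)
    (rho : (R -> C) -> 'M[C]_2) : Prop :=
  forall l, torus_loop tau (~` singular_points tau p) q0 l ->
  forall i, continuation l (y i)
    (fun z => \sum_j rho l i j * y j (z - (l 1 - l 0))).

(* Up to a common conjugation, the monodromy matrices of the equation with    *)
(* parameter A along l1, l2 are N1, N2.                                       *)
Definition monodromy_conj (tau p A q0 : C) (l1 l2 : R -> C)
    (N1 N2 : 'M[C]_2) : Prop :=
  exists (y : 'I_2 -> C -> C) (rho : (R -> C) -> 'M[C]_2),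
    [/\ local_basis tau p A q0 y, monodromy_rep tau p q0 y rho &
        exists2 P : 'M[C]_2, P \in unitmx &
          rho l1 = P *m N1 *m invmx P /\ rho l2 = P *m N2 *m invmx P].

(* C U {oo} is represented by option C, with None for oo. *)

(* v is the value at c of the rational function num / den. The two rational   *)
(* functions this is used for are in lowest terms, so the points c with       *)
(* den c = 0 are poles, where no v : C is the value. At oo, x = 1 / c -> 0.   *)
Definition ratfun_value (num den : C -> C) (c : option C) (v : C) : Prop :=
  if c is Some c0 then den c0 != 0 /\ v = num c0 / den c0
  else (num x^-1 / den x^-1) @[x --> (0 : C)^'] --> v.

Definition lower_unip (c : C) : 'M[C]_2 :=
  \matrix_(i, j) (if i == j then 1 else if (j < i)%N then c else 0).

Definition mono1 (c : option C) : 'M[C]_2 :=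
  if c is Some _ then lower_unip 1 else 1%:M.

Definition mono2 (c : option C) : 'M[C]_2 :=
  if c is Some c0 then lower_unip c0 else lower_unip 1.

Definition epsilon (k : nat) : C * C :=
  match k with 1%N => (1, -1) | 2%N => (-1, 1) | _ => (-1, -1) end.

End Monodromy.

(* Main.v *)
Require Import Defs.
From HB Require Import structures.
From mathcomp Require Import all_boot all_order all_algebra complex.
From mathcomp Require Import all_classical all_reals all_analysis.
From mathcomp Require Import ring lra zify.
Import Order.TTheory GRing.Theory Num.Theory.
Import numFieldNormedType.Exports.
Local Open Scope classical_set_scope.
Local Open Scope ring_scope.
Set Implicit Arguments.
Unset Strict Implicit.
Unset Printing Implicit Defensive.

(* Write u = wp and P = u p. For a suitable A the substitution
   y = N / sqrt (u - P) gives explicit solutions of the equation: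
     part (1): N1 = u - Y,  N2 = N1 (2 zeta + 2 Y z) + u';
     part (2): N1 = v',     N2 = N1 (2 al zeta + 2 Y z) + v (2 al v^2 + 2 Y + 4 al e_k),
   where v = sqrt (u - e_k) is meromorphic on C and a period only changes its
   sign. The Wronskian N1 N2' - N1' N2 is a multiple of u - P precisely under
   the hypothesis on wp p, with Y / al = - (C eta_1 - eta_2) / (C - tau).
   Translation by omega_j multiplies (N1, N2) by a sign times a unipotent
   matrix with entry 2 (al eta_j + Y omega_j), and the ratio of these two
   entries is C because of tau eta_1 <> eta_2. The only other contribution to
   the monodromy is the sign of sqrt (u - P) along l_j; it is +1, as moving the
   branch points +-p to 0 along L, which l_j avoids, makes the quotient
   (u (l t) - u p) / (u (l 0) - u p) constant.

   The identities between elliptic functions come from Liouville's theorem,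
   which is derived from a maximum principle for twice complex differentiable
   functions, and tau eta_1 <> eta_2 from the signs of imaginary parts of
   partial sums of zeta (z + omega_j) - zeta z. *)

(** * Complex differentiation *)

(** The form of the solutions is dictated by the local exponents. They are -1/2, 3/2 at +-p and -1,
    2 at 0, so y sqrt (u - P) has exponents 0, 2 at +-p and -2, 1 at 0: the first numerator should
    be, up to signs under translation, elliptic with at most a double pole at 0. Taking it even
    leaves u - Y when both signs are +1, and v' for each of the three other choices. The second one
    comes from reduction of order, N2 / N1 being a primitive of a constant times (u - P) / N1^2. In
    part (1) this primitive has no logarithm at the zeros of u - Y when a residue vanishes, which is
    cubic in Y. In part (2) the zeros of v' are half periods, around which u is even; no residue
    occurs, and a linear condition on al and Y remains, which fits the coefficients of zeta and z to
    P. The parameter A is then read off from y = h^(-1/2) (1 + A h + ...) at z = p + h. No contour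
    integrals are involved: holomorphy is represented by two complex derivatives, and continuation
    by square roots with positive real part. *)

Section Modulus.
Context {R : realType}.
Notation C := (cplx R).
Implicit Types (z w : C) (x e : R).

(** The norm of [cplx R] takes values in [cplx R] itself; its real part brings all estimates into
    the ordered field [R], within reach of [lra]. *)
Definition cmod z : R := complex.Re `|z|.
Definition cr x : C := (x%:C)%C.

Lemma cmodE z : `|z| = cr (cmod z).
Proof. by rewrite /cmod /cr; case: (`|z|) (normr_ge0 z) => a b; rewrite lecE /= => /andP[/eqP -> _]. Qed.

Lemma crD x y : cr (x + y) = cr x + cr y.
Proof. exact: (rmorphD (real_complex R)). Qed.
Lemma crM x y : cr (x * y) = cr x * cr y.
Proof. exact: (rmorphM (real_complex R)). Qed.
Lemma crN x : cr (- x) = - cr x.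
Proof. exact: (rmorphN (real_complex R)). Qed.
Lemma crB x y : cr (x - y) = cr x - cr y.
Proof. exact: (rmorphB (real_complex R)). Qed.
Lemma crV x : cr (x^-1) = (cr x)^-1.
Proof. exact: (fmorphV (real_complex R)). Qed.
Lemma cr0 : cr 0 = 0. Proof. by []. Qed.
Lemma cr1 : cr 1 = 1. Proof. by []. Qed.
Lemma cr_nat n : cr n%:R = n%:R.
Proof. exact: (rmorph_nat (real_complex R)). Qed.
Lemma cr_int (n : int) : cr n%:~R = n%:~R.
Proof. exact: (rmorph_int (real_complex R)). Qed.
Lemma cr_inj : injective cr. Proof. by move=> x y []. Qed.
Lemma cr_eq0 x : (cr x == 0) = (x == 0).
Proof. by apply/eqP/eqP => [[]//|->]. Qed.
Lemma ler_cr x y : (cr x <= cr y) = (x <= y). Proof. exact: lecR. Qed.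
Lemma ltr_cr x y : (cr x < cr y) = (x < y). Proof. exact: ltcR. Qed.

Lemma pos_cr (e : C) : 0 < e -> e = cr (complex.Re e) /\ 0 < complex.Re e.
Proof. by case: e => a b; rewrite ltcE /= => /andP[/eqP -> ?]. Qed.

Lemma cmod_ge0 z : 0 <= cmod z.
Proof. by rewrite -ler_cr -cmodE cr0. Qed.
Lemma cmodD z w : cmod (z + w) <= cmod z + cmod w.
Proof. by rewrite -ler_cr crD -!cmodE ler_normD. Qed.
Lemma cmodM z w : cmod (z * w) = cmod z * cmod w.
Proof. by apply: cr_inj; rewrite crM -!cmodE normrM. Qed.
Lemma cmodN z : cmod (- z) = cmod z.
Proof. by apply: cr_inj; rewrite -!cmodE normrN. Qed.
Lemma cmodV z : cmod (z^-1) = (cmod z)^-1.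
Proof. by apply: cr_inj; rewrite crV -!cmodE normfV. Qed.
Lemma cmodX z n : cmod (z ^+ n) = cmod z ^+ n.
Proof.
elim: n => [|n IH]; last by rewrite !exprS cmodM IH.
by apply: cr_inj; rewrite -cmodE !expr0 normr1.
Qed.
Lemma cmod_cr x : cmod (cr x) = `|x|.
Proof.
apply: cr_inj; rewrite -cmodE.
case: (lerP 0 x) => hx; first by rewrite [in RHS]ger0_norm // ger0_norm // -cr0 ler_cr.
by rewrite (ltr0_norm hx) -normrN -crN ger0_norm // -cr0 ler_cr oppr_ge0 ltW.
Qed.
Lemma cmod0 : cmod (0 : C) = 0. Proof. by rewrite -cr0 cmod_cr normr0. Qed.
Lemma cmod1 : cmod (1 : C) = 1. Proof. by rewrite -cr1 cmod_cr normr1. Qed.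
Lemma cmod_eq0 z : (cmod z == 0) = (z == 0).
Proof. by rewrite -cr_eq0 -cmodE normr_eq0. Qed.
Lemma cmod_gt0 z : (0 < cmod z) = (z != 0).
Proof. by rewrite lt_neqAle eq_sym cmod_eq0 cmod_ge0 andbT. Qed.
Lemma cmod_nat n : cmod (n%:R : C) = n%:R.
Proof. by rewrite -cr_nat cmod_cr ger0_norm // ler0n. Qed.
Lemma cmodB z w : cmod (z - w) <= cmod z + cmod w.
Proof. by rewrite -(cmodN w); apply: cmodD. Qed.
Lemma cmodBC z w : cmod (z - w) = cmod (w - z).
Proof. by rewrite -cmodN opprB. Qed.
Lemma cmod_lb z w : cmod z - cmod w <= cmod (z + w).
Proof.
have := cmodB (z + w) w; rewrite addrK; move: (cmod z) (cmod w) (cmod _) => a b c; lra.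
Qed.
Lemma cmod_sum (I : Type) (r : seq I) (P : pred I) (F : I -> C) :
  cmod (\sum_(i <- r | P i) F i) <= \sum_(i <- r | P i) cmod (F i).
Proof.
elim/big_rec2: _ => [|i y1 y2 _ h]; first by rewrite cmod0.
by apply: le_trans (cmodD _ _) _; rewrite lerD2l.
Qed.

Lemma ReD z w : complex.Re (z + w) = complex.Re z + complex.Re w.
Proof. by case: z w => ? ? []. Qed.
Lemma ImD z w : complex.Im (z + w) = complex.Im z + complex.Im w.
Proof. by case: z w => ? ? []. Qed.
Lemma ReN z : complex.Re (- z) = - complex.Re z.
Proof. by case: z. Qed.
Lemma ImN z : complex.Im (- z) = - complex.Im z.
Proof. by case: z. Qed.
Lemma ReM z w : complex.Re (z * w) =
  complex.Re z * complex.Re w - complex.Im z * complex.Im w.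
Proof. by case: z w => ? ? []. Qed.
Lemma ImM z w : complex.Im (z * w) =
  complex.Re z * complex.Im w + complex.Im z * complex.Re w.
Proof. by case: z w => ? ? []. Qed.
Lemma crReIm z : z = cr (complex.Re z) + cr (complex.Im z) * 'i%C.
Proof. by apply/eqP; rewrite eq_complex !(ReD, ImD, ReM, ImM) /=; apply/andP; split; apply/eqP; ring. Qed.
Lemma cmod_sq z : cmod z ^+ 2 = complex.Re z ^+ 2 + complex.Im z ^+ 2.
Proof.
apply: cr_inj; rewrite expr2 crM -cmodE -expr2 -add_Re2_Im2.
by [].
Qed.
Lemma Re_le_cmod z : `|complex.Re z| <= cmod z.
Proof.
rewrite -(@ler_pXn2r _ 2) ?nnegrE ?cmod_ge0 // cmod_sq real_normK ?num_real //.
by rewrite lerDl sqr_ge0.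
Qed.
Lemma Im_le_cmod z : `|complex.Im z| <= cmod z.
Proof.
rewrite -(@ler_pXn2r _ 2) ?nnegrE ?cmod_ge0 // cmod_sq real_normK ?num_real //.
by rewrite lerDr sqr_ge0.
Qed.
Lemma cmod_le_ReIm z : cmod z <= `|complex.Re z| + `|complex.Im z|.
Proof.
rewrite {1}(crReIm z); apply: le_trans (cmodD _ _) _.
rewrite cmodM !cmod_cr; suff -> : cmod ('i%C : C) = 1 by rewrite mulr1.
have := cmod_sq ('i%C : C); rewrite /= => h.
have : (cmod ('i%C : C) - 1) * (cmod ('i%C : C) + 1) = 0 by move: h; set t := cmod _; move=> h; ring: h.
move/eqP; rewrite mulf_eq0 => /orP[|] /eqP H; first by lra.
have := cmod_ge0 ('i%C : C); lra.
Qed.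

Lemma cplx_eq z w : complex.Re z = complex.Re w -> complex.Im z = complex.Im w -> z = w.
Proof. by case: z w => a b [c d] /= -> ->. Qed.

Lemma nearP (z : C) (P : C -> Prop) :
  (\forall w \near z, P w) <->
  exists2 d : R, 0 < d & forall w, cmod (w - z) < d -> P w.
Proof.
split.
  case/nbhs_ballP => e /= e0 h.
  have [ee e'0] := pos_cr e0; exists (complex.Re e) => // w hw.
  by apply: h; rewrite -ball_normE /= ee cmodE ltr_cr cmodBC.
case=> d d0 h; apply/nbhs_ballP; exists (cr d); first by rewrite /= -cr0 ltr_cr.
by move=> w; rewrite -ball_normE /= cmodE ltr_cr cmodBC => /h.
Qed.

Lemma near0P (z : C) (P : C -> Prop) :
  (\forall w \near z, P w) <->
  exists2 d : R, 0 < d & forall h, cmod h < d -> P (z + h).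
Proof.
rewrite nearP; split => -[d d0 h]; exists d => // w hw.
  by apply: h; rewrite addrC addKr.
by rewrite -[w](subrK z) addrC; apply: h.
Qed.

(* The difference quotient of the library, freed of its division. *)
Definition cderiv (f : C -> C) (z d : C) : Prop :=
  forall e : R, 0 < e -> exists2 r : R, 0 < r &
    forall h, cmod h < r -> cmod (f (z + h) - f z - d * h) <= e * cmod h.

Lemma is_deriveP (f : C -> C) (z d : C) : is_derive z (1 : C) f d <-> cderiv f z d.
Proof.
split=> [[df dv]|H].
  move=> e e0.
  have : (fun h => h^-1 *: ((f \o shift z) (h *: (1 : C)) - f z)) @ (0 : C)^' --> d.
    by rewrite -dv.
  move/cvgrPdist_lt => /(_ (cr e)); rewrite -cr0 ltr_cr => /(_ e0).
  rewrite /prop_near1 /= => /(nearP 0) [r r0 h].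
  exists r => // k hk; have [->|k0] := eqVneq k 0.
    by rewrite addr0 subrr mulr0 subr0 cmod0 mulr0.
  have := h k; rewrite subr0 => /(_ hk k0); rewrite cmodE ltr_cr /= => H.
  have -> : f (z + k) - f z - d * k = - (k * (d - k^-1 *: (f (k *: (1 : C) + z) - f z))).
    rewrite mulrBr -[_ *: (_ - _)]/(_ * _) mulrA divff // mul1r.
    have -> : k *: (1 : C) = k by exact: mulr1.
    by rewrite (addrC k z); ring.
  by rewrite cmodN cmodM mulrC ler_wpM2r ?cmod_ge0 // ltW.
have cv : (fun h => h^-1 *: ((f \o shift z) (h *: (1 : C)) - f z)) @ (0 : C)^' --> d.
  apply/cvgrPdist_le => e /pos_cr [-> e0].
  have [r r0 h] := H _ e0.
  apply/(nearP 0); exists r => // k; rewrite subr0 => hk /= k0.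
  rewrite cmodE ler_cr -[_ *: _]/(_ * _).
  have -> : k *: (1 : C) = k by exact: mulr1.
  have -> : d - k^-1 * (f (k + z) - f z) = - (k^-1 * (f (z + k) - f z - d * k)).
    by rewrite (addrC z k); field.
  rewrite cmodN cmodM cmodV mulrC ler_pdivrMr ?cmod_gt0 //; exact: h.
split; first by apply/cvg_ex; exists d.
exact: cvg_lim cv.
Qed.

End Modulus.

(** * Rules for continuity and derivatives *)

Section Calculus.
Context {R : realType}.
Notation C := (cplx R).
Implicit Types (f g : C -> C) (z w a b : C) (e r : R).

Definition ccont f z := forall e, 0 < e ->
  exists2 r, 0 < r & forall h, cmod h < r -> cmod (f (z + h) - f z) < e.

Lemma cderivD f g z a b : cderiv f z a -> cderiv g z b ->
  cderiv (fun x => f x + g x) z (a + b).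
Proof. by move=> /is_deriveP ? /is_deriveP ?; apply/is_deriveP; apply: is_deriveD. Qed.

Lemma cderivN f z a : cderiv f z a -> cderiv (fun x => - f x) z (- a).
Proof. by move=> /is_deriveP ?; apply/is_deriveP; apply: is_deriveN. Qed.

Lemma cderivB f g z a b : cderiv f z a -> cderiv g z b ->
  cderiv (fun x => f x - g x) z (a - b).
Proof. by move=> ? ?; apply: cderivD => //; apply: cderivN. Qed.

Lemma cderiv_eq f z a b : cderiv f z a -> a = b -> cderiv f z b.
Proof. by move=> ? <-. Qed.

Lemma cderivM f g z a b : cderiv f z a -> cderiv g z b ->
  cderiv (fun x => f x * g x) z (a * g z + f z * b).
Proof.
move=> /is_deriveP ? /is_deriveP ?; apply/is_deriveP.
by apply: is_derive_eq; rewrite addrC mulrC.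
Qed.

Lemma cderivC (c : C) z : cderiv (fun=> c) z 0.
Proof. by apply/is_deriveP; apply: is_derive_cst. Qed.

Lemma cderivI z : cderiv id z 1.
Proof. by apply/is_deriveP; apply: is_derive_id. Qed.

Lemma cderivZ f z a (c : C) : cderiv f z a -> cderiv (fun x => c * f x) z (c * a).
Proof. by move=> h; apply: cderiv_eq (cderivM (cderivC c z) h) _; rewrite mul0r add0r. Qed.

Lemma cderivV f z a : f z != 0 -> cderiv f z a ->
  cderiv (fun x => (f x)^-1) z (- a / f z ^+ 2).
Proof.
move=> f0 /is_deriveP [df <-]; apply/is_deriveP; split; first exact: derivableV.
by rewrite deriveV // -[LHS]/(_ * _) mulrC mulNr mulrN.
Qed.

Lemma cderiv_div f g z a b : g z != 0 -> cderiv f z a -> cderiv g z b ->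
  cderiv (fun x => f x / g x) z ((a * g z - f z * b) / g z ^+ 2).
Proof.
move=> g0 hf hg; apply: cderiv_eq (cderivM hf (cderivV g0 hg)) _.
by field.
Qed.

Lemma cderiv_cont f z a : cderiv f z a -> ccont f z.
Proof.
move=> H e e0; have [r r0 h] := H 1 ltr01.
have k0 : 0 < 1 + cmod a by have := cmod_ge0 a; lra.
exists (Num.min r (e / (1 + cmod a))); first by rewrite lt_min r0 divr_gt0.
move=> k; rewrite lt_min => /andP[/h hk]; rewrite ltr_pdivlMr // => hk2.
apply: le_lt_trans hk2.
have -> : f (z + k) - f z = (f (z + k) - f z - a * k) + a * k by ring.
apply: le_trans (cmodD _ _) _; rewrite cmodM.
by move: hk; move: (cmod _) (cmod a) (cmod k) => x y t; lra.
Qed.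

Lemma cderiv_ext f g z a : (\forall w \near z, f w = g w) -> cderiv f z a -> cderiv g z a.
Proof.
move=> /near0P[d d0 hd] H e e0; have [r r0 h] := H e e0.
exists (Num.min r d); first by rewrite lt_min r0.
move=> k; rewrite lt_min => /andP[kr kd]; rewrite -hd // -(addr0 z) -hd ?cmod0 //.
by rewrite addr0; apply: h.
Qed.

Lemma cderiv_unique f z a b : cderiv f z a -> cderiv f z b -> a = b.
Proof. by move=> /is_deriveP [_ <-] /is_deriveP [_ <-]. Qed.

Lemma ccontD f g z : ccont f z -> ccont g z -> ccont (fun x => f x + g x) z.
Proof.
move=> hf hg e e0; have e2 : 0 < e / 2 by lra.
have [r r0 h] := hf _ e2; have [s s0 k] := hg _ e2.
exists (Num.min r s); first by rewrite lt_min r0.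
move=> t; rewrite lt_min => /andP[/h tr /k ts].
have -> : f (z + t) + g (z + t) - (f z + g z) = (f (z + t) - f z) + (g (z + t) - g z) by ring.
by apply: le_lt_trans (cmodD _ _) _; move: tr ts; move: (cmod _) (cmod _) => x y; lra.
Qed.

Lemma ccontM f g z : ccont f z -> ccont g z -> ccont (fun x => f x * g x) z.
Proof.
move=> hf hg e e0.
set K := 1 + cmod (f z) + cmod (g z).
have Kf := cmod_ge0 (f z); have Kg := cmod_ge0 (g z).
have K1 : 1 <= K by rewrite /K; lra.
set d := Num.min 1 (e / (2 * K)).
have d0 : 0 < d by rewrite lt_min ltr01 divr_gt0 //; lra.
have d1 : d <= 1 by rewrite ge_min lexx.
have d2 : 2 * K * d <= e.
  by rewrite mulrC -ler_pdivlMr ?ge_min ?lexx ?orbT //; lra.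
have [r r0 h] := hf _ d0; have [s s0 k] := hg _ d0.
exists (Num.min r s); first by rewrite lt_min r0.
move=> t; rewrite lt_min => /andP[/h tr /k ts].
set x := f (z + t) - f z in tr *; set y := g (z + t) - g z in ts *.
have -> : f (z + t) * g (z + t) - (f z * g z) = x * y + x * g z + f z * y by rewrite /x /y; ring.
apply: le_lt_trans (cmodD _ _) _; rewrite cmodM.
apply: le_lt_trans (lerD (cmodD _ _) (lexx _)) _; rewrite !cmodM.
have x0 := cmod_ge0 x; have y0 := cmod_ge0 y.
clearbody d; move: tr ts d2 x0 y0 K1 Kf Kg d0 d1; rewrite /K.
move: (cmod x) (cmod y) (cmod (f z)) (cmod (g z)) => X Y F G *.
have h1 : X * Y <= d * 1 by rewrite ler_pM //; lra.
have h2 : X * G <= d * G by rewrite ler_wpM2r // ltW.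
have h3 : F * Y <= F * d by rewrite ler_wpM2l // ltW.
have h4 : 0 < d * (1 + F + G) by rewrite mulr_gt0 //; lra.
lra.
Qed.

Lemma ccontC (c : C) z : ccont (fun=> c) z.
Proof. by move=> e e0; exists 1 => // h _; rewrite subrr cmod0. Qed.

Lemma ccontI z : ccont id z.
Proof. by move=> e e0; exists e => // h; rewrite addrC addKr. Qed.

Lemma ccont_near_neq f z c : ccont f z -> f z != c -> \forall w \near z, f w != c.
Proof.
move=> h fz; have e0 : 0 < cmod (f z - c) by rewrite cmod_gt0 subr_eq0.
have [r r0 H] := h _ e0; apply/near0P; exists r => // k /H.
apply: contraTneq => ->; rewrite cmodBC ltxx //.
Qed.

Lemma cderiv_comp f g z a b : cderiv g z b -> cderiv f (g z) a ->
  cderiv (fun x => f (g x)) z (a * b).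
Proof.
move=> hg hf e e0.
set K := 1 + cmod a + cmod b.
have ha := cmod_ge0 a; have hb := cmod_ge0 b.
have K1 : 1 <= K by rewrite /K; lra.
set d := Num.min 1 (e / (2 * K)).
have d0 : 0 < d by rewrite lt_min ltr01 divr_gt0 //; lra.
have d1 : d <= 1 by rewrite ge_min lexx.
have d2 : 2 * K * d <= e.
  by rewrite mulrC -ler_pdivlMr ?ge_min ?lexx ?orbT //; lra.
have [r r0 h] := hf _ d0; have [s s0 k] := hg _ d0.
have [t t0 hc] := cderiv_cont hg r0.
exists (Num.min s t); first by rewrite lt_min s0.
move=> x; rewrite lt_min => /andP[/k xs /hc xt].
have := h _ xt; rewrite (addrC (g z)) subrK => xh.
set y := g (z + x) - g z in xs xt xh.
have -> : f (g (z + x)) - f (g z) - a * b * x =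
  (f (g (z + x)) - f (g z) - a * y) + a * (y - b * x) by ring.
apply: le_trans (cmodD _ _) _; rewrite cmodM.
have yb : cmod y <= (cmod b + d) * cmod x.
  have -> : y = (y - b * x) + b * x by ring.
  apply: le_trans (cmodD _ _) _; rewrite cmodM.
  by move: xs; move: (cmod _) (cmod b) (cmod x) => p q v; lra.
have x0 := cmod_ge0 x.
move: xs xh yb; move: (cmod (f _ - _ - _)) (cmod (y - _)) => p q xs xh yb.
have y0 := cmod_ge0 y.
have h1 : p <= d * ((cmod b + 1) * cmod x).
  apply: le_trans xh _; rewrite ler_pM2l //; apply: le_trans yb _.
  by rewrite ler_wpM2r // lerD2l.
have h2 : cmod a * q <= cmod a * (d * cmod x) by rewrite ler_wpM2l.
have h3 : (2 * K * d) * cmod x <= e * cmod x by rewrite ler_wpM2r.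
have h4 : 0 <= d * cmod x by rewrite mulr_ge0 // ltW.
have h5 : 0 <= cmod a * (d * cmod x) by rewrite mulr_ge0.
have h6 : 0 <= cmod b * (d * cmod x) by rewrite mulr_ge0.
clearbody d; move: h1 h2 h3 h4 h5 h6; rewrite /K; move: (cmod a) (cmod b) (cmod x) => A B X; lra.
Qed.

Lemma cderiv_shift f z a (c : C) : cderiv f (z + c) a -> cderiv (fun x => f (x + c)) z a.
Proof.
move=> h; apply: cderiv_eq (cderiv_comp (cderivD (cderivI z) (cderivC c z)) h) _.
by rewrite addr0 mulr1.
Qed.

Lemma ccont_comp f g z : ccont g z -> ccont f (g z) -> ccont (fun x => f (g x)) z.
Proof.
move=> hg hf e /hf [r r0 h]; have [s s0 k] := hg _ r0.
by exists s => // x /k /h; rewrite (addrC (g z)) subrK.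
Qed.

Lemma cderivX2 z : cderiv (fun x : C => x ^+ 2) z (2 * z).
Proof. by apply: cderiv_eq (cderivM (cderivI z) (cderivI z)) _; ring. Qed.

Lemma cderiv_sqrt f g z a : ccont g z -> g z != 0 ->
  (\forall w \near z, g w ^+ 2 = f w) -> cderiv f z a ->
  cderiv g z (a / (2 * g z)).
Proof.
move=> cg g0 /near0P[r0 r00 hs] hf.
have fz : f z = g z ^+ 2 by rewrite -{1}(addr0 z) -hs ?cmod0 // addr0.
(* Caratheodory: (g w - g z) = (f w - f z) / (g w + g z) *)
have cq : ccont (fun w => g w + g z) z by apply: ccontD => //; apply: ccontC.
have g20 : g z + g z != 0 by rewrite -mulr2n mulrn_eq0.
have G0 : 0 < cmod (g z + g z) by rewrite cmod_gt0.
set m := cmod (g z + g z) in G0.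
move=> e e0.
have e1 : 0 < e * m / 4 by rewrite !(mulr_gt0, divr_gt0).
have [r1 r10 h1] := hf _ e1.
have ha := cmod_ge0 a.
have e2 : 0 < Num.min (m / 2) (e * m ^+ 2 / (4 * (1 + cmod a))).
  rewrite lt_min !divr_gt0 //= ?mulr_gt0 ?exprn_gt0 //; lra.
have [r2 r20 h2] := cq _ e2.
exists (Num.min r0 (Num.min r1 r2)); first by rewrite !lt_min r00 r10.
move=> h; rewrite !lt_min => /andP[hr0 /andP[hr1 /h2]].
have -> : g (z + h) + g z - (g z + g z) = g (z + h) - g z by ring.
rewrite lt_min => /andP[k1 k2].
have hq := h1 _ hr1; rewrite -hs // fz in hq.
set s := g (z + h) + g z.
have ms : m / 2 <= cmod s.
  have -> : s = (g z + g z) + (g (z + h) - g z) by rewrite /s; ring.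
  apply: le_trans (cmod_lb _ _); move: k1; rewrite -/m; clearbody m; move: (cmod _) => x; lra.
have s0 : s != 0 by rewrite -cmod_gt0; apply: lt_le_trans ms; lra.
have E : g (z + h) - g z - a / (2 * g z) * h =
   ((g (z + h) ^+ 2 - g z ^+ 2 - a * h) - a * h * (g (z + h) - g z) / (g z + g z)) / s.
  have -> : g (z + h) ^+ 2 - g z ^+ 2 = (g (z + h) - g z) * s by rewrite /s; ring.
  have -> : g (z + h) - g z = s - (g z + g z) by rewrite /s; ring.
  by field; rewrite s0 g20 g0.

rewrite E cmodM cmodV ler_pdivrMr ?cmod_gt0 //.
apply: le_trans (cmodB _ _) _.
have h0 := cmod_ge0 h.
have step : cmod (a * h * (g (z + h) - g z) / (g z + g z)) <= e * m / 4 * cmod h.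
  rewrite cmodM cmodV -/m ler_pdivrMr // !cmodM.
  move: k2; rewrite ltr_pdivlMr; last by lra.
  move: (cmod a) (cmod h) (cmod (_ - _)) (cmod_ge0 (g (z + h) - g z)) ha h0 => A H' D D0 A0 H0 k2.
  have := ler_wpM2r H0 (ltW k2); nra.
have : e * cmod h * (m / 2) <= e * cmod h * cmod s by rewrite ler_wpM2l // mulr_ge0 // ltW.
move: hq step; clearbody m; move: (cmod (_ - _ - _)) (cmod (_ / _)) (cmod s) (cmod h) => *; lra.
Qed.

Lemma real_deriveP (f : R -> R) (t : R) (d : R) :
  (forall e, 0 < e -> exists2 r, 0 < r &
    forall h : R, `|h| < r -> `|f (t + h) - f t - d * h| <= e * `|h|) ->
  is_derive t (1 : R) f d.
Proof.
move=> H.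
have cv : (fun h : R => h^-1 *: ((f \o shift t) (h *: (1 : R)) - f t)) @ (0 : R)^' --> d.
  apply/cvgrPdist_le => e e0.
  have [r r0 h] := H _ e0.
  apply/nbhs_ballP; exists r => // k; rewrite /ball /= sub0r normrN => hk k0.
  rewrite -[_ *: _]/(_ * _).
  have -> : k *: (1 : R) = k by exact: mulr1.
  have -> : d - k^-1 * (f (k + t) - f t) = - (k^-1 * (f (t + k) - f t - d * k)).
    by rewrite (addrC t k); field.
  rewrite normrN normrM normrV ?unitfE // mulrC ler_pdivrMr ?normr_gt0 //; exact: h.
split; first by apply/cvg_ex; exists d.
exact: cvg_lim cv.
Qed.

Lemma real_derive_Re f (z b c d : C) (t : R) : cderiv f (z + cr t * b) d ->
  is_derive t (1 : R) (fun t => complex.Re (c * f (z + cr t * b))) (complex.Re (c * d * b)).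
Proof.
move=> H; apply: real_deriveP => e e0.
have K0 : 0 < 1 + cmod c * cmod b by have := mulr_ge0 (cmod_ge0 c) (cmod_ge0 b); lra.
have [r r0 hr] := H (e / (1 + cmod c * cmod b)) (divr_gt0 e0 K0).
have B0 : 0 < 1 + cmod b by have := cmod_ge0 b; lra.
exists (r / (1 + cmod b)); first exact: divr_gt0.
move=> h; rewrite ltr_pdivlMr // => hh.
have hb : cmod (cr h * b) < r.
  rewrite cmodM cmod_cr; apply: le_lt_trans hh; rewrite ler_wpM2l //; lra.
have := hr _ hb; set X := (X in cmod X <= _) => hX.
have -> : complex.Re (c * f (z + cr (t + h) * b)) - complex.Re (c * f (z + cr t * b)) -
    complex.Re (c * d * b) * h = complex.Re (c * X).
  have -> : z + cr (t + h) * b = z + cr t * b + cr h * b by rewrite crD; ring.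
  rewrite /X; set p := f _; set q := f _.
  have -> : c * (p - q - d * (cr h * b)) = c * p - c * q - c * d * b * cr h by ring.
  rewrite !(ReD, ReN) (ReM _ (cr h)) /= mulr0 subr0 //.
apply: le_trans (Re_le_cmod _) _; rewrite cmodM.
apply: le_trans (ler_wpM2l (cmod_ge0 c) hX) _.
rewrite cmodM cmod_cr; set H' := `|h|.
have hH : 0 <= H' by rewrite normr_ge0.
have hm : (e / (1 + cmod c * cmod b)) * (cmod c * cmod b) <= e.
  by rewrite mulrAC ler_pdivrMr // ler_wpM2l ?ltW //; lra.
by have := ler_wpM2r hH hm; move: (e / _) => k; lra.
Qed.

End Calculus.

(** * Mean value inequality and second-order expansions *)

Section MeanValue.
Context {R : realType}.
Notation C := (cplx R).
Implicit Types (f g : C -> C) (z w a b : C) (e r : R).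

(** The real mean value theorem is applied to t -> Re (conj D * f (a + t b)), with D the total
    increment: this function grows by |D|^2, and its slope is at most |D| K |b|. *)
Lemma cmvt f (g : C -> C) (a b : C) (K : R) :
  (forall t : R, 0 <= t <= 1 -> cderiv f (a + cr t * b) (g (a + cr t * b))) ->
  (forall t : R, 0 <= t <= 1 -> cmod (g (a + cr t * b)) <= K) ->
  cmod (f (a + b) - f a) <= K * cmod b.
Proof.
move=> hd hK; set D := f (a + b) - f a.
have [D0|D0] := eqVneq D 0; first by rewrite D0 cmod0 mulr_ge0 ?cmod_ge0 //; apply: le_trans (hK 0 _); rewrite ?cmod_ge0 // lexx ler01.
set c : C := (D^*)%C.
have der (t : R) : 0 <= t <= 1 -> is_derive t (1 : R) (fun t => complex.Re (c * f (a + cr t * b)))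
    (complex.Re (c * g (a + cr t * b) * b)) by move=> /hd; apply: real_derive_Re.
have [t|t|t] := @MVT_segment R (fun t => complex.Re (c * f (a + cr t * b)))
    (fun t => complex.Re (c * g (a + cr t * b) * b)) 0 1 ler01.
- by rewrite in_itv /= => /andP[? ?]; apply: der; rewrite !ltW.
- apply: continuous_in_subspaceT => x; rewrite inE /= in_itv /= => /der [+ _].
  by move/derivable1_diffP/differentiable_continuous.
rewrite in_itv /= => t01; rewrite subr0 mulr1 cr1 cr0 mul1r mul0r addr0.
have -> : complex.Re (c * f (a + b)) - complex.Re (c * f a) = cmod D ^+ 2.
  rewrite -ReN -ReD -mulrN -mulrDr -/D cmod_sq /c; case: (D) => x y /=; ring.
move=> E.
have Dp : 0 < cmod D by rewrite cmod_gt0.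
have cD : cmod c = cmod D.
  apply/eqP; rewrite -(@eqrXn2 _ 2) ?cmod_ge0 // !cmod_sq /c; case: (D) => x y /=.
  by rewrite sqrrN.
rewrite -(ler_pM2l Dp) -expr2 E.
apply: le_trans (ler_norm _) _; apply: le_trans (Re_le_cmod _) _.
rewrite -mulrA !cmodM cD ler_wpM2l ?cmod_ge0 // ler_wpM2r ?cmod_ge0 //.
exact: hK.
Qed.

Lemma cderiv0_const f (a b : C) :
  (forall t : R, 0 <= t <= 1 -> cderiv f (a + cr t * b) 0) -> f (a + b) = f a.
Proof.
move=> h; have := @cmvt f (fun=> 0) a b 0 h.
rewrite mul0r => /(_ _) H.
have : cmod (f (a + b) - f a) <= 0 by apply: H => t _; rewrite cmod0.
by move=> H0; apply/eqP; rewrite -subr_eq0 -cmod_eq0 eq_le H0 cmod_ge0.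
Qed.

(** Plays the part of holomorphy at z: it provides what the expansion [taylor2P] consumes, and it is
    stable under algebra and composition. *)
Definition twice f z := exists f1 a,
  (\forall w \near z, cderiv f w (f1 w)) /\ cderiv f1 z a.

Definition taylor2 f z a b := forall e, 0 < e -> exists2 r, 0 < r &
  forall h, cmod h < r -> cmod (f (z + h) - f z - a * h - b * h ^+ 2) <= e * cmod h ^+ 2.

(** Mean value inequality for the remainder F, whose derivative f1 (z + w) - f1 z - a w is o(w). *)
Lemma taylor2P f f1 z a : (\forall w \near z, cderiv f w (f1 w)) -> cderiv f1 z a ->
  taylor2 f z (f1 z) (a / 2).
Proof.
move=> /near0P[d d0 hd] h e e0; have [r r0 hr] := h e e0.
exists (Num.min d r); first by rewrite lt_min d0.
move=> k; rewrite lt_min => /andP[kd kr].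
pose F w := f (z + w) - f1 z * w - a / 2 * w ^+ 2.
have small (t : R) : 0 <= t <= 1 -> cmod (cr t * k) <= cmod k.
  by move=> /andP[t0 t1]; rewrite cmodM cmod_cr ger0_norm // ler_piMl ?cmod_ge0.
have -> : f (z + k) - f z - f1 z * k - a / 2 * k ^+ 2 = F (0 + k) - F 0.
  by rewrite /F add0r addr0; ring.
have -> : e * cmod k ^+ 2 = e * cmod k * cmod k by ring.
apply: (@cmvt F (fun w => f1 (z + w) - f1 z - a * w)) => t t01; rewrite add0r.
  apply: cderivB; last first.
    by apply: cderiv_eq (cderivZ _ (cderivX2 _)) _; field.
  apply: cderivB; last by apply: cderiv_eq (cderivZ _ (cderivI _)) _; rewrite mulr1.
  have hs := hd _ (le_lt_trans (small _ t01) kd).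
  have := @cderiv_shift _ f (cr t * k) (f1 (z + cr t * k)) z.
  rewrite addrC => /(_ hs); apply: cderiv_ext.
  by near=> w; rewrite addrC.
apply: le_trans (hr _ (le_lt_trans (small _ t01) kr)) _.
by apply: ler_wpM2l; [exact: ltW|exact: small].
Unshelve. all: by end_near. Qed.

Lemma twice_taylor f z : twice f z -> exists a b, taylor2 f z a b.
Proof. by move=> [f1 [a [h1 h2]]]; exists (f1 z), (a / 2); apply: taylor2P. Qed.

Lemma twice_cont f z : twice f z -> ccont f z.
Proof.
move=> [f1 [a [/near0P[d d0 h] _]]]; apply: (@cderiv_cont _ f z (f1 (z + 0))).
by rewrite -{1}(addr0 z); apply: h; rewrite cmod0.
Qed.

Lemma near_at (P : C -> Prop) z : (\forall w \near z, P w) -> P z.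
Proof. exact: nbhs_singleton. Qed.

Lemma twiceD f g z : twice f z -> twice g z -> twice (fun x => f x + g x) z.
Proof.
move=> [f1 [a [hf1 hf2]]] [g1 [b [hg1 hg2]]].
exists (fun x => f1 x + g1 x), (a + b); split; last exact: cderivD.
by near=> w; apply: cderivD; near: w.
Unshelve. all: by end_near. Qed.

Lemma twiceM f g z : twice f z -> twice g z -> twice (fun x => f x * g x) z.
Proof.
move=> [f1 [a [hf1 hf2]]] [g1 [b [hg1 hg2]]].
exists (fun x => f1 x * g x + f x * g1 x).
have hf := near_at hf1; have hg := near_at hg1.
exists ((a * g z + f1 z * g1 z) + (f1 z * g1 z + f z * b)); split; last first.
  by apply: cderivD; apply: cderivM.
by near=> w; apply: cderivM; near: w.
Unshelve. all: by end_near. Qed.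

Lemma twiceC (c : C) z : twice (fun=> c) z.
Proof. by exists (fun=> 0), 0; split; [near=> w|]; apply: cderivC. Unshelve. all: by end_near. Qed.

Lemma twiceI z : twice id z.
Proof. by exists (fun=> 1), 0; split; [near=> w; apply: cderivI|apply: cderivC]. Unshelve. all: by end_near. Qed.

Lemma twiceN f z : twice f z -> twice (fun x => - f x) z.
Proof.
move=> h; have -> : (fun x => - f x) = (fun x => (-1) * f x).
  by apply: funext => x; rewrite mulN1r.
by apply: twiceM => //; apply: twiceC.
Qed.

Lemma twiceB f g z : twice f z -> twice g z -> twice (fun x => f x - g x) z.
Proof. by move=> ? ?; apply: twiceD => //; apply: twiceN. Qed.

Lemma twiceX f z n : twice f z -> twice (fun x => f x ^+ n) z.
Proof.
move=> h; elim: n => [|n IH].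
  by have -> : (fun x => f x ^+ 0) = (fun=> 1) by []; apply: twiceC.
have -> : (fun x => f x ^+ n.+1) = (fun x => f x * f x ^+ n).
  by apply: funext => x; rewrite exprS.
exact: twiceM.
Qed.

Lemma near_ccont (g : C -> C) z (P : C -> Prop) : ccont g z -> (\forall w \near g z, P w) ->
  \forall w \near z, P (g w).
Proof.
move=> hg /nearP[d d0 h]; have [r r0 k] := hg _ d0.
by apply/near0P; exists r => // x /k; apply: h.
Qed.

Lemma twice_comp f g z : twice g z -> twice f (g z) -> twice (fun x => f (g x)) z.
Proof.
move=> tg; have cg := twice_cont tg; move: tg.
move=> [g1 [b [hg1 hg2]]] [f1 [a [hf1 hf2]]].
have hf1' := near_ccont cg hf1; have hg := near_at hg1.
exists (fun x => f1 (g x) * g1 x), ((a * g1 z) * g1 z + f1 (g z) * b); split.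
  by near=> w; apply: cderiv_comp; near: w.
by apply: cderivM => //; apply: cderiv_comp.
Unshelve. all: by end_near. Qed.

Lemma twice_inv z : z != 0 -> twice (fun x : C => x^-1) z.
Proof.
move=> z0; exists (fun x => - 1 / x ^+ 2), (- (- 1 * (2 * z)) / (z ^+ 2) ^+ 2); split.
  have := ccont_near_neq (@ccontI _ z) z0; apply: filterS => w w0.
  by apply: (cderivV w0 (cderivI w)).
apply: cderiv_eq (cderiv_div _ (cderivC _ _) (cderivX2 z)) _; first by rewrite expf_neq0.
by rewrite mul0r sub0r.
Qed.

Lemma twiceV f z : f z != 0 -> twice f z -> twice (fun x => (f x)^-1) z.
Proof. by move=> f0 hf; apply: (@twice_comp (fun x => x^-1) f) => //; apply: twice_inv. Qed.

Lemma twice_ext f g z : (\forall w \near z, f w = g w) -> twice f z -> twice g z.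
Proof.
move=> h [f1 [a [h1 h2]]]; exists f1, a; split=> //.
have h' := near_join h; near=> w; apply: (@cderiv_ext _ f); last by near: w.
by near: w.
Unshelve. all: by end_near. Qed.

End MeanValue.

(** * Maximum principle and Liouville's theorem *)

Section Liouville.
Context {R : realType}.
Notation C := (cplx R).
Implicit Types (f g F : C -> C) (phi : C -> R) (z w a b : C) (e r : R).

Definition rcont phi z := forall e, 0 < e -> exists2 r, 0 < r &
  forall h, cmod h < r -> `|phi (z + h) - phi z| < e.

(** Compactness is taken from subsets of [R * R]; this chart carries it to period parallelograms (a
    = 1, b = tau) and to discs (a = 1, b = i). *)
Definition affine_pt (o a b : C) (p : R * R) : C := o + cr p.1 * a + cr p.2 * b.

Lemma affine_pt_cont (o a b : C) (p : R * R) phi : rcont phi (affine_pt o a b p) ->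
  {for p, continuous (phi \o affine_pt o a b)}.
Proof.
move=> H; apply/cvgrPdist_lt => e e0; have [r r0 hr] := H e e0.
have K0 : 0 < 1 + cmod a + cmod b by have := cmod_ge0 a; have := cmod_ge0 b; lra.
have d0 : 0 < r / (1 + cmod a + cmod b) by apply: divr_gt0.
have := nbhsx_ballx p _ d0; apply: filterS => q [] /=.
rewrite /ball /= => q1 q2; rewrite distrC.
have -> : affine_pt o a b q = affine_pt o a b p + (cr (q.1 - p.1) * a + cr (q.2 - p.2) * b).
  by rewrite /affine_pt !crB; ring.
apply: hr; apply: le_lt_trans (cmodD _ _) _; rewrite !cmodM !cmod_cr.
rewrite distrC in q1; rewrite distrC in q2; rewrite ltr_pdivlMr // in q1; rewrite ltr_pdivlMr // in q2.
move: q1 q2; move: (cmod_ge0 a) (cmod_ge0 b) (normr_ge0 (q.1 - p.1)) (normr_ge0 (q.2 - p.2)).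
move: `|_| `|_| (cmod a) (cmod b) => x y A B A0 B0 x0 y0 h1 h2.
have : (y * A + x * B) * (1 + A + B) <= r * (A + B).
  have -> : (y * A + x * B) * (1 + A + B) = A * (y * (1 + A + B)) + B * (x * (1 + A + B)) by ring.
  by rewrite [leRHS]mulrC mulrDl lerD // ler_wpM2l // ltW.
move=> h3; rewrite -(ltr_pM2r (_ : 0 < 1 + A + B)); last by lra.
by apply: le_lt_trans h3 _; rewrite ltr_pM2l //; lra.
Qed.

Lemma affine_pt_max (o a b : C) (B : set (R * R)) phi : compact B -> B !=set0 ->
  (forall p, B p -> rcont phi (affine_pt o a b p)) ->
  exists2 p, B p & forall q, B q -> phi (affine_pt o a b q) <= phi (affine_pt o a b p).
Proof.
move=> cB B0 H; have [|p pB h] := @compact_EVT_max _ _ (phi \o affine_pt o a b) B B0 cB.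
  apply: continuous_in_subspaceT => p; rewrite inE => /H; exact: affine_pt_cont.
by exists p; [rewrite inE in pB|move=> q qB; apply: h; rewrite inE].
Qed.

Lemma parallelogram_max (o a b : C) phi :
  (forall p : R * R, 0 <= p.1 <= 1 -> 0 <= p.2 <= 1 -> rcont phi (affine_pt o a b p)) ->
  exists K : R, forall p : R * R, 0 <= p.1 <= 1 -> 0 <= p.2 <= 1 -> phi (affine_pt o a b p) <= K.
Proof.
move=> H; have [|||p pB h] := @affine_pt_max o a b (`[0, 1] `*` `[0, 1]) phi.
- by apply: compact_setX; apply: segment_compact.
- by exists (0, 0); split; rewrite /= in_itv /= lexx ler01.
- by move=> p [] /=; rewrite !in_itv /=; apply: H.
by exists (phi (affine_pt o a b p)) => q q1 q2; apply: h; split; rewrite /= in_itv.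
Qed.

Lemma cmod_rcont (z : C) : rcont cmod z.
Proof.
move=> e e0; exists e => // h; apply: le_lt_trans.
have := cmodD z h; have := cmod_lb z h.
by rewrite ler_norml; move: (cmod _) (cmod _) (cmod _) => *; lra.
Qed.

Lemma disc_max r phi : 0 <= r -> (forall z, cmod z <= r -> rcont phi z) ->
  exists2 z, cmod z <= r & forall w, cmod w <= r -> phi w <= phi z.
Proof.
move=> r0 H.
pose pt := affine_pt 0 1 ('i%C : C).
pose B : set (R * R) := (`[- r, r] `*` `[- r, r]) `&` [set p | cmod (pt p) <= r].
have [|||p pB h] := @affine_pt_max 0 1 'i%C B phi.
- apply: compact_closedI; first by apply: compact_setX; apply: segment_compact.
  have -> : [set p | cmod (pt p) <= r] = (cmod \o pt) @^-1` [set x | x <= r] by [].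
  apply: closed_comp; last exact: closed_le.
  by move=> p _; apply: affine_pt_cont; apply: cmod_rcont.
- exists (0, 0); split; first by split; rewrite /= in_itv /= oppr_le0 r0.
  by rewrite /= /pt /affine_pt /= cr0 !mul0r !addr0 cmod0.
- by move=> p [_ /=]; apply: H.
exists (pt p); first by case: pB.
move=> w wr; have wE : w = pt (complex.Re w, complex.Im w).
  by rewrite /pt /affine_pt /= add0r mulr1 -crReIm.
rewrite {1}wE; apply: h; split; last by rewrite /= -wE.
split; rewrite /= in_itv /= -ler_norml.
  exact: le_trans (Re_le_cmod _) wr.
exact: le_trans (Im_le_cmod _) wr.
Qed.

Definition ip (a x : C) : R := complex.Re a * complex.Re x + complex.Im a * complex.Im x.
Lemma ipD a x y : ip a (x + y) = ip a x + ip a y.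
Proof. by rewrite /ip !(ReD, ImD); ring. Qed.
(** The tangent of |x|^2 at a: it replaces the square by something linear in x, so that averages can
    be taken inside. *)
Lemma ip_lb a x : 2 * ip a x - cmod a ^+ 2 <= cmod x ^+ 2.
Proof.
rewrite /ip !cmod_sq.
have := sqr_ge0 (complex.Re a - complex.Re x); have := sqr_ge0 (complex.Im a - complex.Im x).
by move: (complex.Re _) (complex.Re _) (complex.Im _) (complex.Im _) => *; nra.
Qed.
Lemma ip_self a : ip a a = cmod a ^+ 2.
Proof. by rewrite /ip cmod_sq; ring. Qed.
Lemma ip_norm a x : - (cmod a * cmod x) <= ip a x.
Proof.
have -> : ip a x = complex.Re ((a^*)%C * x).
  by rewrite /ip; case: a => p q; case: x => s t /=; ring.
have <- : cmod ((a^*)%C * x) = cmod a * cmod x.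
  rewrite cmodM; congr (_ * _).
  apply/eqP; rewrite -(@eqrXn2 _ 2) ?cmod_ge0 // !cmod_sq; case: (a) => p q /=.
  by rewrite sqrrN.
by have := Re_le_cmod ((a^*)%C * x); rewrite ler_norml => /andP[].
Qed.

(* At an interior maximum w0 of |g|^2 + e|w|^2, averaging over the four points
   w0 + i^k t kills the terms of order one and two of g, so that the average
   exceeds the value at w0 by about e t^2. *)
Lemma max_principle g r M : 0 < r ->
  (forall w, cmod w <= r -> ccont g w) ->
  (forall w, cmod w < r -> g w != 0 -> exists a b, taylor2 g w a b) ->
  (forall w, cmod w = r -> cmod (g w) <= M) ->
  forall w, cmod w <= r -> cmod (g w) <= M.
Proof.
move=> r0 gc gt gb w1 w1r; rewrite leNgt; apply/negP => Mlt.
have M0 : 0 <= M.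
  by apply: le_trans (cmod_ge0 (g (cr r))) (gb _ _); rewrite cmod_cr gtr0_norm.
have r20 : 0 < r ^+ 2 by rewrite exprn_gt0.
(* Half of the excess of |g w1|^2 over M^2, divided by r^2: the term e |w|^2 then stays too small to
   move the maximum to the boundary circle. *)
pose e := (cmod (g w1) ^+ 2 - M ^+ 2) / (2 * r ^+ 2).
have dpos : 0 < cmod (g w1) ^+ 2 - M ^+ 2.
  by rewrite subr_gt0 ltr_pXn2r // ?nnegrE ?cmod_ge0.
have e0 : 0 < e by rewrite divr_gt0 // mulr_gt0.
have er : e * r ^+ 2 < cmod (g w1) ^+ 2 - M ^+ 2.
  have -> : e * r ^+ 2 = (cmod (g w1) ^+ 2 - M ^+ 2) / 2.
    by rewrite /e; field; rewrite lt0r_neq0.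
  by lra.
pose phi w := cmod (g w) ^+ 2 + e * cmod w ^+ 2.
have phic w : cmod w <= r -> rcont phi w.
  move=> wr; have cc : ccont (fun x => cr (cmod (g x)) * cr (cmod (g x)) + cr e * (cr (cmod x) * cr (cmod x))) w.
    have cm : ccont (fun x => cr (cmod x)) w.
      move=> d d0; have [s s0 h] := cmod_rcont w d0; exists s => // k /h.
      by rewrite -crB cmod_cr.
    have cg : ccont (fun x => cr (cmod (g x))) w.
      have := @ccont_comp _ (fun x => cr (cmod x)) g w (gc _ wr); apply.
      move=> d d0; have [s s0 h] := cmod_rcont (g w) d0; exists s => // k /h.
      by rewrite -crB cmod_cr.
    by apply: ccontD; [|apply: ccontM; first exact: ccontC]; apply: ccontM.
  move=> d d0; have [s s0 h] := cc d d0; exists s => // k /h.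
  by rewrite -!crM -!crD -crB cmod_cr /phi !expr2.
have [w0 w0r w0max] := disc_max (ltW r0) phic.
have big : M ^+ 2 + e * r ^+ 2 < phi w0.
  apply: lt_le_trans (w0max _ w1r); rewrite /phi.
  have : 0 <= e * cmod w1 ^+ 2 by rewrite mulr_ge0 ?sqr_ge0 // ltW.
  by move: er; move: (e * _ ^+ 2) (_ * _) => x y; lra.
have w0r2 : e * cmod w0 ^+ 2 <= e * r ^+ 2.
  by rewrite ler_pM2l // ler_pXn2r // ?nnegrE ?cmod_ge0 // ltW.
have {w0r} w0r : cmod w0 < r.
  rewrite lt_neqAle w0r andbT; apply/eqP => w0E.
  have : cmod (g w0) ^+ 2 <= M ^+ 2 by rewrite ler_pXn2r // ?nnegrE ?cmod_ge0 // gb.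
  by move: big w0r2; rewrite /phi; move: (e * _) (e * _) => x y; lra.
(* At a zero of g the function phi is at most e r^2, so the maximum is not there. Expansions of g
   are thus wanted only off its zeros, which later permits extension by 0 across singularities. *)
have gw0 : g w0 != 0.
  apply: contraTneq big => gE; rewrite -leNgt /phi gE cmod0 expr0n /= add0r.
  by apply: le_trans w0r2 _; rewrite lerDr sqr_ge0.
have [a [b T]] := gt _ w0r gw0.
set A := g w0 in gw0 T.
have A0 := cmod_ge0 A.
(* With this bound the four remainders cost at most 2 e t^2, against the 4 e t^2 gained from the
   summand e |w|^2. *)
have eta0 : 0 < e / (4 * (1 + cmod A)) by rewrite divr_gt0 // mulr_gt0 //; lra.
have [s s0 Ts] := T _ eta0.
set eta := e / _ in eta0 Ts.
pose t := Num.min (s / 2) ((r - cmod w0) / 2).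
have t0 : 0 < t by rewrite lt_min !divr_gt0 // subr_gt0.
have ts : t < s by rewrite /t gt_min; apply/orP; left; lra.
have tr : t < r - cmod w0 by rewrite /t gt_min; apply/orP; right; lra.
pose I : C := 'i%C.
have I2 : I * I = -1 by rewrite -expr2 sqr_i.
have I1 : cmod I = 1.
  apply/eqP; rewrite -(@eqrXn2 _ 2) ?cmod_ge0 ?ler01 // cmod_sq /= expr0n /= add0r.
  by rewrite !expr1n.
pose h0 := cr t; pose h1 := cr t * I; pose h2 := - h0; pose h3 := - h1.
have m0 : cmod h0 = t by rewrite cmod_cr gtr0_norm.
have m1 : cmod h1 = t by rewrite cmodM I1 mulr1.
have m2 : cmod h2 = t by rewrite cmodN.
have m3 : cmod h3 = t by rewrite cmodN.
pose rem h := g (w0 + h) - A - a * h - b * h ^+ 2.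
have remb h : cmod h = t -> cmod (rem h) <= eta * t ^+ 2.
  by move=> hE; rewrite -hE; apply: Ts; rewrite hE.
have sumg : g (w0 + h0) + g (w0 + h1) + g (w0 + h2) + g (w0 + h3) =
  (A + A + A + A) + (rem h0 + rem h1 + rem h2 + rem h3).
  by rewrite /rem /h3 /h2 /h1 /h0; ring: I2.
have sumw : cmod (w0 + h0) ^+ 2 + cmod (w0 + h1) ^+ 2 + cmod (w0 + h2) ^+ 2 +
   cmod (w0 + h3) ^+ 2 = 4 * cmod w0 ^+ 2 + 4 * t ^+ 2.
  rewrite !cmod_sq /h3 /h2 /h1 /h0 /I; case: (w0) => x y /=; ring.
have le_phi h : cmod h = t -> phi (w0 + h) <= phi w0.
  move=> hE; apply: w0max; apply: le_trans (cmodD _ _) _; rewrite hE; lra.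
have := le_phi _ m0; have := le_phi _ m1; have := le_phi _ m2; have := le_phi _ m3.
rewrite /phi -/A.
have lb h := ip_lb A (g (w0 + h)).
have := lb h0; have := lb h1; have := lb h2; have := lb h3.
have sumip : ip A (g (w0 + h0)) + ip A (g (w0 + h1)) + ip A (g (w0 + h2)) + ip A (g (w0 + h3)) =
  4 * cmod A ^+ 2 + (ip A (rem h0) + ip A (rem h1) + ip A (rem h2) + ip A (rem h3)).
  by rewrite -!ipD sumg !ipD ip_self; ring.
have rb h : cmod h = t -> - (cmod A * (eta * t ^+ 2)) <= ip A (rem h).
  move=> /remb hE; apply: le_trans (ip_norm _ _); rewrite lerN2; exact: ler_wpM2l.
have := rb _ m0; have := rb _ m1; have := rb _ m2; have := rb _ m3.
move: sumip sumw.
have t20 : 0 < t ^+ 2 by rewrite exprn_gt0.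
have etaE : 4 * (cmod A * (eta * t ^+ 2)) <= e * t ^+ 2.
  have -> : 4 * (cmod A * (eta * t ^+ 2)) = (e * t ^+ 2) * (cmod A / (1 + cmod A)).
    by rewrite /eta; field; rewrite lt0r_neq0 //; lra.
  apply: ler_piMr; [by rewrite mulr_ge0 ?sqr_ge0 // ltW|rewrite ler_pdivrMr; lra].
have et : 0 < e * t ^+ 2 by rewrite mulr_gt0.
move: (cmod (w0 + h0) ^+ 2) (cmod (w0 + h1) ^+ 2) (cmod (w0 + h2) ^+ 2) (cmod (w0 + h3) ^+ 2) (cmod w0 ^+ 2).
move: (cmod (g (w0 + h0)) ^+ 2) (cmod (g (w0 + h1)) ^+ 2) (cmod (g (w0 + h2)) ^+ 2) (cmod (g (w0 + h3)) ^+ 2) (cmod A ^+ 2).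
move: (ip A (rem h0)) (ip A (rem h1)) (ip A (rem h2)) (ip A (rem h3)) etaE.
move: (ip A _) (ip A _) (ip A _) (ip A _) (cmod A * _) et.
move=> p0 p1 p2 p3 q et i0 i1 i2 i3 hq g0 g1 g2 g3 cA n0 n1 n2 n3 n hs hw r3 r2 r1 r0' b3 b2 b1 b0 f3 f2 f1 f0.
have hw2 : e * n0 + e * n1 + e * n2 + e * n3 = 4 * (e * n) + 4 * (e * t ^+ 2).
  by rewrite -!mulrDr hw; ring.
lra.
Qed.

End Liouville.

(** * Liouville's theorem and vanishing on a disc *)

Section Liouville2.
Context {R : realType}.
Notation C := (cplx R).
Implicit Types (f g F : C -> C) (phi : C -> R) (z w a b : C) (e r : R).

Lemma cmod_dist z w : `|cmod z - cmod w| <= cmod (z - w).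
Proof.
have h1 := cmodD (z - w) w; have h2 := cmodD (w - z) z.
rewrite subrK in h1; rewrite subrK (cmodBC w z) in h2.
by rewrite ler_norml; move: h1 h2; move: (cmod _) (cmod z) (cmod w) => *; lra.
Qed.

(** Dividing f by z - z0 would need a limit at z0, and only a Lipschitz bound is at hand. After z =
    z0 + w^2 the quotient f (z0 + w^2) / w is O(|w|), hence continuous at 0 with the value 0 that
    [0^-1 = 0] gives it, and the maximum principle bounds it by M / r for all large r. *)
Lemma liouville_lip f z0 (M K d : R) : (forall z, ccont f z) -> (forall z, cmod (f z) <= M) ->
  (forall z, f z != 0 -> twice f z) -> f z0 = 0 ->
  0 < d -> (forall h, cmod h < d -> cmod (f (z0 + h)) <= K * cmod h) ->
  forall z, f z = 0.
Proof.
move=> fc fb ft fz0 d0 fl.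
pose g (w : C) := f (z0 + w ^+ 2) / w.
have gc w : ccont g w.
  have [->|w0] := eqVneq w 0.
    move=> e e0; have K0 : 0 < 1 + `|K| by have := normr_ge0 K; lra.
    exists (Num.min 1 (Num.min d (e / (1 + `|K|)))).
      by rewrite !lt_min ltr01 d0 divr_gt0.
    move=> h; rewrite add0r !lt_min ltr_pdivlMr // => /and3P[h1 hd he].
    rewrite {2}/g invr0 mulr0 subr0 /g.
    have [->|h0] := eqVneq h 0; first by rewrite invr0 mulr0 cmod0.
    have hp : 0 < cmod h by rewrite cmod_gt0.
    have h2 : cmod (h ^+ 2) = cmod h * cmod h by rewrite cmodX expr2.
    have hh : cmod (h ^+ 2) < d by rewrite h2; apply: lt_trans hd; rewrite -[ltRHS]mulr1 ltr_pM2l.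
    rewrite cmodM cmodV ltr_pdivrMr //; apply: le_lt_trans (fl _ hh) _.
    rewrite h2 mulrA ltr_pM2r //; apply: le_lt_trans he.
    rewrite mulrC ler_pM2l //; have := ler_norm K; lra.
  apply: ccontM.
    apply: (@ccont_comp _ f (fun w => z0 + w ^+ 2)) => //.
    by apply: ccontD; [apply: ccontC|apply: cderiv_cont (cderivX2 w)].
  exact: cderiv_cont (cderivV w0 (cderivI w)).
have gt w : g w != 0 -> exists a b, taylor2 g w a b.
  move=> gw; apply: twice_taylor.
  have w0 : w != 0 by apply: contraNneq gw => ->; rewrite /g invr0 mulr0.
  have fw : f (z0 + w ^+ 2) != 0 by apply: contraNneq gw => E; rewrite /g E mul0r.
  apply: twiceM; last exact: twice_inv.
  apply: (@twice_comp _ f (fun w => z0 + w ^+ 2)); last exact: ft.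
  by apply: twiceD; [apply: twiceC|apply: twiceX; apply: twiceI].
have M0 : 0 <= M := le_trans (cmod_ge0 _) (fb 0).
have gb w r : 0 < r -> cmod w <= r -> cmod (g w) <= M / r.
  move=> r0; apply: max_principle => // [x _|x xr]; first exact: gt.
  by rewrite /g cmodM cmodV xr ler_wpM2r // invr_ge0 ltW.
have g0 w : g w = 0.
  apply/eqP; rewrite -cmod_eq0 eq_le cmod_ge0 andbT leNgt; apply/negP => gp.
  pose r := 1 + cmod w + M / cmod (g w).
  have Mg : 0 <= M / cmod (g w) by rewrite divr_ge0 // ltW.
  have r0 : 0 < r by rewrite /r; have := cmod_ge0 w; lra.
  have wr : cmod w <= r by rewrite /r; lra.
  have := gb _ _ r0 wr; rewrite ler_pdivlMr // mulrC -ler_pdivlMr //.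
  by rewrite /r; have := cmod_ge0 w; lra.
move=> z; have [->//|zz] := eqVneq z z0.
have := g0 (sqrtC (z - z0)); rewrite /g sqrtCK addrC subrK => /eqP.
rewrite mulf_eq0 invr_eq0 sqrtC_eq0 subr_eq0 (negPf zz) orbF => /eqP //.
Qed.

(** At s nothing better than continuity is known, so the Lipschitz version is applied at a point z0
    with F z0 <> 0, to F (F - F z0). Its vanishing leaves F only the values 0 and F z0, and
    continuity of |F| along the segment from s to z0 excludes the jump. *)
Lemma liouville F (M : R) (s : C) : (forall z, ccont F z) -> (forall z, cmod (F z) <= M) ->
  (forall z, F z != 0 -> twice F z) -> F s = 0 -> forall z, F z = 0.
Proof.
move=> Fc Fb Ft Fs z0; apply/eqP/negPn/negP => F0.
pose f z := F z * (F z - F z0).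
have f0 z : f z = 0.
  have [F1 [a [hF1 _]]] := Ft _ F0.
  have tf : twice f z0 by apply: twiceM; [exact: Ft|apply: twiceB; [exact: Ft|apply: twiceC]].
  have [f1 [b [hf _]]] := tf.
  have hf0 : cderiv f z0 (f1 z0) := near_at hf.
  have [d d0 hd] := hf0 1 ltr01.
  apply: (@liouville_lip f z0 (M * (M + cmod (F z0))) (1 + cmod (f1 z0)) d) => //.
  - by move=> x; apply: ccontM => //; apply: ccontD => //; apply: ccontC.
  - move=> x; rewrite /f cmodM ler_pM ?cmod_ge0 //.
    by apply: le_trans (cmodB _ _) _; rewrite lerD2r.
  - move=> x fx; have Fx : F x != 0 by apply: contraNneq fx => E; rewrite /f E mul0r.
    by apply: twiceM; [exact: Ft|apply: twiceB; [exact: Ft|apply: twiceC]].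
  - by rewrite /f subrr mulr0.
  move=> h /hd; rewrite {2}/f subrr mulr0 subr0 => H.
  have -> : f (z0 + h) = (f (z0 + h) - f1 z0 * h) + f1 z0 * h by ring.
  apply: le_trans (cmodD _ _) _; rewrite cmodM.
  by move: H; move: (cmod _) (cmod h) (cmod _) => x y t; lra.
have F2 z : F z = 0 \/ F z = F z0.
  move/eqP: (f0 z); rewrite /f mulf_eq0 subr_eq0 => /orP[] /eqP ->; by [left|right].
pose psi (t : R) := cmod (F (s + cr t * (z0 - s))).
have psic : continuous psi.
  move=> t; apply/cvgrPdist_lt => e e0.
  have [r r0 hr] := Fc (s + cr t * (z0 - s)) e e0.
  have K0 : 0 < 1 + cmod (z0 - s) by have := cmod_ge0 (z0 - s); lra.
  apply/nbhs_ballP; exists (r / (1 + cmod (z0 - s))); first exact: divr_gt0.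
  move=> u; rewrite /ball /= distrC ltr_pdivlMr // => hu; rewrite distrC /psi.
  have -> : s + cr u * (z0 - s) = s + cr t * (z0 - s) + cr (u - t) * (z0 - s).
    by rewrite crB; ring.
  set h := cr (u - t) * _.
  have hh : cmod h < r.
    rewrite cmodM cmod_cr; apply: le_lt_trans hu; rewrite ler_wpM2l //; lra.
  apply: le_lt_trans (hr _ hh).
  exact: cmod_dist.
have Fp : 0 < cmod (F z0) by rewrite cmod_gt0.
have [||t _ tE] := @IVT _ psi 0 1 (cmod (F z0) / 2) ler01.
- by apply: continuous_subspaceT.
- have -> : psi 0 = 0 by rewrite /psi cr0 mul0r addr0 Fs cmod0.
  have -> : psi 1 = cmod (F z0) by rewrite /psi cr1 mul1r addrC subrK.
  by rewrite min_l ?max_r ?(ltW Fp) //; lra.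
move: tE; rewrite /psi; case: (F2 (s + cr t * (z0 - s))) => ->; first by rewrite cmod0; lra.
lra.
Qed.

(* Hadamard: apply the maximum principle to f (a + w) / w ^ n and let n -> oo. *)
Lemma vanish_disc f a r : (forall w, cmod w < r -> twice f (a + w)) ->
  (\forall w \near a, f w = 0) -> forall w, cmod w < r -> f (a + w) = 0.
Proof.
move=> ft /near0P[d d0 hd] w wr.
pose r1 := (cmod w + r) / 2.
have w0 := cmod_ge0 w.
have wr1 : cmod w < r1 by rewrite /r1; lra.
have r1r : r1 < r by rewrite /r1; lra.
have r10 : 0 < r1 by lra.
pose phi x := cmod (f (a + x)).
have fc x : cmod x < r -> ccont (fun x => f (a + x)) x.
  move=> /ft /twice_cont h; apply: (@ccont_comp _ f (fun x => a + x)) => //.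
  by apply: ccontD; [apply: ccontC|apply: ccontI].
have [|zM _ hM] := @disc_max _ r1 phi (ltW r10).
  move=> z zr; have zr' : cmod z < r := le_lt_trans zr r1r.
  move=> e e0; have [s s0 h] := fc _ zr' _ e0; exists s => // k /h.
  by apply: le_lt_trans; apply: cmod_dist.
set M := phi zM in hM.
have M0 : 0 <= M by apply: cmod_ge0.
have bound n : cmod (f (a + w)) <= M * (cmod w / r1) ^+ n.+1.
  pose g x := f (a + x) / x ^+ n.+1.
  have [wE|wn0] := eqVneq w 0; first by rewrite wE hd ?cmod0 // mul0r expr0n /= mulr0.
  have gz x : cmod x < d -> g x = 0 by move=> xd; rewrite /g hd // mul0r.
  have := @max_principle _ g r1 (M / r1 ^+ n.+1) r10.
  move=> /(_ _ _ _ w (ltW wr1)) H.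
  have : cmod (g w) <= M / r1 ^+ n.+1.
    apply: H => x.
    - move=> xr; have [xd|xd] := ltP (cmod x) d.
        move=> e e0; exists (d - cmod x); first by rewrite subr_gt0.
        move=> h hh; rewrite !gz ?subrr ?cmod0 //.
        by apply: le_lt_trans (cmodD _ _) _; lra.
      have x0 : x != 0 by rewrite -cmod_gt0; apply: lt_le_trans xd.
      apply: ccontM; first by apply: fc; apply: le_lt_trans xr _.
      apply: twice_cont; apply: twiceV; first by rewrite expf_neq0.
      by apply: twiceX; apply: twiceI.
    - move=> xr gx; apply: twice_taylor.
      have x0 : x != 0 by apply: contraNneq gx => ->; rewrite gz ?cmod0.
      apply: twiceM.
        apply: (@twice_comp _ f (fun x => a + x)); last by apply: ft; apply: lt_trans r1r.
        by apply: twiceD; [apply: twiceC|apply: twiceI].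
      by apply: twiceV; [rewrite expf_neq0|apply: twiceX; apply: twiceI].
    - move=> xr; rewrite /g cmodM cmodV cmodX xr ler_wpM2r ?invr_ge0 ?exprn_ge0 ?(ltW r10) //.
      by apply: hM; rewrite xr.
  have wp : 0 < cmod w ^+ n.+1 by rewrite exprn_gt0 // cmod_gt0.
  rewrite /g cmodM cmodV cmodX ler_pdivrMr // => /le_trans; apply.
  by rewrite (expr_div_n (cmod w)) mulrAC -mulrA.
apply/eqP; rewrite -cmod_eq0 eq_le cmod_ge0 andbT leNgt; apply/negP => fp.
have q0' : 0 <= cmod w / r1 by apply: divr_ge0 => //; apply: ltW.
have q1 : `|cmod w / r1| < 1.
  rewrite ger0_norm //; set q := cmod w / r1.
  by rewrite /q ltr_pdivrMr // mul1r.
have M1 : 0 < 1 + M by lra.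
have := @cvg_expr _ (cmod w / r1) q1.
move/cvgrPdist_lt => /(_ (cmod (f (a + w)) / (1 + M)) (divr_gt0 fp M1)) [N _ hN].
have h2 := hN N.+1 (leqnSn _); rewrite /= sub0r normrN in h2.
rewrite ger0_norm ?exprn_ge0 // in h2; rewrite ltr_pdivlMr // in h2.
have q0 : 0 <= (cmod w / r1) ^+ N.+1 by rewrite exprn_ge0.
have := bound N; move: q0 h2; move: (_ ^+ N.+1) => q; move: (cmod _) => y; nra.
Qed.

End Liouville2.

(** * Lattice sums *)

Section Lattice.
Context {R : realType}.
Notation C := (cplx R).
Implicit Types (f g : C -> C) (z w : C) (u : nat -> C) (m n : int) (N : nat).

Definition ccvg u (l : C) := forall e : R, 0 < e ->
  exists N0, forall N, (N0 <= N)%N -> cmod (u N - l) < e.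

Lemma ccvgP u l : ccvg u l -> u @ \oo --> l.
Proof.
move=> H; apply/cvgrPdist_lt => e /pos_cr [-> e0].
have [N0 h] := H _ e0; exists N0 => // N /= hN.
by rewrite cmodE ltr_cr cmodBC h.
Qed.

Lemma ccvg_lim u l : ccvg u l -> lim (u @ \oo) = l.
Proof. by move/ccvgP/cvg_lim; apply; apply: norm_hausdorff. Qed.

Lemma ccvg_unique u l l' : ccvg u l -> ccvg u l' -> l = l'.
Proof. by move=> /ccvg_lim <- /ccvg_lim <-. Qed.

Lemma ccvgD u v l l' : ccvg u l -> ccvg v l' -> ccvg (fun N => u N + v N) (l + l').
Proof.
move=> hu hv e e0; have e2 : 0 < e / 2 by lra.
have [N1 h1] := hu _ e2; have [N2 h2] := hv _ e2.
exists (maxn N1 N2) => N; rewrite geq_max => /andP[/h1 a /h2 b].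
have -> : u N + v N - (l + l') = (u N - l) + (v N - l') by ring.
by apply: le_lt_trans (cmodD _ _) _; move: a b; move: (cmod _) (cmod _) => x y; lra.
Qed.

Lemma ccvgC (l : C) : ccvg (fun=> l) l.
Proof. by move=> e e0; exists 0%N => N _; rewrite subrr cmod0. Qed.

Lemma ccvgZ u l (c : C) : ccvg u l -> ccvg (fun N => c * u N) (c * l).
Proof.
move=> hu e e0; have K0 : 0 < 1 + cmod c by have := cmod_ge0 c; lra.
have [N h] := hu _ (divr_gt0 e0 K0); exists N => k /h.
rewrite -mulrBr cmodM ltr_pdivlMr //; have := cmod_ge0 (u k - l).
by move: (cmod _) (cmod c) => x y; nra.
Qed.

Lemma ccvgN u l : ccvg u l -> ccvg (fun N => - u N) (- l).
Proof.
move=> h e /h [N hN]; exists N => k /hN.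
by rewrite -opprD cmodN.
Qed.

Lemma ccvgB u v l l' : ccvg u l -> ccvg v l' -> ccvg (fun N => u N - v N) (l - l').
Proof. by move=> h k; apply: ccvgD => //; apply: ccvgN. Qed.

Lemma ccvg_ext u v l : (forall N, u N = v N) -> ccvg u l -> ccvg v l.
Proof. by move=> E h e /h [N hN]; exists N => k /hN; rewrite E. Qed.

Lemma ccvg_bound u l (B : R) : (forall N, cmod (u N) <= B) -> ccvg u l -> cmod l <= B.
Proof.
move=> hB h; rewrite leNgt; apply/negP => Bl.
have p : 0 < cmod l - B by rewrite subr_gt0.
have [N hN] := h _ p.
have := hN N (leqnn _); have := hB N; have := cmodB (u N) (u N - l).
have -> : u N - (u N - l) = l by ring.
by move: (cmod _) (cmod _) (cmod _) => *; lra.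
Qed.

Lemma ccvg_harmonic u (K : R) : (forall N, cmod (u N) <= K / N.+1%:R) -> ccvg u 0.
Proof.
move=> h e e0; have [N0 _ hN] : \forall N \near \oo, K / e < N%:R :> R.
  exists (Num.truncn `|K / e|).+1 => // N /= hN.
  apply: le_lt_trans (ler_norm _) _; apply: lt_le_trans (truncnS_gt _) _.
  by rewrite ler_nat.
exists N0 => N NN; rewrite subr0; apply: le_lt_trans (h N) _.
have N1 : 0 < N.+1%:R :> R by rewrite ltr0n.
rewrite ltr_pdivrMr //.
have := hN N NN; rewrite ltr_pdivrMr // => h1; apply: lt_trans h1 _.
by rewrite mulrC ltr_pM2l // ltr_nat.
Qed.

(** For v N = B / (N + 1), the sequence u - v increases and u + v decreases; hence u - v is bounded
    above and converges, and v tends to 0. *)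
Lemma real_seq_cvg (u : nat -> R) (B : R) : 0 <= B ->
  (forall N, `|u N.+1 - u N| <= B * (N.+1%:R^-1 - N.+2%:R^-1)) ->
  exists l : R, u @ \oo --> l.
Proof.
move=> B0 H.
pose v N := B * (N.+1%:R : R)^-1.
have dv N : B * (N.+1%:R^-1 - N.+2%:R^-1) = v N - v N.+1 by rewrite /v mulrBr.
have nd : nondecreasing_seq (fun N => u N - v N).
  apply/nondecreasing_seqP => N; have := H N; rewrite dv ler_norml => /andP[]; lra.
have ub N : u N + v N <= u 0%N + v 0%N.
  elim: N => [//|N IH]; have := H N; rewrite dv ler_norml => /andP[]; lra.
have vN N : 0 <= v N by rewrite mulr_ge0 // invr_ge0 ler0n.
have c1 : cvgn (fun N => u N - v N).
  apply: nondecreasing_is_cvgn => //; exists (u 0%N + v 0%N) => _ [N _ <-].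
  by have := ub N; have := vN N; lra.
have v0 : v @ \oo --> (0 : R).
  by rewrite -(mulr0 B); apply: cvgM; [exact: cvg_cst|exact: cvg_harmonic].
have {c1} : (fun N => u N - v N) @ \oo --> limn (fun N => u N - v N) := c1.
move: (limn _) => l c1; exists l.
have -> : u = (fun N => (u N - v N) + v N) by apply: funext => N; rewrite subrK.
by rewrite -[X in _ --> X]addr0; apply: cvgD; [exact: c1|exact: v0].
Qed.

Lemma ccvg_telescope u (B : R) : 0 <= B ->
  (forall N, cmod (u N.+1 - u N) <= B * (N.+1%:R^-1 - N.+2%:R^-1)) ->
  exists l, ccvg u l.
Proof.
move=> B0 H.
have [|a ha] := @real_seq_cvg (fun N => complex.Re (u N)) B B0.
  by move=> N; apply: le_trans (H N); rewrite -ReN -ReD; apply: Re_le_cmod.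
have [|b hb] := @real_seq_cvg (fun N => complex.Im (u N)) B B0.
  by move=> N; apply: le_trans (H N); rewrite -ImN -ImD; apply: Im_le_cmod.
exists (Complex a b) => e e0; have e2 : 0 < e / 2 by lra.
move/cvgrPdist_lt: ha => /(_ _ e2) [N1 _ h1].
move/cvgrPdist_lt: hb => /(_ _ e2) [N2 _ h2].
exists (maxn N1 N2) => N; rewrite geq_max => /andP[/h1 x /h2 y].
apply: le_lt_trans (cmod_le_ReIm _) _; rewrite ReD ReN ImD ImN /=.
by move: x y; rewrite /= ![`|_ - complex.Re _|]distrC ![`|_ - complex.Im _|]distrC; lra.
Qed.

(** Indexing by integers makes reflections and unit shifts of the index available; the range matches
    that of [lattice_sum]. *)
Definition symsum N (g : int -> C) : C := \sum_(i < N.*2.+1) g (i%:Z - N%:Z).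

Lemma symsum0 (g : int -> C) : symsum 0 g = g 0.
Proof. by rewrite /symsum big_ord1 subrr. Qed.

Lemma symsumS N (g : int -> C) : symsum N.+1 g = g (- (N.+1)%:Z) + symsum N g + g (N.+1)%:Z.
Proof.
rewrite /symsum doubleS big_ord_recl big_ord_recr /= -addrA; congr (_ + (_ + _)).
- by congr g; lia.
- by apply: eq_bigr => i _; congr g; rewrite /bump /=; lia.
- by congr g; rewrite /bump /=; lia.
Qed.

Lemma symsumD N (g h : int -> C) : symsum N (fun k => g k + h k) = symsum N g + symsum N h.
Proof. exact: big_split. Qed.

Lemma symsumZ N (g : int -> C) (c : C) : symsum N (fun k => c * g k) = c * symsum N g.
Proof. by rewrite /symsum mulr_sumr. Qed.

Lemma symsumN N (g : int -> C) : symsum N (fun k => - g k) = - symsum N g.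
Proof. exact: sumrN. Qed.

Lemma symsumB N (g h : int -> C) : symsum N (fun k => g k - h k) = symsum N g - symsum N h.
Proof. by rewrite symsumD symsumN. Qed.

Lemma symsum_opp N (g : int -> C) : symsum N (fun k => g (- k)) = symsum N g.
Proof.
elim: N => [|N IH]; first by rewrite !symsum0 oppr0.
by rewrite !symsumS IH opprK; ring.
Qed.

Lemma eq_symsum N (g h : int -> C) : (forall k : int, (`|k| <= N)%N -> g k = h k) -> symsum N g = symsum N h.
Proof. by move=> E; apply: eq_bigr => i _; apply: E; have := ltn_ord i; lia. Qed.

Lemma symsum_bound N (g : int -> C) (B : R) : (forall k : int, (`|k| <= N)%N -> cmod (g k) <= B) ->
  cmod (symsum N g) <= (N.*2.+1)%:R * B.
Proof.
move=> H; apply: le_trans (cmod_sum _ _ _) _.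
apply: le_trans (_ : \sum_(i < N.*2.+1) B <= _).
  by apply: ler_sum => i _; apply: H; have := ltn_ord i; lia.
by rewrite sumr_const card_ord -[leLHS]mulr_natl.
Qed.

Lemma symsum_shift N (g : int -> C) :
  symsum N (fun k => g (k + 1)) - symsum N g = g (N.+1)%:Z - g (- N%:Z).
Proof.
elim: N => [|N IH]; first by rewrite !symsum0 oppr0.
rewrite !symsumS.
have -> : - (N.+1)%:Z + 1 = - N%:Z by lia.
have -> : (N.+1)%:Z + 1 = (N.+2)%:Z by lia.
rewrite [LHS](_ : _ = symsum N (fun k => g (k + 1)) - symsum N g
  + g (- N%:Z) + g N.+2 - g (- (N.+1)%:Z) - g N.+1); last by ring.
by rewrite IH; ring.
Qed.

Lemma symsum_exchange N (a : int -> int -> C) :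
  symsum N (fun k => symsum N (fun j => a k j)) = symsum N (fun j => symsum N (fun k => a k j)).
Proof. exact: exchange_big. Qed.

Lemma half_nint (m : int) : (2^-1 : R) != m%:~R.
Proof.
apply/eqP => E; have : (1 : R) = (m * 2)%:~R by rewrite intrM -E mulVf.
by rewrite -[1]/(1%:~R) => /eqP; rewrite eqr_int => /eqP; lia.
Qed.

Section Tau.
Variable tau : C.
Hypothesis Htau : 0 < complex.Im tau.

Definition lpt m n : C := m%:~R + n%:~R * tau.

Lemma lptE m n : lpt m n = cr m%:~R + cr n%:~R * tau.
Proof. by rewrite !cr_int. Qed.

Lemma lattice_lpt m n : lattice tau (lpt m n).
Proof. by exists m, n. Qed.

Lemma coords z : exists x y : R, z = cr x + cr y * tau.
Proof.
exists (complex.Re z - complex.Im z / complex.Im tau * complex.Re tau), (complex.Im z / complex.Im tau).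
apply: cplx_eq; rewrite !(ReD, ImD, ReM, ImM) /=; field; exact: lt0r_neq0.
Qed.

(** Bounds the real coordinates by the modulus: |y| Im tau <= |x + y tau|, and |x| <= |x + y tau| +
    |y| |tau|. *)
Definition Kt : R := 1 + (1 + cmod tau) / complex.Im tau.

Lemma Kt_ge1 : 1 <= Kt.
Proof. by rewrite lerDl divr_ge0 ?(ltW Htau) // addr_ge0 ?cmod_ge0. Qed.

Lemma coord_y (x y : R) : `|y| <= Kt * cmod (cr x + cr y * tau).
Proof.
have h := Im_le_cmod (cr x + cr y * tau).
rewrite ImD ImM /= mul0r !(add0r, addr0) normrM (gtr0_norm Htau) in h.
have h0 := cmod_ge0 (cr x + cr y * tau); have ht := cmod_ge0 tau.
have : `|y| <= cmod (cr x + cr y * tau) / complex.Im tau by rewrite ler_pdivlMr.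
move/le_trans; apply; rewrite mulrC ler_wpM2r // /Kt.
by rewrite mulrDl mul1r addrA; have := divr_ge0 ht (ltW Htau); lra.
Qed.

Lemma coord_x (x y : R) : `|x| <= Kt * cmod (cr x + cr y * tau).
Proof.
have h := Im_le_cmod (cr x + cr y * tau).
rewrite ImD ImM /= mul0r !(add0r, addr0) normrM (gtr0_norm Htau) in h.
have h0 := cmod_ge0 (cr x + cr y * tau); have ht := cmod_ge0 tau.
have hy : `|y| <= cmod (cr x + cr y * tau) / complex.Im tau by rewrite ler_pdivlMr.
have hx : `|x| <= cmod (cr x + cr y * tau) + `|y| * cmod tau.
  rewrite -cmod_cr -(cmod_cr y) -cmodM; set a := cr y * tau.
  by have := cmodB (cr x + a) a; rewrite addrK.
apply: le_trans hx _.
have : `|y| * cmod tau <= cmod (cr x + cr y * tau) / complex.Im tau * cmod tau by rewrite ler_wpM2r.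
have : 0 <= cmod (cr x + cr y * tau) / complex.Im tau by rewrite divr_ge0 // ltW.
move: (cmod (_ + _)) h0 => M h0; move: (`|y|) => Y hY hT.
have -> : Kt * M = M + M / complex.Im tau + M / complex.Im tau * cmod tau.
  by rewrite /Kt; field; apply: lt0r_neq0.
lra.
Qed.

Lemma lpt_lb m n N : (N <= maxn `|m| `|n|)%N -> N%:R <= Kt * cmod (lpt m n).
Proof.
have hm : (`|m|%N)%:R = `|m%:~R| :> R by rewrite natr_absz intr_norm.
have hn : (`|n|%N)%:R = `|n%:~R| :> R by rewrite natr_absz intr_norm.
rewrite leq_max lptE => /orP[] h.
  by apply: le_trans (coord_x _ _); rewrite -hm ler_nat.
by apply: le_trans (coord_y m%:~R _); rewrite -hn ler_nat.
Qed.

Lemma lpt_eq0 m n : (lpt m n == 0) = (m == 0) && (n == 0).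
Proof.
apply/idP/andP => [/eqP h|[/eqP -> /eqP ->]]; last by rewrite /lpt mul0r addr0.
have := @lpt_lb m n _ (leqnn _); rewrite h cmod0 mulr0 lern0 => /eqP h0.
by split; lia.
Qed.

Lemma lattice_gap w : lattice tau w -> w != 0 -> 1 <= Kt * cmod w.
Proof.
case=> m [n ->]; rewrite -/(lpt m n) lpt_eq0 => h.
by have := @lpt_lb m n 1%N; apply; lia.
Qed.

Definition box N f : C :=
  symsum N (fun m => symsum N (fun n => if (m == 0) && (n == 0) then 0 else f (lpt m n))).

Lemma lattice_sumE f : lattice_sum tau f = lim ((fun N => box N f) @ \oo).
Proof.
rewrite /lattice_sum; apply: (congr1 (fun u : nat -> C => lim (u @ \oo))); apply: funext => N.
apply: eq_bigr => i _; rewrite big_mkcond; apply: eq_bigr => j _.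
have E k : (k%:Z - N%:Z == 0) = (k == N) by apply/eqP/eqP; lia.
rewrite !E; case: ifP; case: ifP => // _ _.
by rewrite /lpt !rmorphB.
Qed.

Definition cubic f (K : R) := forall w, lattice tau w -> w != 0 -> cmod (f w) * cmod w ^+ 3 <= K.

Lemma box0 f : box 0 f = 0.
Proof. by rewrite /box !symsum0 !eqxx. Qed.

Lemma shell_bound f K N m n : 0 <= K -> cubic f K -> (maxn `|m| `|n|)%N = N.+1 ->
  cmod (if (m == 0) && (n == 0) then 0 else f (lpt m n)) <= K * Kt ^+ 3 / N.+1%:R ^+ 3.
Proof.
move=> K0 hf hN; case: ifP => [|h]; first by lia.
have l0 : lpt m n != 0 by rewrite lpt_eq0 h.
have := hf _ (lattice_lpt m n) l0.
have := @lpt_lb m n N.+1; rewrite hN leqnn => /(_ isT) hl hK.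
have N0 : 0 < N.+1%:R :> R by rewrite ltr0n.
have K1 := Kt_ge1.
rewrite ler_pdivlMr ?exprn_gt0 //.
apply: le_trans (_ : cmod (f (lpt m n)) * (Kt * cmod (lpt m n)) ^+ 3 <= _).
  by rewrite ler_wpM2l ?cmod_ge0 // lerXn2r // nnegrE ltW // (lt_le_trans N0).
rewrite exprMn mulrCA [leRHS]mulrC ler_wpM2l // exprn_ge0 //; lra.
Qed.

(** 16 = 8 * 2: the shell max (|m|, |n|) = N + 1 has 8 (N + 1) points, and 1 / (N + 1)^2 is at most
    twice 1 / (N + 1) - 1 / (N + 2). *)
Definition bconst (K : R) : R := 16 * (K * Kt ^+ 3).

Lemma bconst_ge0 K : 0 <= K -> 0 <= bconst K.
Proof.
move=> K0; apply: mulr_ge0 => //; apply: mulr_ge0 => //; apply: exprn_ge0.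
exact: le_trans ler01 Kt_ge1.
Qed.

(** Cubic decay gives O(N^-3) at each of the O(N) points of a shell. Stating the resulting O(N^-2)
    as a telescoping difference serves convergence and the bound [box_bound] alike. *)
Lemma box_step f K N : 0 <= K -> cubic f K ->
  cmod (box N.+1 f - box N f) <= bconst K * (N.+1%:R^-1 - N.+2%:R^-1).
Proof.
move=> K0 hf; set a := fun m n => if (m == 0) && (n == 0) then 0 else f (lpt m n).
set B := K * Kt ^+ 3 / N.+1%:R ^+ 3.
have sb m n : (maxn `|m| `|n|)%N = N.+1 -> cmod (a m n) <= B by exact: shell_bound.
have E : box N.+1 f - box N f =
  symsum N.+1 (a (- (N.+1)%:Z)) + symsum N.+1 (a (N.+1)%:Z) +
  symsum N (fun m => a m (- (N.+1)%:Z) + a m (N.+1)%:Z).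
  rewrite /box -/a symsumS.
  have -> : symsum N (fun m => symsum N.+1 (a m)) =
     symsum N (fun m => symsum N (a m)) + symsum N (fun m => a m (- (N.+1)%:Z) + a m (N.+1)%:Z).
    by rewrite -symsumD; apply: eq_symsum => k _; rewrite symsumS; ring.
  by ring.
have h1 : cmod (symsum N.+1 (a (- (N.+1)%:Z))) <= (N.+1.*2.+1)%:R * B.
  by apply: symsum_bound => k hk; apply: sb; lia.
have h2 : cmod (symsum N.+1 (a (N.+1)%:Z)) <= (N.+1.*2.+1)%:R * B.
  by apply: symsum_bound => k hk; apply: sb; lia.
have h3 : cmod (symsum N (fun m => a m (- (N.+1)%:Z) + a m (N.+1)%:Z)) <= (N.*2.+1)%:R * (B + B).
  apply: symsum_bound => k hk; apply: le_trans (cmodD _ _) _.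
  by apply: lerD; apply: sb; lia.
rewrite E; apply: le_trans (cmodD _ _) _.
apply: le_trans (lerD (cmodD _ _) (lexx _)) _.
apply: le_trans (lerD (lerD h1 h2) h3) _.
have -> : (N.+1.*2.+1)%:R * B + (N.+1.*2.+1)%:R * B + (N.*2.+1)%:R * (B + B) = 8 * (N.+1%:R * B).
  rewrite -[N.+1.*2.+1]addn1 -[N.*2.+1]addn1 -!mul2n !natrD !natrM -[N.+1]addn1 natrD.
  by clearbody B; ring.
have N0 : N.+1%:R != 0 :> R by rewrite pnatr_eq0.
have N1 : N.+2%:R != 0 :> R by rewrite pnatr_eq0.
have -> : N.+1%:R^-1 - N.+2%:R^-1 = (N.+1%:R * N.+2%:R)^-1 :> R.
  have E2 : N.+2%:R = N.+1%:R + 1 :> R by rewrite natr1.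
  rewrite E2 in N1 *; move: N0 N1; move: (N.+1%:R : R) => x x0 x1.
  by field; rewrite x0 x1.
have -> : 8 * (N.+1%:R * B) = 16 * (K * Kt ^+ 3) * (2 * N.+1%:R * N.+1%:R)^-1.
  by rewrite /B; move: (N.+1%:R : R) N0 => x x0; field.
rewrite /bconst ler_wpM2l //.
  exact: bconst_ge0.
rewrite lef_pV2 ?posrE ?mulr_gt0 ?ltr0n //.
rewrite [2 * _]mulrC -mulrA ler_pM2l ?ltr0n // -natrM ler_nat; lia.
Qed.

Lemma box_bound f K N : 0 <= K -> cubic f K -> cmod (box N f) <= bconst K.
Proof.
move=> K0 hf; suff : cmod (box N f) <= bconst K * (1 - N.+1%:R^-1).
  move/le_trans; apply; rewrite -[leRHS]mulr1; apply: ler_wpM2l; first exact: bconst_ge0.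
  by rewrite lerBlDr lerDl invr_ge0 ler0n.
elim: N => [|N IH]; first by rewrite box0 cmod0 invr1 subrr mulr0.
have -> : box N.+1 f = (box N.+1 f - box N f) + box N f by ring.
apply: le_trans (cmodD _ _) _; apply: le_trans (lerD (box_step _ K0 hf) IH) _.
by rewrite -mulrDr; apply: ler_wpM2l; [exact: bconst_ge0|move: (_^-1) (_^-1) => x y; lra].
Qed.

Lemma lsum_cvg f K : 0 <= K -> cubic f K -> ccvg (box^~ f) (lattice_sum tau f).
Proof.
move=> K0 hf; have [l hl] := ccvg_telescope (bconst_ge0 K0) (fun N => box_step N K0 hf).
by rewrite lattice_sumE (ccvg_lim hl).
Qed.

Lemma lsum_unique f l : ccvg (box^~ f) l -> lattice_sum tau f = l.
Proof. by move=> h; rewrite lattice_sumE (ccvg_lim h). Qed.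

Lemma lsum_bound f K : 0 <= K -> cubic f K -> cmod (lattice_sum tau f) <= bconst K.
Proof. by move=> K0 hf; apply: ccvg_bound (lsum_cvg K0 hf) => N; apply: box_bound. Qed.

Lemma boxD N f g : box N (fun w => f w + g w) = box N f + box N g.
Proof.
rewrite /box -symsumD; apply: eq_symsum => m _; rewrite -symsumD; apply: eq_symsum => n _.
by case: ifP; rewrite ?addr0.
Qed.

Lemma boxZ N f (c : C) : box N (fun w => c * f w) = c * box N f.
Proof.
rewrite /box -symsumZ; apply: eq_symsum => m _; rewrite -symsumZ; apply: eq_symsum => n _.
by case: ifP; rewrite ?mulr0.
Qed.

Lemma boxN N f : box N (fun w => f (- w)) = box N f.
Proof.
rewrite /box -[RHS]symsum_opp; apply: eq_symsum => m _; rewrite -[RHS]symsum_opp; apply: eq_symsum => n _.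
by rewrite !oppr_eq0 /lpt !rmorphN mulNr -opprD.
Qed.

Lemma eq_box N f g : (forall w, lattice tau w -> w != 0 -> f w = g w) -> box N f = box N g.
Proof.
move=> E; apply: eq_symsum => m _; apply: eq_symsum => n _.
by case: ifP => // h; apply: E; [exact: lattice_lpt|rewrite lpt_eq0 h].
Qed.

Lemma lsum_opp f : lattice_sum tau (fun w => f (- w)) = lattice_sum tau f.
Proof.
rewrite !lattice_sumE; apply: (congr1 (fun u : nat -> C => lim (u @ \oo))).
by apply: funext => N; apply: boxN.
Qed.

Lemma lsum_odd f : (forall w, f (- w) = - f w) -> lattice_sum tau f = 0.
Proof.
move=> h; apply: lsum_unique; apply: ccvg_ext (ccvgC 0) => N.
have : box N f = - box N f.
  by rewrite -{1}boxN -mulN1r -boxZ; apply: eq_box => w _ _; rewrite h mulN1r.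
by move/eqP; rewrite -addr_eq0 -mulr2n mulrn_eq0 /= => /eqP.
Qed.

End Tau.
End Lattice.

(** * Eisenstein series and quasi-periods *)

Section Eisenstein.
Context {R : realType}.
Notation C := (cplx R).
Variable tau : C.
Hypothesis Htau : 0 < complex.Im tau.
Implicit Types (z w h : C) (k N : nat) (m n : int).

Lemma latticeN w : lattice tau w -> lattice tau (- w).
Proof. by case=> m [n ->]; exists (- m), (- n); rewrite !rmorphN mulNr -opprD. Qed.

Lemma latticeD w w' : lattice tau w -> lattice tau w' -> lattice tau (w + w').
Proof. by case=> m [n ->] [m' [n' ->]]; exists (m + m'), (n + n'); rewrite !rmorphD; ring. Qed.

Lemma latticeB w w' : lattice tau w -> lattice tau w' -> lattice tau (w - w').
Proof. by move=> ? /latticeN; apply: latticeD. Qed.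

Lemma lattice0 : lattice tau 0.
Proof. by exists 0, 0; rewrite mul0r addr0. Qed.

Lemma lattice1 : lattice tau 1.
Proof. by exists 1, 0; rewrite mul0r addr0. Qed.

Lemma lattice_tau : lattice tau tau.
Proof. by exists 0, 1; rewrite mul1r add0r. Qed.

Lemma latticeDl z w : lattice tau w -> lattice tau (z + w) <-> lattice tau z.
Proof.
move=> hw; split=> [h|h]; last exact: latticeD.
by have := latticeB h hw; rewrite addrK.
Qed.

(** The point 0 is allowed on purpose: the regular parts [ell] are differentiable there too, which
    yields the Laurent expansions at 0. *)
Definition punctured z := forall w, lattice tau w -> w != 0 -> z != w.

Lemma notin_punctured z : ~ lattice tau z -> punctured z.
Proof. by move=> h w hw _; apply/eqP => E; apply: h; rewrite E. Qed.

Lemma punctured0 : punctured 0.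
Proof. by move=> w _; rewrite eq_sym. Qed.

(** Distinct lattice points are at least 1 / Kt apart, so at most one of them is closer to z than
    half of that. *)
Lemma punctured_dist z : punctured z -> exists2 d : R, 0 < d &
  forall w, lattice tau w -> w != 0 -> d <= cmod (z - w).
Proof.
move=> hz; have K1 := Kt_ge1 Htau; set d0 := (2 * Kt tau)^-1.
have d00 : 0 < d0 by rewrite invr_gt0 mulr_gt0 // (lt_le_trans ltr01).
have [[w1 [hw1 w10 hd]]|H] := pselect (exists w1, [/\ lattice tau w1, w1 != 0 & cmod (z - w1) < d0]); last first.
  exists d0 => // w hw w0; rewrite leNgt; apply/negP => hlt; apply: H.
  by exists w; split.
exists (Num.min d0 (cmod (z - w1))).
  by rewrite lt_min d00 cmod_gt0 subr_eq0; apply: hz.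
move=> w hw w0; have [->|ww1] := eqVneq w w1; first by rewrite ge_min lexx orbT.
rewrite ge_min; apply/orP; left.
have hne : w1 - w != 0 by rewrite subr_eq0 eq_sym.
have := lattice_gap Htau (latticeB hw1 hw) hne.
have -> : w1 - w = (z - w) - (z - w1) by ring.
move=> h1; have h2 := cmodB (z - w) (z - w1).
have h3 : 2 * d0 <= cmod (z - w - (z - w1)).
  rewrite /d0 invfM mulrA divff // mul1r -(ler_pM2l (_ : 0 < Kt tau)) ?(lt_le_trans ltr01) //.
  by rewrite divff // lt0r_neq0 // (lt_le_trans ltr01).
by move: h2 h3 hd; move: (cmod _) (cmod _) (cmod _) d0 {d00} => *; lra.
Qed.

Lemma punctured_gap z : punctured z -> exists2 c : R, 0 < c &
  forall w, lattice tau w -> w != 0 -> c * (1 + cmod w) <= cmod (z - w).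
Proof.
move=> /punctured_dist [d d0 hd].
have z0 := cmod_ge0 z; have D0 : 0 < 1 + cmod z + d by lra.
exists (d / (1 + cmod z + d)); first exact: divr_gt0.
move=> w hw w0; have h := hd _ hw w0.
rewrite mulrAC ler_pdivrMr //.
have : cmod w <= cmod z + cmod (z - w).
  by have := cmodB z (z - w); have -> : z - (z - w) = w by ring.
move: h; move: (cmod w) (cmod z) (cmod (z - w)) z0 => a b x b0 h1 h2.
have : d * (1 + a) <= d * (1 + b + x) by rewrite ler_pM2l //; lra.
have : d * (1 + b) <= x * (1 + b) by rewrite ler_wpM2r //; lra.
lra.
Qed.

Lemma punctured_near z : punctured z -> \forall x \near z, punctured x.
Proof.
move=> /punctured_dist [d d0 hd]; apply/near0P; exists d => // h hh w hw w0.
apply/eqP => E; have := hd _ hw w0; rewrite -E.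
have -> : z - (z + h) = - h by ring.
by rewrite cmodN leNgt hh.
Qed.

Lemma notin_near z : ~ lattice tau z -> \forall x \near z, ~ lattice tau x.
Proof.
move=> hz; have z0 : z != 0 by apply/eqP => E; apply: hz; rewrite E; apply: lattice0.
have h1 := punctured_near (notin_punctured hz).
have h2 := ccont_near_neq (@ccontI _ z) z0.
near=> x => hx; have x0 : x != 0 by near: x.
have hp : punctured x by near: x.
by have := hp x hx x0; rewrite eqxx.
Unshelve. all: by end_near. Qed.

(** General term of the k-th Eisenstein series without its pole at 0, carrying the convergence terms
    of zeta for k = 1 and of wp for k = 2. Treating all k together makes wp' and wp'' members of the
    same family. *)
Definition phi k z w : C := match k with
  | 1%N => (z - w)^-1 + w^-1 + z * w ^- 2
  | 2%N => (z - w) ^- 2 - w ^- 2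
  | _ => (z - w) ^- k end.

Definition ell k z : C := lattice_sum tau (phi k z).
Definition eis k z : C := z ^- k + ell k z.

Lemma wpE z : wp tau z = eis 2 z. Proof. by []. Qed.
Lemma zetaE z : zeta tau z = eis 1 z. Proof. by rewrite /eis expr1. Qed.

Lemma cubic_bound (c : R) (k : nat) (b w : C) : 0 < c -> (2 < k)%N ->
  c * (1 + cmod w) <= cmod b -> (cmod b)^-1 ^+ k * cmod w ^+ 3 <= c^-1 ^+ k.
Proof.
move=> c0 k3 h; have w0 := cmod_ge0 w.
have c1 : 0 < c * (1 + cmod w) by rewrite mulr_gt0 //; lra.
have b0 : 0 < cmod b := lt_le_trans c1 h.
have i1 : (cmod b)^-1 <= c^-1 * (1 + cmod w)^-1.
  by rewrite -invfM lef_pV2 // posrE // mulrC.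
have i2 : (cmod b)^-1 ^+ k <= c^-1 ^+ k * (1 + cmod w)^-1 ^+ k.
  rewrite -exprMn lerXn2r // nnegrE ?invr_ge0 ?(ltW b0) //.
  by rewrite -invfM invr_ge0 ltW // mulrC.
apply: le_trans (ler_wpM2r _ i2) _; first by rewrite exprn_ge0.
rewrite -mulrA ler_piMr ?exprn_ge0 ?invr_ge0 ?(ltW c0) //.
have W0 : 0 < 1 + cmod w by lra.
rewrite exprVn mulrC ler_pdivrMr ?exprn_gt0 // mul1r.
apply: le_trans (_ : (1 + cmod w) ^+ 3 <= _).
  by rewrite lerXn2r ?nnegrE //; lra.
by rewrite ler_weXn2l //; lra.
Qed.

Lemma phi_cubic k z : (0 < k)%N -> punctured z -> exists2 K, 0 <= K & cubic tau (phi k z) K.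
Proof.
move=> k0 hz; have [c c0 hc] := punctured_gap hz.
have z0 := cmod_ge0 z.
have ci : 0 <= c^-1 by rewrite invr_ge0 ltW.
case: k k0 => [//|[_|[_|k _]]] /=.
- exists (cmod z ^+ 2 * c^-1); first by rewrite mulr_ge0 ?exprn_ge0.
  move=> w hw w0; have zw : z - w != 0 by rewrite subr_eq0; apply: hz.
  rewrite /phi; have -> : (z - w)^-1 + w^-1 + z * w ^- 2 = z ^+ 2 / (w ^+ 2 * (z - w)).
    by field; rewrite w0 zw.
  rewrite cmodM cmodV cmodM !cmodX.
  have wp : 0 < cmod w by rewrite cmod_gt0.
  have -> : cmod z ^+ 2 / (cmod w ^+ 2 * cmod (z - w)) * cmod w ^+ 3 =
    cmod z ^+ 2 * (cmod w / cmod (z - w)).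
    by field; rewrite !lt0r_neq0 // cmod_gt0.
  rewrite ler_wpM2l ?exprn_ge0 // ler_pdivrMr ?cmod_gt0 // [leRHS]mulrC ler_pdivlMr //.
  by rewrite mulrC; apply: le_trans (hc _ hw w0); rewrite ler_wpM2l ?(ltW c0) //; lra.
- exists (cmod z * (2 + cmod z) * c^-1 ^+ 2).
    by rewrite !mulr_ge0 ?exprn_ge0 //; lra.
  move=> w hw w0; have zw : z - w != 0 by rewrite subr_eq0; apply: hz.
  rewrite /phi; have -> : (z - w) ^- 2 - w ^- 2 = z * (2 * w - z) / (w ^+ 2 * (z - w) ^+ 2).
    by field; rewrite w0 zw.
  rewrite !(cmodM, cmodV, cmodX).
  have wp : 0 < cmod w by rewrite cmod_gt0.
  have -> : cmod z * cmod (2 * w - z) / (cmod w ^+ 2 * cmod (z - w) ^+ 2) * cmod w ^+ 3 =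
    cmod z * (cmod (2 * w - z) * cmod w / cmod (z - w) ^+ 2).
    by field; rewrite !lt0r_neq0 // cmod_gt0.
  rewrite -[leRHS]mulrA ler_wpM2l // ler_pdivrMr ?exprn_gt0 ?cmod_gt0 //.
  have h1 : cmod (2 * w - z) <= 2 * cmod w + cmod z.
    by apply: le_trans (cmodB _ _) _; rewrite cmodM cmod_nat.
  have h2 : (1 + cmod w) ^+ 2 <= c^-1 ^+ 2 * cmod (z - w) ^+ 2.
    rewrite -exprMn lerXn2r // ?nnegrE; try by rewrite ?mulr_ge0 ?cmod_ge0 //; lra.
    by rewrite mulrC ler_pdivlMr // mulrC; apply: hc.
  have h3 : cmod (2 * w - z) * cmod w <= (2 * cmod w + cmod z) * cmod w by rewrite ler_wpM2r ?cmod_ge0.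
  apply: le_trans h3 _; rewrite -mulrA.
  apply: le_trans (_ : (2 + cmod z) * (1 + cmod w) ^+ 2 <= _); last by rewrite ler_wpM2l //; lra.
  by move: z0 wp; move: (cmod z) (cmod w) => a b; nra.
exists (c^-1 ^+ k.+3); first exact: exprn_ge0.
move=> w hw w0; rewrite /phi cmodV cmodX -exprVn; apply: cubic_bound => //; exact: hc.
Qed.

Definition ellP k z (k0 : (0 < k)%N) (hz : punctured z) : ccvg (fun N => box tau N (phi k z)) (ell k z) :=
  let: ex_intro2 K K0 h := phi_cubic k0 hz in lsum_cvg Htau K0 h.

(** The Taylor remainder of x^-k is controlled through one common bound M for 1/|a| and 1/|a + h|,
    because it will be summed over the lattice. Induction on k, splitting off one factor of the
    power. *)
Lemma pow_rem k : exists2 Ck : R, 0 <= Ck & forall (a h : C) (M : R), a != 0 -> a + h != 0 ->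
  (cmod a)^-1 <= M -> (cmod (a + h))^-1 <= M ->
  cmod ((a + h) ^- k - a ^- k + k%:R * h * a ^- k.+1) <= Ck * cmod h ^+ 2 * M ^+ k.+2.
Proof.
elim: k => [|k [Ck C0 IH]].
  exists 0 => // a h M _ _ _ _; rewrite !expr0 invr1 mul0r mul0r addr0 subrr cmod0.
  by rewrite !mul0r.
exists (Ck + 1 + k%:R); first by rewrite !addr_ge0 ?ler0n.
move=> a h M a0 b0 aM bM; have := IH a h M a0 b0 aM bM.
set b := a + h in b0 bM *; set D := _ + _ * h * _ => hD.
have hE : h = b - a by rewrite /b; ring.
have e1 : b^-1 - a^-1 = - h * (a^-1 * b^-1) by rewrite hE; field; rewrite a0 b0.
have e2 : b^-1 - a^-1 + h * a ^- 2 = h ^+ 2 * (a^-1 * a^-1 * b^-1).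
  by rewrite hE; field; rewrite a0 b0.
have -> : b ^- k.+1 - a ^- k.+1 + k.+1%:R * h * a ^- k.+2 =
   b^-1 * D + a ^- k * (b^-1 - a^-1 + h * a ^- 2) - k%:R * h * a ^- k.+1 * (b^-1 - a^-1).
  rewrite /D -!exprVn !exprS expr0 -[k.+1%:R]natr1; ring.
rewrite e2 e1.
have M0 : 0 <= M by apply: le_trans aM; rewrite invr_ge0 cmod_ge0.
have m0 := cmod_ge0 h.
apply: le_trans (cmodB _ _) _; apply: le_trans (lerD (cmodD _ _) (lexx _)) _.
have ai : cmod a^-1 <= M by rewrite cmodV.
have bi : cmod b^-1 <= M by rewrite cmodV.
have ak j : cmod (a ^- j) <= M ^+ j.
  by rewrite -exprVn cmodX lerXn2r // nnegrE ?cmod_ge0.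
have t1 : cmod (b^-1 * D) <= M * (Ck * cmod h ^+ 2 * M ^+ k.+2).
  by rewrite cmodM ler_pM ?cmod_ge0.
have t2 : cmod (a ^- k * (h ^+ 2 * (a^-1 * a^-1 * b^-1))) <= M ^+ k * (cmod h ^+ 2 * (M * M * M)).
  rewrite cmodM (cmodM (h ^+ 2)) cmodX !cmodM; apply: ler_pM; rewrite ?mulr_ge0 ?exprn_ge0 ?cmod_ge0 //.
  by rewrite ler_wpM2l ?exprn_ge0 // !ler_pM ?mulr_ge0 ?cmod_ge0.
have t3 : cmod (k%:R * h * a ^- k.+1 * (- h * (a^-1 * b^-1))) <= k%:R * cmod h * M ^+ k.+1 * (cmod h * (M * M)).
  rewrite !cmodM cmodN cmod_nat; apply: ler_pM; rewrite ?mulr_ge0 ?exprn_ge0 ?cmod_ge0 //.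
    by rewrite ler_wpM2l ?mulr_ge0 ?ler0n.
  by rewrite ler_wpM2l // ler_pM ?cmod_ge0.
apply: le_trans (lerD (lerD t1 t2) t3) _.
by rewrite !exprS expr0; move: (M ^+ k) => X; rewrite le_eqVlt; apply/orP; left; apply/eqP; ring.
Qed.

(** The convergence terms of [phi 1] and [phi 2] are affine in z and drop out of the remainder, so
    that every k obeys the same estimate. *)
Lemma phi_rem k z h w : (0 < k)%N ->
  phi k (z + h) w - phi k z w + k%:R * h * phi k.+1 z w =
  (z - w + h) ^- k - (z - w) ^- k + k%:R * h * (z - w) ^- k.+1.
Proof.
rewrite /phi (_ : z + h - w = z - w + h); last by ring.
case: k => [//|[|[|k]]] _ //=; last by ring.
by rewrite !expr1; ring.
Qed.

(** Termwise differentiation by a direct estimate: the Taylor remainder of the sum is the lattice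
    sum of the remainders D, whose terms are at most a multiple of |h|^2 / |w|^3. *)
Lemma ell_deriv k z : (0 < k)%N -> punctured z -> cderiv (ell k) z (- k%:R * ell k.+1 z).
Proof.
move=> k0 hz; have [c c0 hc] := punctured_gap hz.
have [Ck C0 hC] := pow_rem k.
have [d d0 hd] : exists2 d : R, 0 < d & forall h, cmod h < d -> punctured (z + h).
  by apply/near0P; apply: punctured_near.
(* Half of the gap constant: for |h| < c' the bound c' (1 + |w|) holds below both |z - w| and |z - w
   + h|. *)
set c' := c / 2; have c'0 : 0 < c' by rewrite divr_gt0.
set B := bconst tau (Ck * c'^-1 ^+ k.+2).
have B0 : 0 <= B by apply: bconst_ge0 => //; rewrite mulr_ge0 // exprn_ge0 // invr_ge0 ltW.
have bound h : cmod h < Num.min d c' ->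
    cmod (ell k (z + h) - ell k z - (- k%:R * ell k.+1 z) * h) <= B * cmod h ^+ 2.
  rewrite lt_min => /andP[hd' hc'].
  pose D w := phi k (z + h) w - phi k z w + k%:R * h * phi k.+1 z w.
  have cD : cubic tau D (Ck * c'^-1 ^+ k.+2 * cmod h ^+ 2).
    move=> w hw w0; rewrite /D phi_rem //.
    have zw : z - w != 0 by rewrite subr_eq0; apply: hz.
    have zhw : z - w + h != 0.
      have -> : z - w + h = z + h - w by ring.
      by rewrite subr_eq0; apply: hd.
    have w1 := cmod_ge0 w.
    have g1 := hc _ hw w0.
    have g2 : c' * (1 + cmod w) <= cmod (z - w + h).
      have h1 := cmod_lb (z - w) h.
      have h2 : c' <= c' * (1 + cmod w) by rewrite ler_peMr ?(ltW c'0) //; lra.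
      have h3 : c * (1 + cmod w) = c' * (1 + cmod w) + c' * (1 + cmod w) by rewrite /c'; field.
      by move: g1 h1 h2 hc'; rewrite h3; move: (cmod (z - w)) (cmod _) (cmod h) => *; lra.
    have g1' : c' * (1 + cmod w) <= cmod (z - w).
      apply: le_trans g1; rewrite ler_wpM2r //; [lra|rewrite /c'; lra].
    have cw0 : 0 < c' * (1 + cmod w) by rewrite mulr_gt0 //; lra.
    pose b := cr (c' * (1 + cmod w)).
    have bE : cmod b = c' * (1 + cmod w) by rewrite cmod_cr gtr0_norm.
    have := hC (z - w) h (cmod b)^-1 zw zhw.
    rewrite !lef_pV2 ?posrE ?bE ?cmod_gt0 // => /(_ g1' g2) hr.
    have hb : (cmod b)^-1 ^+ k.+2 * cmod w ^+ 3 <= c'^-1 ^+ k.+2.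
      by apply: cubic_bound; rewrite ?bE //; lia.
    rewrite bE in hb.
    apply: le_trans (ler_wpM2r (exprn_ge0 3 w1) hr) _.
    rewrite -[leLHS]mulrA [leRHS]mulrAC; apply: ler_wpM2l hb.
    by rewrite mulr_ge0 // exprn_ge0 ?cmod_ge0.
  have lD : lattice_sum tau D = ell k (z + h) - ell k z - (- k%:R * ell k.+1 z) * h.
    have cv := ccvgD (ccvgD (ellP k0 (hd _ hd')) (ccvgZ (-1) (ellP k0 hz)))
        (ccvgZ (k%:R * h) (ellP (ltn0Sn k) hz)).
    have cvD : ccvg (fun N => box tau N D)
        (ell k (z + h) + (-1) * ell k z + (k%:R * h) * ell k.+1 z).
      apply: ccvg_ext cv => N; rewrite -!boxZ -!boxD; apply: (eq_box Htau) => w _ _.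
      by rewrite /D mulN1r.
    apply: etrans (lsum_unique Htau cvD) _.
    by move: (ell k _) (ell k z) (ell _ z) => x y t; ring.
  rewrite -lD; apply: le_trans (lsum_bound Htau _ cD) _.
    apply: mulr_ge0; last by rewrite exprn_ge0 ?cmod_ge0.
    by rewrite mulr_ge0 // exprn_ge0 // invr_ge0 ltW.
  by rewrite /B /bconst; rewrite le_eqVlt; apply/orP; left; apply/eqP; ring.
move=> e e0; have B1 : 0 < 1 + B by lra.
exists (Num.min (Num.min d c') (e / (1 + B))).
  by rewrite !lt_min d0 c'0 divr_gt0.
move=> h; rewrite lt_min => /andP[/bound hb]; rewrite ltr_pdivlMr // => he.
apply: le_trans hb _; rewrite expr2 mulrA ler_wpM2r ?cmod_ge0 //.
by apply: le_trans (ltW he); rewrite mulrC ler_wpM2l ?cmod_ge0 //; lra.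
Qed.

Lemma cderivXV z k : z != 0 -> cderiv (fun x => x ^- k) z (- k%:R * z ^- k.+1).
Proof.
move=> z0; elim: k => [|k IH].
  by rewrite oppr0 mul0r; have := cderivC (1 : C) z; apply: cderiv_ext; near=> w; rewrite expr0 invr1.
have := cderivM (cderivV z0 (cderivI z)) IH.
have E : - 1 / z ^+ 2 * z ^- k + z^-1 * (- k%:R * z ^- k.+1) = - k.+1%:R * z ^- k.+2.
  by rewrite -!exprVn !exprS -[k.+1%:R]natr1 expr0; ring.
move/cderiv_eq => /(_ _ E); apply: cderiv_ext.
by near=> w; rewrite exprS invfM.
Unshelve. all: by end_near. Qed.

Lemma eis_deriv k z : (0 < k)%N -> ~ lattice tau z -> cderiv (eis k) z (- k%:R * eis k.+1 z).
Proof.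
move=> k0 hz; rewrite /eis mulrDr; apply: cderivD.
  by apply: cderivXV; apply/eqP => E; apply: hz; rewrite E; apply: lattice0.
by apply: ell_deriv => //; apply: notin_punctured.
Qed.

Lemma phiN k z w : (0 < k)%N -> phi k (- z) (- w) = (-1) ^+ k * phi k z w.
Proof.
rewrite /phi (_ : - z - - w = - (z - w)); last by ring.
case: k => [//|[|[|k]]] _ /=.
- by rewrite expr1 !invrN sqrrN; ring.
- by rewrite !sqrrN expr2; ring.
by rewrite -[- (z - w)]mulN1r exprMn invfM invr_sign.
Qed.

Lemma ellN k z : (0 < k)%N -> punctured z -> ell k (- z) = (-1) ^+ k * ell k z.
Proof.
move=> k0 hz; rewrite /ell -(lsum_opp Htau (phi k (- z))).
apply: (lsum_unique Htau); apply: ccvg_ext (ccvgZ ((-1) ^+ k) (ellP k0 hz)) => N.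
by rewrite -boxZ; apply: (eq_box Htau) => w _ _; rewrite phiN.
Qed.

Lemma eisN k z : (0 < k)%N -> ~ lattice tau z -> eis k (- z) = (-1) ^+ k * eis k z.
Proof.
move=> k0 hz; rewrite /eis ellN //; last exact: notin_punctured.
by rewrite mulrDr; congr (_ + _); rewrite -[- z]mulN1r exprMn invfM invr_sign.
Qed.

Lemma ell1_0 : ell 1 0 = 0.
Proof. by apply: (lsum_odd Htau) => w /=; rewrite !sub0r mul0r !invrN; ring. Qed.

Lemma ell2_0 : ell 2 0 = 0.
Proof.
apply: (lsum_unique Htau); apply: ccvg_ext (ccvgC 0) => N.
have -> : box tau N (phi 2 0) = box tau N (fun w => 0 * w).
  by apply: (eq_box Htau) => w _ _ /=; rewrite sub0r sqrrN subrr mul0r.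
by rewrite boxZ mul0r.
Qed.

Lemma ell_odd0 k : (2 < k)%N -> odd k -> ell k 0 = 0.
Proof.
case: k => [|[|[|k]]] // _ ko; apply: (lsum_odd Htau) => w /=.
by rewrite !sub0r opprK -[- w]mulN1r exprMn -signr_odd ko expr1 mulN1r invrN opprK.
Qed.

End Eisenstein.

Opaque lattice_sum.

(** * Quasi-periods of zeta and periodicity of its derivatives *)

Section Periods.
Context {R : realType}.
Notation C := (cplx R).
Variable tau : C.
Hypothesis Htau : 0 < complex.Im tau.
Implicit Types (z w h : C) (N : nat) (m n : int).
Notation eis := (eis tau).
Notation lpt := (lpt tau).

Lemma symsum_cst0 N : symsum N (fun=> 0 : C) = 0.
Proof. exact: big1. Qed.

Lemma symsum_delta N (c : C) : symsum N (fun k : int => if k == 0 then c else 0) = c.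
Proof.
elim: N => [|N IH]; first by rewrite symsum0.
by rewrite symsumS IH /= add0r addr0.
Qed.

(** In a symmetric box the sum of w^-1 vanishes. What remains besides the plain sum of 1 / (z + w)
    is linear in z, so a translation affects it by a term independent of z. *)
Lemma zeta_box z : ~ lattice tau z ->
  ccvg (fun N => symsum N (fun m => symsum N (fun n => (z + lpt m n)^-1))
                 + z * box tau N (fun w => w ^- 2)) (zeta tau z).
Proof.
move=> hz; have hp := notin_punctured hz.
have cv := ccvgD (ccvgC (z^-1)) (ellP Htau (ltn0Sn 0) hp).
rewrite zetaE /eis expr1; apply: ccvg_ext cv => N.
have odd0 : box tau N (fun w => w^-1) = 0.
  have : box tau N (fun w => w^-1) = - box tau N (fun w => w^-1).
    rewrite -{1}(boxN tau) -mulN1r -boxZ; apply: (eq_box Htau) => w _ _.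
    by rewrite invrN mulN1r.
  by move/eqP; rewrite -addr_eq0 -mulr2n mulrn_eq0 /= => /eqP.
have -> : box tau N (phi 1 z) = box tau N (fun w => (z - w)^-1) + box tau N (fun w => w^-1)
   + z * box tau N (fun w => w ^- 2) by rewrite -boxZ -!boxD.
rewrite odd0 addr0 addrA; congr (_ + _).
have -> : box tau N (fun w => (z - w)^-1) = box tau N (fun w => (z + w)^-1).
  by rewrite -(boxN tau); apply: (eq_box Htau) => w _ _; rewrite opprK.
have -> : z^-1 = symsum N (fun m => symsum N (fun n => if (m == 0) && (n == 0) then z^-1 else 0)).
  rewrite -{1}(symsum_delta N z^-1); apply: eq_symsum => m _.
  by case: eqP => _ /=; rewrite ?symsum_delta // symsum_cst0.
rewrite /box -symsumD; apply: eq_symsum => m _; rewrite -symsumD; apply: eq_symsum => n _.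
case: ifP => [/andP[/eqP -> /eqP ->]|_]; last by rewrite add0r.
by rewrite /lpt mul0r !addr0.
Qed.

(** What survives when the box is translated by 1: the column entering at m = N + 1 minus the column
    leaving at m = - N. *)
Definition bd1 N z : C := symsum N (fun n => (z + lpt N.+1%:Z n)^-1 - (z + lpt (- N%:Z) n)^-1).
Definition bd2 N z : C := symsum N (fun m => (z + lpt m N.+1%:Z)^-1 - (z + lpt m (- N%:Z))^-1).

Lemma zeta_bd1 z : ~ lattice tau z ->
  ccvg (fun N => bd1 N z + box tau N (fun w => w ^- 2)) (zeta tau (z + 1) - zeta tau z).
Proof.
move=> hz; have hz1 : ~ lattice tau (z + 1) by rewrite latticeDl //; apply: lattice1.
apply: ccvg_ext (ccvgB (zeta_box hz1) (zeta_box hz)) => N.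
rewrite opprD addrACA -mulrBl [z + 1]addrC addrK mul1r; congr (_ + _).
pose g (m : int) := symsum N (fun n => (z + lpt m n)^-1).
have -> : symsum N (fun m => symsum N (fun n => (1 + z + lpt m n)^-1)) = symsum N (fun m => g (m + 1)).
  apply: eq_symsum => m _; apply: eq_symsum => n _; congr (_^-1).
  by rewrite /lpt rmorphD /=; ring.
by rewrite symsum_shift /g -symsumB.
Qed.

Lemma zeta_bd2 z : ~ lattice tau z ->
  ccvg (fun N => bd2 N z + tau * box tau N (fun w => w ^- 2)) (zeta tau (z + tau) - zeta tau z).
Proof.
move=> hz; have hz1 : ~ lattice tau (z + tau) by rewrite latticeDl //; apply: lattice_tau.
apply: ccvg_ext (ccvgB (zeta_box hz1) (zeta_box hz)) => N.
rewrite opprD addrACA -mulrBl [z + tau]addrC addrK; congr (_ + _).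
rewrite !(symsum_exchange N (fun m n => (_ + lpt m n)^-1)).
pose g (n : int) := symsum N (fun m => (z + lpt m n)^-1).
have -> : symsum N (fun n => symsum N (fun m => (tau + z + lpt m n)^-1)) = symsum N (fun n => g (n + 1)).
  apply: eq_symsum => m _; apply: eq_symsum => n _; congr (_^-1).
  by rewrite /lpt rmorphD /=; ring.
by rewrite symsum_shift /g -symsumB.
Qed.

Lemma gap z : ~ lattice tau z -> exists2 c : R, 0 < c &
  forall w, lattice tau w -> c * (1 + cmod w) <= cmod (z + w).
Proof.
move=> hz; have [c c0 hc] := punctured_gap Htau (notin_punctured hz).
have z0 : z != 0 by apply/eqP => E; apply: hz; rewrite E; apply: lattice0.
exists (Num.min c (cmod z)); first by rewrite lt_min c0 cmod_gt0.
move=> w hw; have [->|w0] := eqVneq w 0.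
  by rewrite cmod0 !addr0 mulr1 ge_min lexx orbT.
have -> : z + w = z - (- w) by rewrite opprK.
have := hc (- w) (latticeN hw); rewrite oppr_eq0 cmodN => /(_ w0).
by apply: le_trans; rewrite ler_wpM2r ?ge_min ?lexx // addr_ge0 ?cmod_ge0.
Qed.

(** The boundary has O(N) points, of modulus at least of order N. Replacing z by z' changes each
    term by O(N^-2), hence the sums by O(1 / N). This is what makes the quasi-periods constants. *)
Lemma bd_indep (L1 L2 : nat -> int -> C) z z' : ~ lattice tau z -> ~ lattice tau z' ->
  (forall N (k : int), lattice tau (L1 N k) /\ N%:R <= Kt tau * cmod (L1 N k)) ->
  (forall N (k : int), lattice tau (L2 N k) /\ N%:R <= Kt tau * cmod (L2 N k)) ->
  ccvg (fun N => symsum N (fun k => (z + L1 N k)^-1 - (z + L2 N k)^-1) -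
        symsum N (fun k => (z' + L1 N k)^-1 - (z' + L2 N k)^-1)) 0.
Proof.
move=> hz hz' h1 h2; have [c c0 hc] := gap hz; have [d d0 hd] := gap hz'.
have K1 := Kt_ge1 Htau; have K0 : 0 < Kt tau := lt_le_trans ltr01 K1.
have inv_le (x : C) (e : R) N (w : C) : 0 < e -> e * (1 + cmod w) <= cmod (x + w) ->
    N%:R <= Kt tau * cmod w -> (cmod (x + w))^-1 <= Kt tau / e / N.+1%:R.
  move=> e0 he hN; have w1 : 0 < 1 + cmod w by have := cmod_ge0 w; lra.
  have p1 : 0 < cmod (x + w) by apply: lt_le_trans he; rewrite mulr_gt0.
  have N0 : 0 < N.+1%:R :> R by rewrite ltr0n.
  rewrite ler_pdivlMr // mulrC ler_pdivrMr // mulrAC ler_pdivlMr //.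
  apply: le_trans (_ : Kt tau * (1 + cmod w) * e <= _).
    by rewrite ler_pM2r // -natr1 mulrDr mulr1 addrC lerD.
  by rewrite -mulrA ler_pM2l // mulrC.
set B := cmod (z' - z) * (Kt tau / c * (Kt tau / d)).
have B0 : 0 <= B by rewrite !mulr_ge0 ?invr_ge0 ?cmod_ge0 // ltW.
have term N (w : C) : lattice tau w -> N%:R <= Kt tau * cmod w ->
  cmod ((z + w)^-1 - (z' + w)^-1) <= B / N.+1%:R / N.+1%:R.
  move=> hw hN.
  have i1 := inv_le z c N w c0 (hc _ hw) hN; have i2 := inv_le z' d N w d0 (hd _ hw) hN.
  have w1 : 0 < 1 + cmod w by have := cmod_ge0 w; lra.
  have n1 : z + w != 0 by rewrite -cmod_gt0; apply: lt_le_trans (hc _ hw); rewrite mulr_gt0.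
  have n2 : z' + w != 0 by rewrite -cmod_gt0; apply: lt_le_trans (hd _ hw); rewrite mulr_gt0.
  have -> : (z + w)^-1 - (z' + w)^-1 = (z' - z) * ((z + w)^-1 * (z' + w)^-1).
    by field; rewrite n1 n2.
  rewrite !cmodM !cmodV.
  have -> : B / N.+1%:R / N.+1%:R = cmod (z' - z) * ((Kt tau / c / N.+1%:R) * (Kt tau / d / N.+1%:R)).
    by rewrite /B; move: (N.+1%:R^-1) (c^-1) (d^-1) => u v t; ring.
  rewrite ler_wpM2l ?cmod_ge0 //.
  by apply: ler_pM => //; rewrite invr_ge0 cmod_ge0.
clearbody B; apply: (@ccvg_harmonic _ _ (4 * B)) => N.
rewrite -symsumB.
have N0 : 0 < N.+1%:R :> R by rewrite ltr0n.
apply: le_trans (_ : (N.*2.+1)%:R * (2 * (B / N.+1%:R / N.+1%:R)) <= _).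
  apply: symsum_bound => k _; have [l1 k1] := h1 N k; have [l2 k2] := h2 N k.
  have -> : (z + L1 N k)^-1 - (z + L2 N k)^-1 - ((z' + L1 N k)^-1 - (z' + L2 N k)^-1) =
    ((z + L1 N k)^-1 - (z' + L1 N k)^-1) - ((z + L2 N k)^-1 - (z' + L2 N k)^-1).
    by move: (_^-1) (_^-1) (_^-1) (_^-1) => a b e f; ring.
  apply: le_trans (cmodB _ _) _; rewrite mulrDl mul1r; apply: lerD; exact: term.
have : (N.*2.+1)%:R <= 2 * N.+1%:R :> R by rewrite -natrM ler_nat -mul2n; lia.
move: (N.*2.+1%:R : R) (N.+1%:R : R) N0 => x y y0 xy.
have yi : 0 <= y^-1 by rewrite invr_ge0 ltW.
have Y0 : 0 <= 2 * (B / y / y) by rewrite !mulr_ge0.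
apply: le_trans (ler_wpM2r Y0 xy) _.
by rewrite le_eqVlt; apply/orP; left; apply/eqP; field; rewrite lt0r_neq0.
Qed.

Lemma bd1_indep z z' : ~ lattice tau z -> ~ lattice tau z' -> ccvg (fun N => bd1 N z - bd1 N z') 0.
Proof.
move=> hz hz'; apply: (@bd_indep (fun N n => lpt N.+1%:Z n) (fun N n => lpt (- N%:Z) n)) => // N k.
  by split; [exact: lattice_lpt|apply: lpt_lb => //; lia].
by split; [exact: lattice_lpt|apply: lpt_lb => //; lia].
Qed.

Lemma bd2_indep z z' : ~ lattice tau z -> ~ lattice tau z' -> ccvg (fun N => bd2 N z - bd2 N z') 0.
Proof.
move=> hz hz'; apply: (@bd_indep (fun N n => lpt n N.+1%:Z) (fun N n => lpt n (- N%:Z))) => // N k.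
  by split; [exact: lattice_lpt|apply: lpt_lb => //; lia].
by split; [exact: lattice_lpt|apply: lpt_lb => //; lia].
Qed.

Lemma half_notin (s t : R) : (forall m : int, s != m%:~R) \/ (forall n : int, t != n%:~R) ->
  ~ lattice tau (cr s + cr t * tau).
Proof.
move=> H [m [n E]].
have E2 : cr (s - m%:~R) + cr (t - n%:~R) * tau = 0.
  by rewrite !crB !cr_int; move: E; move: (cr s) (cr t) => a b E; rewrite mulrBl addrACA E; ring.
have := coord_x Htau (s - m%:~R) (t - n%:~R); have := coord_y Htau (s - m%:~R) (t - n%:~R).
rewrite E2 cmod0 mulr0 !normr_le0 !subr_eq0 => hb ha.
by case: H => [/(_ m)|/(_ n)]; rewrite ?ha ?hb.
Qed.

Lemma half_notin1 : ~ lattice tau (2^-1).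
Proof.
have -> : 2^-1 = cr 2^-1 + cr 0 * tau :> C by rewrite crV cr_nat mul0r addr0.
by apply: half_notin; left; apply: half_nint.
Qed.

Lemma quasi_period1 z : ~ lattice tau z -> zeta tau (z + 1) - zeta tau z = quasi_period tau 1.
Proof.
have ex : exists c : C, forall z, ~ lattice tau z -> zeta tau (z + omega tau 1) - zeta tau z = c.
  exists (zeta tau (2^-1 + 1) - zeta tau 2^-1) => x hx.
  have h := ccvgB (zeta_bd1 hx) (zeta_bd1 half_notin1).
  apply/eqP; rewrite -subr_eq0; apply/eqP; apply: ccvg_unique h _.
  by apply: ccvg_ext (bd1_indep hx half_notin1) => N; rewrite opprD addrACA subrr addr0.
by have := @getPex _ [set c : C | forall z, ~ lattice tau z -> zeta tau (z + omega tau 1) - zeta tau z = c] ex z.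
Qed.

Lemma quasi_period2 z : ~ lattice tau z -> zeta tau (z + tau) - zeta tau z = quasi_period tau 2.
Proof.
have ex : exists c : C, forall z, ~ lattice tau z -> zeta tau (z + omega tau 2) - zeta tau z = c.
  exists (zeta tau (2^-1 + tau) - zeta tau 2^-1) => x hx.
  have h := ccvgB (zeta_bd2 hx) (zeta_bd2 half_notin1).
  apply/eqP; rewrite -subr_eq0; apply/eqP; apply: ccvg_unique h _.
  by apply: ccvg_ext (bd2_indep hx half_notin1) => N; rewrite opprD addrACA subrr addr0.
by have := @getPex _ [set c : C | forall z, ~ lattice tau z -> zeta tau (z + omega tau 2) - zeta tau z = c] ex z.
Qed.

Lemma Im_inv (a w : C) : complex.Im (a * w^-1) = complex.Im (a * (w^*)%C) / cmod w ^+ 2.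
Proof.
rewrite cmod_sq; case: a => p q; case: w => x y /=.
by rewrite /GRing.inv /=; ring.
Qed.

Lemma Im_tau_inv (x y : R) : complex.Im (tau * (cr x + cr y * tau)^-1) =
  x * complex.Im tau / cmod (cr x + cr y * tau) ^+ 2.
Proof. by rewrite Im_inv; congr (_ / _); case: (tau) => p q /=; ring. Qed.

Lemma Im_one_inv (x y : R) : complex.Im ((cr x + cr y * tau)^-1) =
  - y * complex.Im tau / cmod (cr x + cr y * tau) ^+ 2.
Proof.
rewrite -[_^-1]mul1r Im_inv; congr (_ / _); case: (tau) => p q /=; ring.
Qed.

Lemma Im_symsum_lb N (g : int -> C) (B : R) : (forall k : int, (`|k| <= N)%N -> B <= complex.Im (g k)) ->
  (N.*2.+1)%:R * B <= complex.Im (symsum N g).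
Proof.
move=> H; have -> : complex.Im (symsum N g) = \sum_(i < N.*2.+1) complex.Im (g (i%:Z - N%:Z)).
  by rewrite /symsum; elim/big_rec2: _ => // i x y _ <-; rewrite ImD.
apply: le_trans (_ : \sum_(i < N.*2.+1) B <= _).
  by rewrite sumr_const card_ord -[leRHS]mulr_natl.
by apply: ler_sum => i _; apply: H; have := ltn_ord i; lia.
Qed.

(** The sums of w^-2, which do not converge absolutely, cancel between tau eta_1 and eta_2. Only
    boundary terms are left, and those coming from [bd1] already keep the imaginary part away from
    0. *)
Lemma legendre_neq : tau * quasi_period tau 1 - quasi_period tau 2 != 0.
Proof.
(* These base points centre the box: its sides lie at +-M and +-M tau with M = N + 1/2, and opposite
   sides contribute imaginary parts of the same sign. *)
pose z1 : C := - 2^-1; pose z2 : C := - (2^-1 * tau).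
have h1 : ~ lattice tau z1 by move=> /latticeN; rewrite opprK; apply: half_notin1.
have h2 : ~ lattice tau z2.
  move=> /latticeN; rewrite opprK.
  have -> : 2^-1 * tau = cr 0 + cr 2^-1 * tau by rewrite crV cr_nat cr0 add0r.
  by apply: half_notin; right; apply: half_nint.
have c1 := zeta_bd1 h1; have c2 := zeta_bd2 h2.
rewrite quasi_period1 // in c1; rewrite quasi_period2 // in c2.
have cv : ccvg (fun N => tau * bd1 N z1 - bd2 N z2) (tau * quasi_period tau 1 - quasi_period tau 2).
  apply: ccvg_ext (ccvgB (ccvgZ tau c1) c2) => N.
  by move: (bd1 _ _) (bd2 _ _) (box _ _ _) => a b c; ring.
(* There are 2 N + 1 = 2 M terms, each with two sides contributing at least M Im tau / (M (1 +
   |tau|))^2; the factor M cancels in the total. *)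
set b := 4 * complex.Im tau / (1 + cmod tau) ^+ 2.
have t0 := cmod_ge0 tau.
have b0 : 0 < b by rewrite divr_gt0 ?mulr_gt0 ?exprn_gt0 //; lra.
suff lb N : b <= complex.Im (tau * bd1 N z1 - bd2 N z2).
  apply/eqP => E; have [N hN] := cv _ b0; have := hN N (leqnn _); rewrite E subr0.
  by move=> /(le_lt_trans (Im_le_cmod _)); have := lb N; move: (complex.Im _) => x; have := ler_norm x; lra.
rewrite /bd1 /bd2 -symsumZ -symsumB.
set M : R := N%:R + 2^-1.
have N0 : 0 <= N%:R :> R by rewrite ler0n.
have M0 : 0 < M by rewrite /M; lra.
set t := cmod tau in t0 b b0 *.
have S0 : 0 < (M * (1 + t)) ^+ 2 by rewrite exprn_gt0 // mulr_gt0 //; lra.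
have -> : b = (N.*2.+1)%:R * (2 * (M * complex.Im tau / (M * (1 + t)) ^+ 2)).
  have -> : (N.*2.+1)%:R = 2 * M :> R by rewrite -natr1 -mul2n natrM /M; field.
  by rewrite /b; field; rewrite !lt0r_neq0 //; lra.
apply: Im_symsum_lb => k kN.
have cM : cr M = N%:R + 2^-1 by rewrite /M (crD N%:R) crV !cr_nat.
have cN1 : cr (N.+1%:Z)%:~R = N%:R + 1 :> C by rewrite cr_int -pmulrn natr1.
have cN : cr (- N%:Z)%:~R = - N%:R :> C by rewrite cr_int rmorphN.
have -> : z1 + lpt N.+1 k = cr M + cr k%:~R * tau by rewrite lptE cM cN1 /z1; field.
have -> : z1 + lpt (- N%:Z) k = cr (- M) + cr k%:~R * tau.
  by rewrite lptE cN (crN M) cM /z1; field.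
have -> : z2 + lpt k N.+1 = cr k%:~R + cr M * tau by rewrite lptE cM cN1 /z2; field.
have -> : z2 + lpt k (- N%:Z) = cr k%:~R + cr (- M) * tau.
  by rewrite lptE cN (crN M) cM /z2; field.
rewrite mulrBr !(ImD, ImN) !Im_tau_inv !Im_one_inv opprK.
have kM : `|k%:~R| <= M :> R.
  have : `|k%:~R| <= N%:R :> R by rewrite -intr_norm -natr_absz ler_nat.
  by rewrite /M; lra.
have I0 : 0 <= M * complex.Im tau by rewrite mulr_ge0 ?ltW.
have big (x : R) : `|x| = M -> M * complex.Im tau / (M * (1 + t)) ^+ 2 <=
    M * complex.Im tau / cmod (cr x + cr k%:~R * tau) ^+ 2.
  move=> xM; apply: ler_wpM2l => //.
  have p : 0 < cmod (cr x + cr k%:~R * tau).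
    have := coord_x Htau x k%:~R; rewrite xM => /(lt_le_trans M0).
    by rewrite pmulr_rgt0 // (lt_le_trans ltr01) // Kt_ge1.
  rewrite lef_pV2 ?posrE // ?exprn_gt0 // lerXn2r ?nnegrE ?(ltW p) //.
    by rewrite mulr_ge0 ?(ltW M0) //; lra.
  apply: le_trans (cmodD _ _) _; rewrite cmodM !cmod_cr xM mulrDr mulr1 lerD2l.
  by rewrite ler_wpM2r.
have g1 := big M (gtr0_norm M0).
have g2 := big (- M); rewrite normrN in g2; have {}g2 := g2 (gtr0_norm M0).
have pos (x : C) : 0 <= M * complex.Im tau / cmod x ^+ 2.
  by rewrite divr_ge0 // exprn_ge0 // cmod_ge0.
have g3 := pos (cr k%:~R + cr M * tau); have g4 := pos (cr k%:~R + cr (- M) * tau).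
move: g1 g2 g3 g4; move: (_ ^+ 2)^-1 (_ ^+ 2)^-1 (_ ^+ 2)^-1 (_ ^+ 2)^-1 (_ ^+ 2)^-1 => a1 a2 a3 a4 a5.
by rewrite !mulNr; move: (M * _) => MI; lra.
Qed.

(* Periodicity is inherited by derivatives. *)
Lemma eis_periodic k z w : (1 < k)%N -> ~ lattice tau z -> lattice tau w -> eis k (z + w) = eis k z.
Proof.
have per (j : nat) (u : C) : (0 < j)%N -> lattice tau u ->
    (exists c, forall x, ~ lattice tau x -> eis j (x + u) - eis j x = c) ->
    forall x, ~ lattice tau x -> eis j.+1 (x + u) = eis j.+1 x.
  move=> j0 hu [c hc] x hx.
  have hxu : ~ lattice tau (x + u) by rewrite latticeDl.
  have d1 := cderivB (cderiv_shift (eis_deriv Htau j0 hxu)) (eis_deriv Htau j0 hx).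
  have d2 : cderiv (fun x => eis j (x + u) - eis j x) x 0.
    have := cderivC c x; apply: cderiv_ext.
    by have := notin_near Htau hx; apply: filterS => y hy; rewrite hc.
  have := cderiv_unique d1 d2; rewrite -mulrBr => /eqP.
  rewrite mulf_eq0 oppr_eq0 pnatr_eq0 subr_eq0 => /orP[|/eqP //].
  by case: (j) j0.
have base (u : C) : lattice tau u -> (exists c, forall x, ~ lattice tau x -> eis 1 (x + u) - eis 1 x = c) ->
    forall j x, (1 < j)%N -> ~ lattice tau x -> eis j (x + u) = eis j x.
  move=> hu h; elim=> [//|[//|[|j] IH]] x _ hx; first exact: per.
  by apply: per => //; exists 0 => y hy; rewrite IH ?subrr.
have p1 : forall j x, (1 < j)%N -> ~ lattice tau x -> eis j (x + 1) = eis j x.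
  apply: base; first exact: lattice1.
  by exists (quasi_period tau 1) => x hx; rewrite -!zetaE; apply: quasi_period1.
have p2 : forall j x, (1 < j)%N -> ~ lattice tau x -> eis j (x + tau) = eis j x.
  apply: base; first exact: lattice_tau.
  by exists (quasi_period tau 2) => x hx; rewrite -!zetaE; apply: quasi_period2.
move=> k1 hz [m [n ->]].
have int_per (u : C) : lattice tau u -> (forall x, ~ lattice tau x -> eis k (x + u) = eis k x) ->
    forall (i : int) x, ~ lattice tau x -> eis k (x + i%:~R * u) = eis k x.
  move=> hu h i; elim/int_ind: i => [|i IH|i IH] x hx.
  - by rewrite mul0r addr0.
  - have -> : x + (i.+1%:Z)%:~R * u = (x + u) + (i%:Z)%:~R * u.
      by rewrite -addn1 PoszD rmorphD /=; ring.
    by rewrite IH ?h // latticeDl.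
  have -> : x + (- i.+1%:Z)%:~R * u = (x - u) + (- i%:Z)%:~R * u.
    by rewrite -addn1 PoszD opprD rmorphD /=; ring.
  have hxu : ~ lattice tau (x - u) by rewrite latticeDl //; apply: latticeN.
  by rewrite (IH _ hxu); have := h _ hxu; rewrite subrK => ->.
have hzm : ~ lattice tau (z + m%:~R).
  by rewrite latticeDl //; exists m, 0; rewrite mul0r addr0.
have e2 := int_per tau (lattice_tau tau) (fun x => p2 k x k1) n _ hzm.
have := int_per 1 (lattice1 tau) (fun x => p1 k x k1) m z hz; rewrite mulr1 => e1.
by rewrite addrA; refine (etrans e2 e1).
Qed.

Lemma zeta_quasi z m n : ~ lattice tau z ->
  zeta tau (z + (m%:~R + n%:~R * tau)) = zeta tau z + (m%:~R * quasi_period tau 1 + n%:~R * quasi_period tau 2).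
Proof.
have int_per (u c : C) : lattice tau u -> (forall x, ~ lattice tau x -> zeta tau (x + u) = zeta tau x + c) ->
    forall (i : int) x, ~ lattice tau x -> zeta tau (x + i%:~R * u) = zeta tau x + i%:~R * c.
  move=> hu h i; elim/int_ind: i => [|i IH|i IH] x hx.
  - by rewrite !mul0r !addr0.
  - have -> : x + (i.+1%:Z)%:~R * u = (x + u) + (i%:Z)%:~R * u.
      by rewrite -addn1 PoszD rmorphD /=; ring.
    rewrite IH ?h ?latticeDl // -addn1 PoszD rmorphD /=.
    by move: (zeta _ _) => a; ring.
  have -> : x + (- i.+1%:Z)%:~R * u = (x - u) + (- i%:Z)%:~R * u.
    by rewrite -addn1 PoszD opprD rmorphD /=; ring.
  have hxu : ~ lattice tau (x - u) by rewrite latticeDl //; apply: latticeN.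
  rewrite (IH _ hxu) -addn1 PoszD opprD rmorphD /=; have := h _ hxu; rewrite subrK => ->.
  by move: (zeta _ _) => a; ring.
have q1 x : ~ lattice tau x -> zeta tau (x + 1) = zeta tau x + quasi_period tau 1.
  by move=> /quasi_period1 <-; move: (zeta _ _) (zeta _ _) => a b; ring.
have q2 x : ~ lattice tau x -> zeta tau (x + tau) = zeta tau x + quasi_period tau 2.
  by move=> /quasi_period2 <-; move: (zeta _ _) (zeta _ _) => a b; ring.
move=> hz; have hz1 : ~ lattice tau (z + m%:~R).
  by rewrite latticeDl //; exists m, 0; rewrite mul0r addr0.
have e2 := int_per _ _ (lattice_tau tau) q2 n _ hz1.
have := int_per _ _ (lattice1 tau) q1 m z hz; rewrite mulr1 => e1.
by rewrite addrA; refine (etrans e2 _); rewrite e1 addrA.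
Qed.

End Periods.

(** * Elliptic function identities *)

Section EllipticZero.
Context {R : realType}.
Notation C := (cplx R).
Implicit Types (f g F : C -> C) (z w a b l : C) (e r : R).

Definition clim f l := f @ (0 : C)^' --> l.

Lemma climP f l : clim f l <-> forall e : R, 0 < e -> exists2 r, 0 < r &
  forall h, cmod h < r -> h != 0 -> cmod (f h - l) < e.
Proof.
split=> [H e e0|H].
  move/cvgrPdist_lt: H => /(_ (cr e)); rewrite -cr0 ltr_cr => /(_ e0) /(nearP 0) [r r0 h].
  exists r => // k kr k0; have := h k; rewrite subr0 => /(_ kr k0).
  by rewrite cmodE ltr_cr cmodBC.
apply/cvgrPdist_lt => e /pos_cr [-> e0]; have [r r0 h] := H _ e0.
apply/(nearP 0); exists r => // k; rewrite subr0 => kr k0.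
by rewrite cmodE ltr_cr cmodBC; apply: h.
Qed.

Lemma climD f g a b : clim f a -> clim g b -> clim (fun h => f h + g h) (a + b).
Proof. by move=> ha hb; refine (@cvgD C C C (0^') _ f g a b ha hb). Qed.
Lemma climN f a : clim f a -> clim (fun h => - f h) (- a).
Proof. by move=> ha; refine (@cvgN C C C (0^') _ f a ha). Qed.
Lemma climB f g a b : clim f a -> clim g b -> clim (fun h => f h - g h) (a - b).
Proof. by move=> ha hb; refine (climD ha (climN hb)). Qed.
Lemma climM f g a b : clim f a -> clim g b -> clim (fun h => f h * g h) (a * b).
Proof. by move=> ha hb; refine (@cvgM C C (0^') _ f g a b ha hb). Qed.
Lemma climC a : clim (fun=> a) a.
Proof. exact: cvg_cst. Qed.

Lemma clim_ext f g l : (\forall h \near (0 : C), h != 0 -> f h = g h) -> clim f l -> clim g l.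
Proof.
move=> /nearP[d d0 hd] /climP H; apply/climP => e /H [r r0 hr].
exists (Num.min r d); first by rewrite lt_min r0.
move=> h; rewrite lt_min => /andP[h1 h2] h0; rewrite -hd ?subr0 //; exact: hr.
Qed.

Lemma clim_unique f a b : clim f a -> clim f b -> a = b.
Proof. by move=> ha hb; refine (@cvg_unique C _ (f @ 0^') _ a b ha hb); apply: norm_hausdorff. Qed.

Lemma clim_cont f z : ccont f z -> clim (fun h => f (z + h)) (f z).
Proof. by move=> H; apply/climP => e /H [r r0 h]; exists r => // k /h. Qed.

Lemma clim_id : clim id 0.
Proof. by apply/climP => e e0; exists e => // h; rewrite subr0. Qed.

Lemma clim_deriv f z a : cderiv f z a -> clim (fun h => (f (z + h) - f z) / h) a.
Proof.
move=> H; apply/climP => e e0; have e2 : 0 < e / 2 by lra.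
have [r r0 hr] := H _ e2; exists r => // h /hr hh h0.
have hp : 0 < cmod h by rewrite cmod_gt0.
have -> : (f (z + h) - f z) / h - a = (f (z + h) - f z - a * h) / h by field.
rewrite cmodM cmodV ltr_pdivrMr //; apply: le_lt_trans hh _.
by rewrite ltr_pM2r //; lra.
Qed.

Lemma clim_taylor f z a b : taylor2 f z a b -> clim (fun h => (f (z + h) - f z - a * h) / h ^+ 2) b.
Proof.
move=> H; apply/climP => e e0; have e2 : 0 < e / 2 by lra.
have [r r0 hr] := H _ e2; exists r => // h /hr hh h0.
have hp : 0 < cmod h ^+ 2 by rewrite exprn_gt0 // cmod_gt0.
have -> : (f (z + h) - f z - a * h) / h ^+ 2 - b = (f (z + h) - f z - a * h - b * h ^+ 2) / h ^+ 2.
  by field.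
rewrite cmodM cmodV cmodX ltr_pdivrMr //; apply: le_lt_trans hh _.
by rewrite ltr_pM2r //; lra.
Qed.

Lemma clim_neq f l a : clim f l -> l != a -> \forall h \near (0 : C), h != 0 -> f h != a.
Proof.
move=> /climP H la; have e0 : 0 < cmod (l - a) by rewrite cmod_gt0 subr_eq0.
have [r r0 h] := H _ e0; apply/nearP; exists r => // k; rewrite subr0 => kr k0.
by have := h k kr k0; apply: contraTneq => ->; rewrite cmodBC ltxx.
Qed.

Variable tau : C.
Hypothesis Htau : 0 < complex.Im tau.

(** Extended by 0 over S, the function F is continuous and periodic, hence bounded via a period
    parallelogram; Liouville's theorem applies because differentiability is wanted only where F is
    nonzero. The limit is required at a single lattice translate of each singular point. *)
Lemma elliptic_zero (S : C -> Prop) F s0 :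
  (forall z w, lattice tau w -> S z -> S (z + w)) ->
  (forall z w, lattice tau w -> ~ S z -> F (z + w) = F z) ->
  (forall z, ~ S z -> \forall x \near z, ~ S x) ->
  (forall z, ~ S z -> twice F z) ->
  S s0 ->
  (forall s, S s -> exists w, [/\ lattice tau w, S (s + w) & clim (fun h => F (s + w + h)) 0]) ->
  forall z, ~ S z -> F z = 0.
Proof.
move=> Sw Fw So Ft Ss0 Fs.
have Sw' z w : lattice tau w -> S (z + w) -> S z.
  by move=> hw /(Sw _ _ (latticeN hw)); rewrite addrK.
pose G z : C := if pselect (S z) then 0 else F z.
have GS z : S z -> G z = 0 by rewrite /G; case: pselect.
have GF z : ~ S z -> G z = F z by rewrite /G; case: pselect.
have Gw z w : lattice tau w -> G (z + w) = G z.
  move=> hw; have [Sz|Sz] := pselect (S z); first by rewrite !GS //; apply: Sw.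
  by rewrite !GF ?Fw // => /(Sw' _ _ hw).
have Gc z : ccont G z.
  have [Sz|Sz] := pselect (S z); last first.
    have cF := twice_cont (Ft _ Sz); have /near0P[d d0 hd] := So _ Sz.
    move=> e e0; have [r r0 hr] := cF e e0; exists (Num.min r d); first by rewrite lt_min r0.
    by move=> h; rewrite lt_min => /andP[h1 h2]; rewrite !GF //; [apply: hr|apply: hd].
  have [w [hw Szw /climP H]] := Fs _ Sz.
  move=> e e0; have [r r0 hr] := H e e0; exists r => // h hh.
  rewrite (GS z) // subr0 -(Gw _ w) //.
  have -> : z + h + w = z + w + h by ring.
  have [->|h0] := eqVneq h 0; first by rewrite addr0 GS ?cmod0.
  have [Sh|Sh] := pselect (S (z + w + h)); first by rewrite GS // cmod0.
  by rewrite GF //; have := hr h hh h0; rewrite subr0.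
have [K hK] := @parallelogram_max _ 0 1 tau (cmod \o G) (fun p _ _ => ltac:(
  move=> e e0; have [r r0 h] := Gc (affine_pt 0 1 tau p) e e0; exists r => // k /h;
  apply: le_lt_trans; apply: cmod_dist)).
have Gb z : cmod (G z) <= K.
  have [x [y ->]] := coords Htau z.
  have hl : lattice tau (cr (Num.floor x)%:~R + cr (Num.floor y)%:~R * tau).
    by exists (Num.floor x), (Num.floor y); rewrite !cr_int.
  have fl (t : R) : 0 <= t - (Num.floor t)%:~R <= 1.
    have := floor_itv t; rewrite intrD1 => /andP[]; lra.
  have := hK (x - (Num.floor x)%:~R, y - (Num.floor y)%:~R) (fl x) (fl y).
  rewrite /= /affine_pt /= add0r mulr1 -(Gw _ _ hl).
  have -> // : cr (x - (Num.floor x)%:~R) + cr (y - (Num.floor y)%:~R) * tau +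
    (cr (Num.floor x)%:~R + cr (Num.floor y)%:~R * tau) = cr x + cr y * tau.
  by rewrite !crB; ring.
move=> z Sz; rewrite -GF //; apply: (liouville Gc Gb _ (GS _ Ss0)) => x Gx.
have Sx : ~ S x by move=> /GS E; rewrite E eqxx in Gx.
by apply: (@twice_ext _ F) (Ft _ Sx); have := So _ Sx; apply: filterS => y /GF ->.
Qed.

(* From z = x + y tau go to (1 + tau) / 2 along one direction of the lattice, then along the other. *)
Lemma const_off_lattice f : (forall z, ~ lattice tau z -> cderiv f z 0) ->
  forall z z', ~ lattice tau z -> ~ lattice tau z' -> f z = f z'.
Proof.
move=> H; pose mid := cr (2^-1) + cr (2^-1) * tau.
suff key z : ~ lattice tau z -> f z = f mid by move=> z z' /key -> /key ->.
have hor (x x' y : R) : (forall n : int, y != n%:~R) ->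
    f (cr x + cr y * tau) = f (cr x' + cr y * tau).
  move=> hy; have -> : cr x' + cr y * tau = cr x + cr y * tau + cr (x' - x) by rewrite crB; ring.
  apply/esym; apply: cderiv0_const => t _; apply: H.
  have -> : cr x + cr y * tau + cr t * cr (x' - x) = cr (x + t * (x' - x)) + cr y * tau.
    by rewrite (crD x) (crM t); ring.
  by apply: half_notin => //; right.
have ver (x y y' : R) : (forall n : int, x != n%:~R) ->
    f (cr x + cr y * tau) = f (cr x + cr y' * tau).
  move=> hy; have -> : cr x + cr y' * tau = cr x + cr y * tau + cr (y' - y) * tau by rewrite crB; ring.
  apply/esym; apply: cderiv0_const => t _; apply: H.
  have -> : cr x + cr y * tau + cr t * (cr (y' - y) * tau) = cr x + cr (y + t * (y' - y)) * tau.
    by rewrite (crD y) (crM t); ring.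
  by apply: half_notin => //; left.
have [x [y ->]] := coords Htau z => hz.
have [[n ny]|hy] := pselect (exists n : int, y = n%:~R).
  have hx : forall m : int, x != m%:~R.
    move=> m; apply/eqP => E; apply: hz; exists m, n.
    by rewrite E ny !cr_int.
  by rewrite (ver x y 2^-1 hx); apply: hor => k; apply: half_nint.
rewrite (hor x 2^-1 y); first by apply: ver => k; apply: half_nint.
by move=> n; apply/eqP => E; apply: hy; exists n.
Qed.

(* Nearest lattice point: only finitely many candidates beat the origin. *)
Lemma nearest a : exists2 w0, lattice tau w0 & forall w, lattice tau w -> cmod (a - w0) <= cmod (a - w).
Proof.
have K1 := Kt_ge1 Htau.
pose N := (Num.truncn (Kt tau * (2 * cmod a + 1))).+1.
pose pt (i : 'I_(N.*2.+1) * 'I_(N.*2.+1)) := lpt tau (i.1%:Z - N%:Z) (i.2%:Z - N%:Z).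
have NN : (N < N.*2.+1)%N by lia.
pose i0 := (Ordinal NN, Ordinal NN).
have p0 : pt i0 = 0 by rewrite /pt /lpt /= subrr mul0r addr0.
have [i _ hi] := @Order.TotalTheory.arg_minP _ R _ i0 xpredT (fun i => cmod (a - pt i)) isT.
exists (pt i); first exact: lattice_lpt.
move=> w [m [n wE]]; have [small|big] := leqP (maxn `|m| `|n|) N.
  have hm : (absz (m + N%:Z)%R < N.*2.+1)%N by lia.
  have hn : (absz (n + N%:Z)%R < N.*2.+1)%N by lia.
  have -> : w = pt (Ordinal hm, Ordinal hn).
    rewrite wE /pt /lpt /=; congr (_%:~R + _%:~R * _); lia.
  exact: hi.
apply: le_trans (hi i0 isT) _; rewrite p0 subr0.
have h := lpt_lb Htau (ltnW big); rewrite /lpt -wE in h.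
have hN : Kt tau * (2 * cmod a + 1) < N%:R by apply: truncnS_gt.
have h2 : 2 * cmod a + 1 <= cmod w.
  rewrite -(ler_pM2l (_ : 0 < Kt tau)) ?(lt_le_trans ltr01) //.
  exact: le_trans (ltW hN) h.
have := cmodB a (a - w); have -> : a - (a - w) = w by ring.
by move: h2; move: (cmod _) (cmod w) (cmod a) => *; lra.
Qed.

End EllipticZero.

Arguments climC {R} a.
Arguments clim_id {R}.

(** * Derivatives, parity and Laurent expansions of zeta and wp *)

Section WeierstrassFacts.
Context {R : realType}.
Notation C := (cplx R).
Variable tau : C.
Implicit Types (z w c h : C).

Definition dwp z : C := - 2 * eis tau 3 z.
Definition ddwp z : C := 6 * eis tau 4 z.

Hypothesis Htau : 0 < complex.Im tau.
Notation u := (wp tau).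
Notation lat := (lattice tau).

Lemma zeta_deriv z : ~ lat z -> cderiv (zeta tau) z (- u z).
Proof.
move=> hz; have := eis_deriv Htau (ltn0Sn 0) hz; rewrite mulN1r => h.
by apply: cderiv_ext h; near=> x; rewrite zetaE.
Unshelve. all: by end_near. Qed.

Lemma wp_deriv z : ~ lat z -> cderiv u z (dwp z).
Proof. exact: (eis_deriv Htau (ltn0Sn 1)). Qed.

Lemma dwp_deriv z : ~ lat z -> cderiv dwp z (ddwp z).
Proof.
move=> hz; apply: cderiv_eq (cderivZ (-2) (eis_deriv Htau (ltn0Sn 2) hz)) _.
by rewrite /ddwp; move: (eis _ _ _) => x; ring.
Qed.

Lemma eis_twice k z : (0 < k)%N -> ~ lat z -> twice (eis tau k) z.
Proof.
move=> k0 hz; exists (fun x => - k%:R * eis tau k.+1 x), (- k%:R * (- k.+1%:R * eis tau k.+2 z)); split.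
  by have := notin_near Htau hz; apply: filterS => x; apply: eis_deriv.
by apply: cderivZ; apply: eis_deriv.
Qed.

Lemma zeta_twice z : ~ lat z -> twice (zeta tau) z.
Proof.
move=> hz; apply: twice_ext (eis_twice (ltn0Sn 0) hz).
by near=> x; rewrite zetaE.
Unshelve. all: by end_near. Qed.

Lemma wp_twice z : ~ lat z -> twice u z. Proof. exact: eis_twice. Qed.

Lemma ddwp_twice z : ~ lat z -> twice ddwp z.
Proof. by move=> hz; apply: twiceM; [apply: twiceC|apply: eis_twice]. Qed.

Lemma zetaN z : ~ lat z -> zeta tau (- z) = - zeta tau z.
Proof. by move=> hz; rewrite !zetaE eisN // expr1 mulN1r. Qed.
Lemma wpN z : ~ lat z -> u (- z) = u z.
Proof. by move=> hz; rewrite !wpE eisN // sqrrN expr1n mul1r. Qed.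
Lemma dwpN z : ~ lat z -> dwp (- z) = - dwp z.
Proof. by move=> hz; rewrite /dwp eisN //; move: (eis _ _ _) => x; ring. Qed.

Lemma wp_per z w : ~ lat z -> lat w -> u (z + w) = u z.
Proof. by move=> hz hw; rewrite !wpE (eis_periodic Htau _ hz hw). Qed.
Lemma dwp_per z w : ~ lat z -> lat w -> dwp (z + w) = dwp z.
Proof. by move=> hz hw; rewrite /dwp (eis_periodic Htau _ hz hw). Qed.
Lemma ddwp_per z w : ~ lat z -> lat w -> ddwp (z + w) = ddwp z.
Proof. by move=> hz hw; rewrite /ddwp (eis_periodic Htau _ hz hw). Qed.

Lemma zeta_laurent h : zeta tau h = h^-1 + ell tau 1 h.
Proof. by []. Qed.
Lemma wp_laurent h : u h = h ^- 2 + ell tau 2 h.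
Proof. by []. Qed.
Lemma ddwp_laurent h : ddwp h = 6 * h ^- 4 + 6 * ell tau 4 h.
Proof. exact: mulrDr. Qed.

Lemma clim_ell k : (0 < k)%N -> clim (ell tau k) (ell tau k 0).
Proof.
move=> k0; have := clim_cont (cderiv_cont (ell_deriv Htau k0 (@punctured0 _ tau))).
by apply: clim_ext; near=> h; rewrite add0r.
Unshelve. all: by end_near. Qed.

Lemma clim_ell2 : clim (fun h => ell tau 2 h / h ^+ 2) (3 * ell tau 4 0).
Proof.
have h1 : \forall x \near (0 : C), cderiv (ell tau 2) x (- 2 * ell tau 3 x).
  by have := punctured_near Htau (@punctured0 _ tau); apply: filterS => x; apply: ell_deriv.
have h2 := cderivZ (-2) (ell_deriv Htau (ltn0Sn 2) (@punctured0 _ tau)).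
have := clim_taylor (taylor2P h1 h2).
have -> : -2 * (-3%:R * ell tau 4 0) / 2 = 3 * ell tau 4 0 by field.
apply: clim_ext; near=> h => _.
by rewrite add0r (ell2_0 Htau) (@ell_odd0 _ _ Htau 3) // mulr0 mul0r !subr0.
Unshelve. all: by end_near. Qed.

Lemma clim_ell_0 k : (0 < k)%N -> (k < 4)%N -> clim (ell tau k) 0.
Proof.
case: k => [//|[|[|[|//]]]] _ _.
- by rewrite -(ell1_0 Htau); apply: clim_ell.
- by rewrite -(ell2_0 Htau); apply: clim_ell.
by rewrite -(@ell_odd0 _ _ Htau 3) //; apply: clim_ell.
Qed.

Lemma clim_h_zeta : clim (fun h => h * zeta tau h) 1.
Proof.
have := climD (climC 1) (climM clim_id (clim_ell_0 (ltn0Sn 0) isT)).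
rewrite mul0r addr0; apply: clim_ext; near=> h => h0.
by rewrite zeta_laurent mulrDr divff.
Unshelve. all: by end_near. Qed.

Lemma clim_h2_wp : clim (fun h => h ^+ 2 * u h) 1.
Proof.
have := climD (climC 1) (climM (climM clim_id clim_id) (clim_ell_0 (ltn0Sn 1) isT)).
rewrite mulr0 addr0; apply: clim_ext; near=> h => h0.
by rewrite wp_laurent mulrDr expr2 divff ?mulf_neq0.
Unshelve. all: by end_near. Qed.

(** With G = [ell tau 4 0], the expansions wp = h^-2 + 3 G h^2 + ... and wp'' = 6 h^-4 + 6 G + ...
    make all poles of wp'' - 6 wp^2 cancel, and the constant term is 6 G - 36 G = - 30 G. *)
Lemma wp_ode_raw z : ~ lat z -> ddwp z = 6 * u z ^+ 2 - 30 * ell tau 4 0.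
Proof.
move=> hz; apply/eqP; rewrite -subr_eq0; apply/eqP.
pose F z := ddwp z - 6 * u z ^+ 2 + 30 * ell tau 4 0.
suff H : F z = 0 by rewrite opprB addrA addrAC; exact: H.
apply: (@elliptic_zero _ tau Htau lat F 0) => //.
- by move=> x w hw; rewrite latticeDl.
- by move=> x w hw hx; rewrite /F ddwp_per // wp_per.
- exact: notin_near.
- move=> x hx; apply: twiceD; last exact: twiceC.
  apply: twiceB; first exact: ddwp_twice.
  by apply: twiceM; [apply: twiceC|apply: twiceX; apply: wp_twice].
- exact: lattice0.
move=> s hs; exists (- s); split; first exact: latticeN.
  by rewrite subrr; apply: lattice0.
rewrite subrr.
have l4 := clim_ell (ltn0Sn 3); have l2 := clim_ell2; have l20 := clim_ell_0 (ltn0Sn 1) isT.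
have := climD (climB (climB (climM (climC 6) l4) (climM (climC 12) l2))
  (climM (climC 6) (climM l20 l20))) (climC (30 * ell tau 4 0)).
have -> : 6 * ell tau 4 0 - 12 * (3 * ell tau 4 0) - 6 * (0 * 0) + 30 * ell tau 4 0 = 0.
  by move: (ell _ _ _) => x; ring.
apply: clim_ext; near=> h => h0; rewrite add0r /F ddwp_laurent wp_laurent.
by move: (ell _ _ _) (ell _ _ _) (ell _ _ _) => a b c; field.
Unshelve. all: by end_near. Qed.

End WeierstrassFacts.

(** * Differential equations of wp *)

Section EllipticIdentities.
Context {R : realType}.
Notation C := (cplx R).
Variable tau : C.
Hypothesis Htau : 0 < complex.Im tau.
Implicit Types (z w c h p : C).
Notation u := (wp tau).
Notation u1 := (dwp tau).
Notation u2 := (ddwp tau).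
Notation zt := (zeta tau).
Notation lat := (lattice tau).
Notation g2 := (g2 tau).
Notation g3 := (g3 tau).
Local Opaque wp zeta dwp ddwp ell eis.

Lemma near_notin : \forall h \near (0 : C), h != 0 -> ~ lat h.
Proof.
have := punctured_near Htau (@punctured0 _ tau); apply: filterS => h ph h0 hl.
by have := ph h hl h0; rewrite eqxx.
Qed.

Lemma wp_large (K : R) : \forall h \near (0 : C), h != 0 -> K < cmod (u h).
Proof.
have /climP H := clim_h2_wp Htau.
have h2 : 0 < 2^-1 :> R by rewrite invr_gt0.
have [r r0 hr] := H _ h2.
have K0 : 0 < 1 + `|K| by have := normr_ge0 K; lra.
apply/nearP; exists (Num.min r (Num.min 1 (2^-1 / (1 + `|K|)))).
  by rewrite !lt_min r0 ltr01 divr_gt0.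
move=> h; rewrite subr0 !lt_min ltr_pdivlMr // => /and3P[h1 hl1 hK] h0.
have k3 := hr h h1 h0; have k2 := cmod_lb 1 (h ^+ 2 * u h - 1).
have E : 1 + (h ^+ 2 * u h - 1) = h ^+ 2 * u h by rewrite addrC subrK.
rewrite E cmod1 cmodM cmodX in k2.
have p : 0 < cmod h by rewrite cmod_gt0.
have sq : cmod h ^+ 2 <= cmod h by rewrite expr2 ler_piMr ?ltW.
rewrite ltNge; apply/negP => k4.
have : cmod h ^+ 2 * cmod (u h) <= cmod h * `|K|.
  by rewrite ler_pM ?exprn_ge0 ?cmod_ge0 // (le_trans k4) // ler_norm.
have : cmod h * `|K| <= cmod h * (1 + `|K|) by rewrite ler_wpM2l ?(ltW p) // lerDr.
by move: k2 k3 hK; move: (cmod (_ - _)) (cmod h * `|K|) (_ * cmod (u h)) (cmod h * _) => *; lra.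
Qed.

(** For c = 60 [ell tau 4 0], the classical g2, [wp_ode_raw] gives 4 wp^3 - c wp - wp'^2 a zero
    derivative, so it is constant off the lattice. *)
Lemma wp_cubic_ex : exists g : C * C, forall z, ~ lat z -> u1 z ^+ 2 = 4 * u z ^+ 3 - g.1 * u z - g.2.
Proof.
pose c := 60 * ell tau 4 0.
pose f z := 4 * u z ^+ 3 - c * u z - u1 z ^+ 2.
have df z : ~ lat z -> cderiv f z 0.
  move=> hz; have d := wp_deriv Htau hz; have d1 := dwp_deriv Htau hz.
  have := cderivB (cderivB (cderivZ 4 (cderivM d (cderivM d d))) (cderivZ c d)) (cderivM d1 d1).
  move=> /cderiv_eq H; apply: cderiv_ext (H 0 _).
    by near=> x; rewrite /f !exprS expr0 !mulr1.
  rewrite (wp_ode_raw Htau hz) /c.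
  by move: (u z) (u1 z) (ell _ _ _) => a b l; ring.
have h0 := half_notin1 Htau.
exists (c, f 2^-1) => z hz /=; rewrite (const_off_lattice Htau df h0 hz) /f.
by move: (u z) (u1 z) => a b; ring.
Unshelve. all: by end_near. Qed.

Lemma wp_cubic z : ~ lat z -> u1 z ^+ 2 = 4 * u z ^+ 3 - g2 * u z - g3.
Proof.
have ex : exists g : C * C, forall z, ~ lat z -> derive1 u z ^+ 2 = 4 * u z ^+ 3 - g.1 * u z - g.2.
  have [g hg] := wp_cubic_ex; exists g => x hx; rewrite -hg //; congr (_ ^+ 2).
  by have /is_deriveP [_] := wp_deriv Htau hx; rewrite derive1E.
move=> hz; have := @getPex _ [set g : C * C | forall z, ~ lat z -> derive1 u z ^+ 2 = 4 * u z ^+ 3 - g.1 * u z - g.2] ex z hz.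
have -> : derive1 u z = u1 z by have /is_deriveP [_] := wp_deriv Htau hz; rewrite derive1E.
by [].
Qed.

Lemma near_witness (P : C -> Prop) : (\forall h \near (0 : C), h != 0 -> P h) -> exists2 h, h != 0 & P h.
Proof.
move/nearP => [d d0 H]; exists (cr (d / 2)); first by rewrite cr_eq0 lt0r_neq0 // divr_gt0.
apply: H; last by rewrite cr_eq0 lt0r_neq0 // divr_gt0.
by rewrite subr0 cmod_cr gtr0_norm ?divr_gt0 //; lra.
Qed.

(** [g2] is known only as a choice satisfying the cubic relation, and comparison with [wp_ode_raw]
    determines it wherever wp' <> 0. Such a point exists, as otherwise wp would be constant in spite
    of its pole. *)
Lemma wp_ode z : ~ lat z -> u2 z = 6 * u z ^+ 2 - g2 / 2.
Proof.
move=> hz; rewrite (wp_ode_raw Htau hz); congr (_ - _).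
(* differentiate the cubic relation at a point where u' <> 0 *)
have key x : ~ lat x -> u1 x != 0 -> 30 * ell tau 4 0 = g2 / 2.
  move=> hx hx1; have d := wp_deriv Htau hx; have d1 := dwp_deriv Htau hx.
  have e1 := cderivB (cderivB (cderivZ 4 (cderivM d (cderivM d d))) (cderivZ g2 d)) (cderivM d1 d1).
  have e2 : cderiv (fun x => 4 * (u x * (u x * u x)) - g2 * u x - u1 x * u1 x) x 0.
    apply: cderiv_ext (cderivC g3 x).
    have := notin_near Htau hx; apply: filterS => y hy.
    have := wp_cubic hy; move: (u y) (u1 y) => a b E; ring: E.
  have := cderiv_unique e1 e2; rewrite (wp_ode_raw Htau hx).
  move: (u1 x) (u x) hx1 (ell _ _ _) => b a b0 l E.
  have : b * (60 * l - g2) = 0 by rewrite -[RHS]E; ring.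
  move/eqP; rewrite mulf_eq0 (negPf b0) /= subr_eq0 => /eqP <-.
  by field.
apply: contrapT => N.
have H (y : C) : ~ lat y -> u1 y = 0.
  by move=> hy; apply/eqP; apply/negPn/negP => hy1; apply: N; apply: (key y).
have cst := @const_off_lattice _ tau Htau u.
have dz (y : C) : ~ lat y -> cderiv u y 0 by move=> hy; rewrite -(H y hy); apply: wp_deriv.
have nb : \forall h \near (0 : C), h != 0 -> ~ lat h /\ cmod (u z) < cmod (u h).
  by apply: filterS2 near_notin (wp_large (cmod (u z))) => h a b h0; split; [apply: a|apply: b].
have [h h0 [hl hK]] := near_witness nb.
by move: hK; rewrite (cst dz _ _ hl hz) ltxx.
Qed.

(** Constancy spreads over the largest disc around z free of lattice points. The nearest lattice
    point w0 lies on its boundary, and wp is unbounded inside the disc near w0. *)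
Lemma wp_not_locally_const z c : ~ lat z -> (\forall x \near z, u x = c) -> False.
Proof.
move=> hz hc; have [w0 hw0 hmin] := nearest Htau z.
set r := cmod (z - w0).
have r0 : 0 < r.
  by rewrite cmod_gt0 subr_eq0; apply/eqP => E; apply: hz; rewrite E.
have tw w : cmod w < r -> twice (fun x => u x - c) (z + w).
  move=> wr; apply: twiceB; last exact: twiceC.
  apply: wp_twice => // hl; have := hmin _ hl.
  have -> : z - (z + w) = - w by ring.
  by rewrite cmodN leNgt wr.
have hn : \forall w \near z, u w - c = 0 by apply: filterS hc => x ->; rewrite subrr.
have van := @vanish_disc _ _ z r tw hn.
have [d d0 hd] : exists2 d : R, 0 < d & forall h, cmod h < d -> h != 0 -> ~ lat h /\ cmod c < cmod (u h).
  have /nearP [d1 d10 h1] := near_notin; have /nearP [d2 d20 h2] := wp_large (cmod c).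
  exists (Num.min d1 d2) => [|h]; first by rewrite lt_min d10.
  by rewrite lt_min => /andP[a b] h0; split; [apply: h1|apply: h2]; rewrite ?subr0.
pose s := Num.min (2^-1) (d / (2 * r)).
have s0 : 0 < s by rewrite lt_min invr_gt0 ltr0n /= divr_gt0 // mulr_gt0.
have s1 : s <= 2^-1 by rewrite ge_min lexx.
have sd : s * r < d.
  have : s <= d / (2 * r) by rewrite ge_min lexx orbT.
  rewrite ler_pdivlMr ?mulr_gt0 //; have := mulr_gt0 s0 r0; lra.
pose h := cr s * (z - w0).
have ch : cmod h = s * r by rewrite cmodM cmod_cr gtr0_norm.
have h0 : h != 0 by rewrite -cmod_gt0 ch mulr_gt0.
have hd' : cmod h < d by rewrite ch.
have [hl hb] := hd _ hd' h0.
have wr : cmod (h - (z - w0)) < r.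
  have -> : h - (z - w0) = cr (s - 1) * (z - w0) by rewrite /h crB; ring.
  rewrite cmodM cmod_cr -/r ltr0_norm; last by lra.
  by rewrite -[ltRHS]mul1r ltr_pM2r //; lra.
have := van _ wr; have -> : z + (h - (z - w0)) = h + w0 by ring.
rewrite (wp_per Htau hl hw0) => /eqP; rewrite subr_eq0 => /eqP E.
by move: hb; rewrite E ltxx.
Qed.

End EllipticIdentities.

(** * Addition formula for zeta *)

Section Addition.
Context {R : realType}.
Notation C := (cplx R).
Variable tau : C.
Hypothesis Htau : 0 < complex.Im tau.
Implicit Types (z w c h p : C).
Notation u := (wp tau).
Notation u1 := (dwp tau).
Notation u2 := (ddwp tau).
Notation zt := (zeta tau).
Notation lat := (lattice tau).
Notation g2 := (g2 tau).
Notation g3 := (g3 tau).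
Local Opaque wp zeta dwp ddwp ell eis.

Lemma latN z : lat (- z) <-> lat z.
Proof. by split=> /latticeN; rewrite ?opprK. Qed.

Lemma lat_half p : ~ lat (2 * p) -> ~ lat p.
Proof. by move=> h hp; apply: h; have := latticeD hp hp; rewrite mulrDl mul1r. Qed.

Definition generic p z := [/\ ~ lat z, ~ lat (z - p) & ~ lat (z + p)].

Lemma generic_near p z : generic p z -> \forall x \near z, generic p x.
Proof.
case=> h1 h2 h3.
have n1 := notin_near Htau h1.
have n2 : \forall x \near z, ~ lat (x - p).
  have c : ccont (fun x : C => x - p) z by apply: ccontD; [exact: ccontI|exact: ccontC].
  exact: (near_ccont c (notin_near Htau h2)).
have n3 : \forall x \near z, ~ lat (x + p).
  have c : ccont (fun x : C => x + p) z by apply: ccontD; [exact: ccontI|exact: ccontC].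
  exact: (near_ccont c (notin_near Htau h3)).
by near=> x; split; near: x.
Unshelve. all: by end_near. Qed.

Lemma generic_per p z w : lat w -> generic p (z + w) <-> generic p z.
Proof.
move=> hw; rewrite /generic.
have -> : z + w - p = z - p + w by ring.
have -> : z + w + p = z + p + w by ring.
have e x := latticeDl x hw.
by split=> -[a b c]; split; move: a b c; rewrite !e.
Qed.

(** No pole survives on the left: at 0 the first factor vanishes to second order against the double
    pole of wp, at p the pole of zeta meets the zero of wp z - wp p, and -p follows by evenness.
    Both limits equal - wp' p. The assumption on 2 p keeps the three points distinct modulo the
    lattice. *)
Lemma zeta_diff p z : ~ lat (2 * p) -> generic p z ->
  (zt (z + p) - zt (z - p) - 2 * zt p) * (u z - u p) = - u1 p.
Proof.
move=> h2p; have hp := lat_half h2p.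
pose G z := zt (z + p) - zt (z - p) - 2 * zt p.
pose F z := G z * (u z - u p) + u1 p.
suff H : ~ ~ generic p z -> F z = 0.
  move=> hz; apply/eqP; rewrite -addr_eq0; apply/eqP; apply: H.
  by move=> n; apply: n.
have Fev x : ~ ~ generic p x -> F (- x) = F x.
  move=> /contrapT [a b c]; rewrite /F /G wpN //.
  have -> : - x + p = - (x - p) by ring.
  have -> : - x - p = - (x + p) by ring.
  by rewrite !(zetaN Htau) //; congr (_ * _ + _); move: (zt _) (zt _) (zt _) => i j k; ring.
have Gd x : ~ lat (x + p) -> ~ lat (x - p) -> cderiv G x (- u (x + p) + u (x - p)).
  move=> b c; apply: cderiv_eq (cderivB (cderivB (cderiv_shift (zeta_deriv Htau b)) (cderiv_shift (zeta_deriv Htau c))) (cderivC _ x)) _.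
  by rewrite subr0 opprK.
(* at the origin: G has a double zero, u a double pole *)
have at0 : clim F 0.
  have p1 : ~ lat (0 + p) by rewrite add0r.
  have p2 : ~ lat (0 - p) by rewrite add0r latN.
  have h1 : \forall x \near (0 : C), cderiv G x (- u (x + p) + u (x - p)).
    have c1 : ccont (fun x : C => x + p) 0 by apply: ccontD; [exact: ccontI|exact: ccontC].
    have c2 : ccont (fun x : C => x - p) 0 by apply: ccontD; [exact: ccontI|exact: ccontC].
    have n1 := near_ccont c1 (notin_near Htau p1).
    have n2 := near_ccont c2 (notin_near Htau p2).
    by near=> x; apply: Gd; near: x.
  have h2 := cderivD (cderivN (cderiv_shift (wp_deriv Htau p1))) (cderiv_shift (wp_deriv Htau p2)).
  have T := clim_taylor (taylor2P h1 h2).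
  have W := climB (clim_h2_wp Htau) (climM (climM clim_id clim_id) (climC (u p))).
  have := climD (climM T W) (climC (u1 p)).
  have -> : (- u1 (0 + p) + u1 (0 - p)) / 2 * (1 - 0 * 0 * u p) + u1 p = 0.
    by rewrite add0r sub0r dwpN //; move: (u1 p) => a; field.
  apply: clim_ext; near=> h => h0; rewrite /F.
  have -> : G 0 = 0.
    by rewrite /G add0r sub0r zetaN //; move: (zt p) => a; ring.
  rewrite add0r; have -> : - u (0 + p) + u (0 - p) = 0 by rewrite add0r sub0r wpN // addNr.
  by move: (G h) (u h) (u p) => a b c; field.
have atp : clim (fun h => F (p + h)) 0.
  have c1 : clim (fun h => zt (2 * p + h)) (zt (2 * p)).
    by apply: clim_cont; apply: cderiv_cont; apply: (zeta_deriv Htau h2p).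
  have H := clim_deriv (wp_deriv Htau hp).
  have l1 := clim_ell_0 Htau (ltn0Sn 0) isT.
  have := climD (climB (climM (climB (climB c1 l1) (climC (2 * zt p))) (climM H clim_id)) H) (climC (u1 p)).
  have -> : (zt (2 * p) - 0 - 2 * zt p) * (u1 p * 0) - u1 p + u1 p = 0 by rewrite !mulr0 sub0r addNr.
  apply: clim_ext; near=> h => h0; rewrite /F /G.
  have -> : p + h + p = 2 * p + h by ring.
  have -> : p + h - p = h by ring.
  rewrite (zeta_laurent tau h).
  by move: (zt _) (zt _) (ell _ _ _) (u _) (u _) (u1 _) => a b c d e f; field.
apply: (@elliptic_zero _ tau Htau (fun x => ~ generic p x) F 0).
- by move=> x w hw h1 h3; apply: h1; rewrite -(generic_per p x hw).
- move=> x w hw /contrapT [a b c]; rewrite /F /G (wp_per Htau a hw).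
  case: hw => m [n ->].
  have -> : x + (m%:~R + n%:~R * tau) + p = x + p + (m%:~R + n%:~R * tau) by ring.
  have -> : x + (m%:~R + n%:~R * tau) - p = x - p + (m%:~R + n%:~R * tau) by ring.
  rewrite !(zeta_quasi Htau) //; congr (_ * _ + _).
  by move: (zt _) (zt _) (zt _) => i j k; ring.
- by move=> x /contrapT /generic_near; apply: filterS => y h1 h3; apply: h3.
- move=> x /contrapT [a b c]; apply: twiceD; last exact: twiceC.
  apply: twiceM; last by apply: twiceB; [apply: wp_twice|apply: twiceC].
  apply: twiceB; last exact: twiceC.
  apply: twiceB.
    apply: (@twice_comp _ zt (fun x => x + p)); last exact: zeta_twice.
    by apply: twiceD; [apply: twiceI|apply: twiceC].
  apply: (@twice_comp _ zt (fun x => x - p)); last exact: zeta_twice.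
  by apply: twiceD; [apply: twiceI|apply: twiceC].
- by case=> h _ _; apply: h; apply: lattice0.
move=> s hs.
have [sl|sl] := pselect (lat s).
  exists (- s); split; first exact: latticeN.
    by rewrite subrr => -[h _ _]; apply: h; apply: lattice0.
  rewrite subrr; apply: clim_ext at0; near=> h => _; by rewrite add0r.
have [sp|sp] := pselect (lat (s - p)).
  exists (- (s - p)); have -> : s - (s - p) = p by ring.
  split; [exact: latticeN|by case=> _ h _; apply: h; rewrite subrr; apply: lattice0|exact: atp].
have [sn|sn] := pselect (lat (s + p)); last by case: hs.
exists (- (s + p)); have -> : s - (s + p) = - p by ring.
split; [exact: latticeN|by case=> _ _ h; apply: h; rewrite addNr; apply: lattice0|].
have nN : \forall h \near (0 : C), ~ ~ generic p (p - h) \/ h = 0.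
  have a1 : ccont (fun h : C => p - h) 0.
    by apply: ccontD; [exact: ccontC|apply: cderiv_cont (cderivN (cderivI 0))].
  have a2 : ccont (fun h : C => 2 * p - h) 0.
    by apply: ccontD; [exact: ccontC|apply: cderiv_cont (cderivN (cderivI 0))].
  have b1 : ~ lat (p - 0) by rewrite subr0.
  have b2 : ~ lat (2 * p - 0) by rewrite subr0.
  have n1 := near_ccont a1 (notin_near Htau b1).
  have n2 := near_ccont a2 (notin_near Htau b2).
  have n3 := near_notin Htau.
  near=> h; have [->|h0] := eqVneq h 0; [by right|left; apply].
  split; first by near: h.
    have -> : p - h - p = - h by ring.
    by rewrite latN; move: h0; near: h.
  have -> : p - h + p = 2 * p - h by ring.
  by near: h.
move/climP: atp => atp; apply/climP => e e0; have [r r0 hr] := atp e e0.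
move/nearP: nN => [d d0 hd].
exists (Num.min r d); first by rewrite lt_min r0.
move=> h; rewrite lt_min => /andP[h1 h3] h0.
have := hd h; rewrite subr0 => /(_ h3) [gh|E]; last by rewrite E eqxx in h0.
have -> : - p + h = - (p - h) by ring.
by rewrite Fev //; apply: hr; rewrite ?cmodN ?oppr_eq0.
Unshelve. all: by end_near. Qed.

End Addition.

(** * Duplication formulas and half periods *)

Section Duplication.
Context {R : realType}.
Notation C := (cplx R).
Variable tau : C.
Hypothesis Htau : 0 < complex.Im tau.
Implicit Types (z w c h p : C).
Notation u := (wp tau).
Notation u1 := (dwp tau).
Notation u2 := (ddwp tau).
Notation zt := (zeta tau).
Notation lat := (lattice tau).
Notation g2 := (g2 tau).
Notation g3 := (g3 tau).
Local Opaque wp zeta dwp ddwp ell eis.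

(** Otherwise the product in [zeta_diff] vanishes near p while its first factor has a pole there, so
    wp would be constant near p. *)
Lemma dwp_neq0 p : ~ lat (2 * p) -> u1 p != 0.
Proof.
move=> h2p; have hp := lat_half h2p; apply/eqP => E.
apply: (@wp_not_locally_const _ tau Htau p (u p) hp).
have c1 : clim (fun h => zt (2 * p + h)) (zt (2 * p)).
  by apply: clim_cont; apply: cderiv_cont; apply: (zeta_deriv Htau h2p).
(* the first factor of [zeta_diff] has a pole at p *)
have L := climB (climM clim_id (climB c1 (climC (2 * zt p)))) (clim_h_zeta Htau).
have N1 : 0 * (zt (2 * p) - 2 * zt p) - 1 != 0 by rewrite mul0r sub0r oppr_eq0 oner_eq0.
have n := clim_neq L N1.
have c2 : ccont (fun h : C => p + h) 0 by apply: ccontD; [exact: ccontC|exact: ccontI].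
have c3 : ccont (fun h : C => 2 * p + h) 0 by apply: ccontD; [exact: ccontC|exact: ccontI].
have b1 : ~ lat (p + 0) by rewrite addr0.
have b2 : ~ lat (2 * p + 0) by rewrite addr0.
have n1 := near_ccont c2 (notin_near Htau b1).
have n2 := near_ccont c3 (notin_near Htau b2).
have n3 := near_notin Htau.
have nb : \forall h \near (0 : C), u (p + h) = u p.
  near=> h; have [->|h0] := eqVneq h 0; first by rewrite addr0.
  have gp : generic tau p (p + h).
    split; first by near: h.
      have -> : p + h - p = h by ring.
      by move: h0; near: h.
    have -> : p + h + p = 2 * p + h by ring.
    by near: h.
  have := zeta_diff Htau h2p gp; rewrite E oppr0.
  have -> : p + h - p = h by ring.
  have -> : p + h + p = 2 * p + h by ring.
  have : h * (zt (2 * p + h) - 2 * zt p) - h * zt h != 0 by move: h0; near: h.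
  move=> ne /eqP; rewrite mulf_eq0 => /orP[/eqP z0|]; last by rewrite subr_eq0 => /eqP.
  case/eqP: ne; rewrite -mulrBr -[RHS](mulr0 h); congr (h * _).
  by rewrite -[RHS]z0 addrAC.
by apply/(near0P p (fun x => u x = u p)); have /nearP [d d0 hd] := nb; exists d => // h hh; apply: hd; rewrite subr0.
Unshelve. all: by end_near. Qed.

Lemma wp_neq p z : ~ lat (2 * p) -> generic tau p z -> u z != u p.
Proof.
move=> h2p gz; rewrite -subr_eq0; apply/eqP => E.
have := zeta_diff Htau h2p gz; rewrite E mulr0 => /esym/eqP.
by rewrite oppr_eq0 (negPf (dwp_neq0 h2p)).
Qed.

Lemma zeta_diff_div p z : ~ lat (2 * p) -> generic tau p z ->
  zt (z + p) - zt (z - p) = 2 * zt p - u1 p / (u z - u p).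
Proof.
move=> h2p gz; have := zeta_diff Htau h2p gz; have := wp_neq h2p gz.
rewrite -subr_eq0 => ne E; have -> : u1 p = - - u1 p by rewrite opprK.
rewrite -E; move: ne; move: (zt _) (zt _) (zt _) (u z) (u p) => i j k a b ne.
by field.
Qed.

Lemma half_dwp c : ~ lat c -> lat (2 * c) -> u1 c = 0.
Proof.
move=> hc h2c; have E : u1 (- c) = u1 c.
  rewrite -(dwp_per Htau (_ : ~ lat (- c)) h2c); last by rewrite latN.
  by congr u1; ring.
move: E; rewrite dwpN // => /eqP; rewrite eq_sym -addr_eq0 -mulr2n mulrn_eq0 /=.
by move/eqP.
Qed.

(** The double pole of each factor, at 0 and at c, is met by a double zero of the other because wp'
    c = 0; the limit of the product is wp'' c / 2 at both points. *)
Lemma half_wp_prod c z : ~ lat c -> lat (2 * c) -> ~ lat z -> ~ lat (z - c) ->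
  (u z - u c) * (u (z - c) - u c) = u2 c / 2.
Proof.
move=> hc h2c hz hzc; apply/eqP; rewrite -subr_eq0; apply/eqP.
pose F z := (u z - u c) * (u (z - c) - u c) - u2 c / 2.
pose S z := lat z \/ lat (z - c).
have subc x : ccont (fun x => x - c) x by apply: ccontD; [exact: ccontI|exact: ccontC].
have T x : ~ lat x -> u x = u c -> u1 x = 0 -> u2 x = u2 c ->
    clim (fun h => (u h - u c) * (u (x + h) - u c) - u2 c / 2) 0.
  move=> hx e0 e1 e2.
  have h1 : \forall y \near x, cderiv u y (u1 y).
    by have := notin_near Htau hx; apply: filterS => y; apply: wp_deriv.
  have L := clim_taylor (taylor2P h1 (dwp_deriv Htau hx)).
  have W := climB (clim_h2_wp Htau) (climM (climM clim_id clim_id) (climC (u c))).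
  have := climB (climM W L) (climC (u2 c / 2)).
  have -> : (1 - 0 * 0 * u c) * (u2 x / 2) - u2 c / 2 = 0 by rewrite e2 !mul0r subr0 mul1r subrr.
  apply: clim_ext; near=> h => h0; rewrite e0 e1.
  by move: (u h) (u _) (u c) (u2 c) => i j k l; field.
have hNc : ~ lat (- c) by rewrite latN.
have perc (f : C -> C) : (forall z w, ~ lat z -> lat w -> f (z + w) = f z) -> f (- c) = f c.
  move=> per; rewrite -(per (- c) (2 * c)) //; congr f; ring.
apply: (@elliptic_zero _ tau Htau S F 0 _ _ _ _ _ _ z) => //; last by case.
- move=> x w hw [h|h]; [left|right]; first exact: latticeD.
  have -> : x + w - c = x - c + w by ring.
  exact: latticeD.
- move=> x w hw nS.
  have h1 : ~ lat x by move=> h; apply: nS; left.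
  have h2 : ~ lat (x - c) by move=> h; apply: nS; right.
  rewrite /F wp_per //; have -> : x + w - c = x - c + w by ring.
  by rewrite wp_per.
- move=> x nS.
  have h1 : ~ lat x by move=> h; apply: nS; left.
  have h2 : ~ lat (x - c) by move=> h; apply: nS; right.
  have n1 := notin_near Htau h1; have n2 := near_ccont (subc x) (notin_near Htau h2).
  by apply: filterS2 n1 n2 => y a b [].
- move=> x nS.
  have h1 : ~ lat x by move=> h; apply: nS; left.
  have h2 : ~ lat (x - c) by move=> h; apply: nS; right.
  apply: twiceB; last exact: twiceC.
  apply: twiceM; first by apply: twiceB; [apply: wp_twice|apply: twiceC].
  apply: twiceB; last exact: twiceC.
  apply: (@twice_comp _ u (fun x => x - c)); last exact: wp_twice.
  by apply: twiceB; [apply: twiceI|apply: twiceC].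
- by left; apply: lattice0.
move=> s [h|h].
  exists (- s); split; [exact: latticeN|by left; rewrite subrr; apply: lattice0|].
  have := T (- c) hNc (perc u (wp_per Htau)) _ (perc u2 (ddwp_per Htau)).
  rewrite dwpN // half_dwp // oppr0 => /(_ erefl); apply: clim_ext; near=> k => _.
  by rewrite subrr add0r /F (addrC k).
exists (- (s - c)); have -> : s - (s - c) = c by ring.
split; [exact: latticeN|by right; rewrite subrr; apply: lattice0|].
have := T c hc erefl (half_dwp hc h2c) erefl; apply: clim_ext; near=> k => _.
by rewrite /F mulrC; have -> : c + k - c = k by ring.
Unshelve. all: by end_near. Qed.

(** Otherwise one factor of [half_wp_prod] vanishes at each point; near 0 it cannot be the one with
    the pole, so wp would be constant near -c. *)
Lemma half_ddwp_neq0 c : ~ lat c -> lat (2 * c) -> u2 c != 0.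
Proof.
move=> hc h2c; apply/eqP => E.
have hNc : ~ lat (- c) by rewrite latN.
apply: (@wp_not_locally_const _ tau Htau (- c) (u c) hNc).
have n1 := near_notin Htau; have n2 := wp_large Htau (cmod (u c)).
have c2 : ccont (fun h : C => h - c) 0 by apply: ccontD; [exact: ccontI|exact: ccontC].
have b1 : ~ lat (0 - c) by rewrite sub0r.
have n3 := near_ccont c2 (notin_near Htau b1).
have nb : \forall h \near (0 : C), u (- c + h) = u c.
  near=> h; have [->|h0] := eqVneq h 0; first by rewrite addr0 wpN.
  have hl : ~ lat h by move: h0; near: h.
  have hlc : ~ lat (h - c) by near: h.
  have := half_wp_prod hc h2c hl hlc; rewrite E mul0r => /eqP.
  rewrite mulf_eq0 !subr_eq0 (addrC h) => /orP[/eqP hu|/eqP //].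
  have : cmod (u c) < cmod (u h) by move: h0; near: h.
  by rewrite hu ltxx.
by apply/(near0P (- c) (fun x => u x = u c)); have /nearP [d d0 hd] := nb; exists d => // h hh; apply: hd; rewrite subr0.
Unshelve. all: by end_near. Qed.

Lemma half_wp_neq c z : ~ lat c -> lat (2 * c) -> ~ lat z -> ~ lat (z - c) -> u z != u c.
Proof.
move=> hc h2c hz hzc; rewrite -subr_eq0; apply/eqP => E.
have := half_wp_prod hc h2c hz hzc; rewrite E mul0r => /esym/eqP.
by rewrite mulf_eq0 invr_eq0 pnatr_eq0 orbF (negPf (half_ddwp_neq0 hc h2c)).
Qed.

Lemma twice_notin_near p : ~ lat (2 * p) -> \forall x \near p, ~ lat (2 * x).
Proof.
move=> h; have c : ccont (fun x : C => 2 * x) p by apply: ccontM; [exact: ccontC|exact: ccontI].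
exact: (near_ccont c (notin_near Htau h)).
Qed.

(** Limit of [zeta_diff] for z = p + h with h -> 0: the product of the pole 1 / h with wp (p + h) -
    wp p must be expanded to second order, which brings in wp'' p / 2. *)
Lemma zeta_dup p : ~ lat (2 * p) -> zt (2 * p) = 2 * zt p + u2 p / (2 * u1 p).
Proof.
move=> h2p; have hp := lat_half h2p; have d0 := dwp_neq0 h2p.
have h1 : \forall y \near p, cderiv u y (u1 y).
  by have := notin_near Htau hp; apply: filterS => y; apply: wp_deriv.
have L := clim_taylor (taylor2P h1 (dwp_deriv Htau hp)).
have c1 : clim (fun h => zt (2 * p + h)) (zt (2 * p)).
  by apply: clim_cont; apply: cderiv_cont; apply: (zeta_deriv Htau h2p).
have H := clim_deriv (wp_deriv Htau hp).
have l1 := clim_ell_0 Htau (ltn0Sn 0) isT.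
have M := climM (climB (climB c1 (climC (2 * zt p))) l1) H.
have n1 : \forall h \near (0 : C), h != 0 -> generic tau p (p + h).
  have c2 : ccont (fun h : C => p + h) 0 by apply: ccontD; [exact: ccontC|exact: ccontI].
  have c3 : ccont (fun h : C => 2 * p + h) 0 by apply: ccontD; [exact: ccontC|exact: ccontI].
  have b1 : ~ lat (p + 0) by rewrite addr0.
  have b2 : ~ lat (2 * p + 0) by rewrite addr0.
  have m1 := near_ccont c2 (notin_near Htau b1).
  have m2 := near_ccont c3 (notin_near Htau b2).
  have m3 := near_notin Htau.
  near=> h => h0; split; first by near: h.
    have -> : p + h - p = h by ring.
    by move: h0; near: h.
  have -> : p + h + p = 2 * p + h by ring.
  by near: h.
have E : (zt (2 * p) - 2 * zt p - 0) * u1 p = u2 p / 2.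
  apply: clim_unique M _; apply: clim_ext L.
  near=> h => h0.
  have gp : generic tau p (p + h) by move: h0; near: h.
  have := zeta_diff Htau h2p gp.
  have -> : p + h - p = h by ring.
  have -> : p + h + p = 2 * p + h by ring.
  rewrite (zeta_laurent tau h).
  move=> E; have -> : u1 p = - - u1 p by rewrite opprK.
  rewrite -E; move: (zt _) (zt _) (ell _ _ _) (u (p + h)) (u p) => i j k a b.
  by field.
have -> : u2 p = 2 * (u2 p / 2) by field.
by rewrite -E subr0; move: (zt _) (zt _) => i j; field.
Unshelve. all: by end_near. Qed.

Lemma ddwp_deriv z : ~ lat z -> cderiv u2 z (12 * u z * u1 z).
Proof.
move=> hz; have d := wp_deriv Htau hz.
have := cderivB (cderivZ 6 (cderivM d d)) (cderivC (g2 / 2) z).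
have -> : 6 * (u1 z * u z + u z * u1 z) - 0 = 12 * u z * u1 z by move: (u z) (u1 z) => a b; ring.
apply: cderiv_ext; have := notin_near Htau hz; apply: filterS => x hx.
by rewrite (wp_ode Htau hx).
Qed.

(** Differentiate [zeta_dup] in p and use wp''' = 12 wp wp'. *)
Lemma wp_dup p : ~ lat (2 * p) -> u (2 * p) = (u2 p / u1 p) ^+ 2 / 4 - 2 * u p.
Proof.
move=> h2p; have hp := lat_half h2p; have d0 := dwp_neq0 h2p.
have e1 := cderiv_comp (cderivZ 2 (cderivI p)) (zeta_deriv Htau h2p).
have d20 : 2 * u1 p != 0 by rewrite mulf_neq0.
have e2 := cderivD (cderivZ 2 (zeta_deriv Htau hp))
  (@cderiv_div _ u2 (fun x => 2 * u1 x) p _ _ d20 (ddwp_deriv hp) (cderivZ 2 (dwp_deriv Htau hp))).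
have n : \forall x \near p, 2 * zt x + u2 x / (2 * u1 x) = zt (2 * x).
  by have := twice_notin_near h2p; apply: filterS => x hx; rewrite zeta_dup.
have := cderiv_unique e1 (cderiv_ext n e2).
move=> E; transitivity (- (- u (2 * p) * (2 * 1)) / 2).
  by move: (u (2 * p)) => a; field.
by rewrite E; move: (u p) (u1 p) (u2 p) d0 => b c d c0; field.
Qed.

(** Differentiating [zeta_diff_div] in p rather than in z produces the symmetric sum that occurs in
    the potential. *)
Lemma wp_sum p z : ~ lat (2 * p) -> generic tau p z ->
  u (z + p) + u (z - p) = 2 * u p + u2 p / (u z - u p) + u1 p ^+ 2 / (u z - u p) ^+ 2.
Proof.
move=> h2p gz; have hp := lat_half h2p; have [hz hm hpl] := gz.
have ne : u z - u p != 0 by rewrite subr_eq0 wp_neq.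
have dm : cderiv (fun x : C => z - x) p (0 - 1) by apply: cderivB; [exact: cderivC|exact: cderivI].
have dpl : cderiv (fun x : C => z + x) p (0 + 1) by apply: cderivD; [exact: cderivC|exact: cderivI].
have e1 := cderivB (cderiv_comp dpl (zeta_deriv Htau hpl)) (cderiv_comp dm (zeta_deriv Htau hm)).
have e2 := cderivB (cderivZ 2 (zeta_deriv Htau hp))
  (@cderiv_div _ u1 (fun x => u z - u x) p _ _ ne (dwp_deriv Htau hp) (cderivB (cderivC (u z) p) (wp_deriv Htau hp))).
have n : \forall x \near p, 2 * zt x - u1 x / (u z - u x) = zt (z + x) - zt (z - x).
  have n1 := twice_notin_near h2p.
  have n2 := near_ccont (cderiv_cont dm) (notin_near Htau hm).
  have n3 := near_ccont (cderiv_cont dpl) (notin_near Htau hpl).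
  by near=> x; rewrite zeta_diff_div //; [near: x|split=> //; near: x].
have := cderiv_unique e1 (cderiv_ext n e2).
move=> E; transitivity (- (- u (z + p) * (0 + 1) - - u (z - p) * (0 - 1))).
  by move: (u (z + p)) (u (z - p)) => a b; ring.
by rewrite E; move: (u z) (u p) (u1 p) (u2 p) ne => v c d e ne; field.
Unshelve. all: by end_near. Qed.

End Duplication.

(** * Explicit solutions *)

Section Numerators.
Context {R : realType}.
Notation C := (cplx R).
Variable tau : C.
Hypothesis Htau : 0 < complex.Im tau.
Implicit Types (z w c h : C).
Notation u := (wp tau).
Notation u1 := (dwp tau).
Notation u2 := (ddwp tau).
Notation zt := (zeta tau).
Notation lat := (lattice tau).
Notation g2 := (g2 tau).
Notation g3 := (g3 tau).
Local Opaque wp zeta dwp ddwp ell eis Defs.g2 Defs.g3.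
Variable p : C.
Hypothesis h2p : ~ lat (2 * p).
Notation P := (u p).
Notation P1 := (u1 p).
Notation P2 := (u2 p).

Definition regular z := ~ lat (2 * z) /\ generic tau p z.

Lemma regular_notin z : regular z -> ~ lat z.
Proof. by case=> _ []. Qed.

Lemma regular_near z : regular z -> \forall x \near z, regular x.
Proof.
move=> [a b]; have n1 := twice_notin_near Htau a; have n2 := generic_near Htau b.
by apply: filterS2 n1 n2.
Qed.

Lemma regular_per z w : lat w -> regular (z + w) <-> regular z.
Proof.
move=> hw; rewrite /regular; have -> : 2 * (z + w) = 2 * z + (w + w) by ring.
have hw2 : lat (w + w) by apply: latticeD.
by rewrite (latticeDl (2 * z) hw2) (generic_per p z hw).
Qed.

Lemma potentialE z A M : regular z -> A = P1 * M - P2 / (4 * P1) ->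
  potential tau p A z = 2 * u z + P + P2 / (u z - P) + 3 / 4 * P1 ^+ 2 / (u z - P) ^+ 2
   - P1 ^+ 2 * M / (u z - P) + P1 ^+ 2 * M ^+ 2 - P2 * M.
Proof.
move=> [_ gz] ->; rewrite /potential /B_apparent.
rewrite (wp_sum Htau h2p gz) (zeta_diff_div Htau h2p gz) (wp_dup Htau h2p) (zeta_dup Htau h2p).
have := dwp_neq0 Htau h2p; have := wp_neq Htau h2p gz; rewrite -subr_eq0.
move: (u z) P P1 P2 (zt p) => x y y1 y2 t d0 y10.
by field; rewrite d0 y10.
Qed.

(* y = N / S solves the equation, for S ^ 2 = wp z - wp p. *)
Definition numerator A (N N' : C -> C) := exists N'' : C -> C, forall z, regular z ->
  [/\ cderiv N z (N' z), cderiv N' z (N'' z) &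
   N'' z * (u z - P) ^+ 2 - N' z * u1 z * (u z - P) +
   N z * (3 / 4 * u1 z ^+ 2 - u2 z * (u z - P) / 2) =
   potential tau p A z * (u z - P) ^+ 2 * N z].

Definition Zeta al Y z : C := 2 * al * zt z + 2 * Y * z.

Lemma Zeta_deriv al Y z : ~ lat z -> cderiv (Zeta al Y) z (2 * Y - 2 * al * u z).
Proof.
move=> hz; apply: cderiv_eq (cderivD (cderivZ (2 * al) (zeta_deriv Htau hz)) (cderivZ (2 * Y) (cderivI z))) _.
by move: (u z) => x; ring.
Qed.

Lemma Zeta_quasi al Y w : lat w -> exists chi : C, forall z, ~ lat z -> Zeta al Y (z + w) = Zeta al Y z + chi.
Proof.
case=> m [n ->]; exists (2 * al * (m%:~R * quasi_period tau 1 + n%:~R * quasi_period tau 2) + 2 * Y * (m%:~R + n%:~R * tau)).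
move=> x hx; rewrite /Zeta (zeta_quasi Htau) //; move: (zt x) (quasi_period _ _) (quasi_period _ _) => a b c; ring.
Qed.

Lemma Zeta_quasi1 al Y z : ~ lat z -> Zeta al Y (z + 1) = Zeta al Y z + 2 * (al * quasi_period tau 1 + Y).
Proof.
move=> /(quasi_period1 Htau); rewrite /Zeta; move: (zt _) (zt _) (quasi_period _ _) => a b c <-; ring.
Qed.

Lemma Zeta_quasi2 al Y z : ~ lat z ->
  Zeta al Y (z + tau) = Zeta al Y z + 2 * (al * quasi_period tau 2 + Y * tau).
Proof.
move=> /(quasi_period2 Htau); rewrite /Zeta; move: (zt _) (zt _) (quasi_period _ _) => a b c <-; ring.
Qed.

Section CaseOne.
Variable Y : C.
(** Equivalent to 4 Y^3 - g2 Y - g3 = (Y - P) (6 Y^2 - g2 / 2), that is, to wp'^2 = (Y - P) wp'' at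
    a zero of wp - Y. This is the vanishing of the residue of (wp - P) / (wp - Y)^2 at a simple
    zero. *)
Hypothesis relY : (6 * Y ^+ 2 - g2 / 2) * P = 2 * Y ^+ 3 + g2 * Y / 2 + g3.

(* The second numerator is N1 times a primitive of a multiple of (wp - P) / N1 ^ 2. *)
Definition numA z : C := u z - Y.
Definition numB z : C := (u z - Y) * Zeta 1 Y z + u1 z.
Definition numB' z : C := u1 z * Zeta 1 Y z + (u z - Y) * (2 * Y - 2 * u z) + u2 z.
(** The coefficient of h in h^(1/2) y at z = p + h, normalised to start with 1: N1'(p) / N1(p) -
    wp''(p) / (4 wp'(p)) for N1 = wp - Y. Comparing terms of order h^(-3/2) in the equation shows
    that it must be A. *)
Definition acc1 := P1 * (P - Y)^-1 - P2 / (4 * P1).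

Let g3E : g3 = (6 * Y ^+ 2 - g2 / 2) * P - (2 * Y ^+ 3 + g2 * Y / 2).
Proof. by rewrite relY; move: g2 g3 => a b; ring. Qed.

Lemma PY_neq : P - Y != 0.
Proof.
apply/eqP => /eqP; rewrite subr_eq0 => /eqP E.
have := dwp_neq0 Htau h2p; rewrite -sqrf_eq0 (wp_cubic Htau (lat_half h2p)) g3E -E.
by move: g2 P => a b; case/negP; apply/eqP; field.
Qed.

Lemma numA_numerator : numerator acc1 numA u1.
Proof.
exists u2 => z hz; have hl := regular_notin hz; split.
- by apply: cderiv_eq (cderivB (wp_deriv Htau hl) (cderivC Y z)) _; rewrite subr0.
- exact: dwp_deriv.
rewrite (potentialE hz (erefl acc1)) /numA.
have := PY_neq; have := wp_neq Htau h2p hz.2; rewrite -subr_eq0.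
rewrite !(wp_cubic Htau) ?(wp_ode Htau) //; try exact: lat_half.
rewrite -expr2 (wp_cubic Htau hl) g3E; move: (u z) P g2 => x y a d0 y0.
by field; rewrite d0 y0.
Qed.

Lemma numB_numerator : numerator acc1 numB numB'.
Proof.
exists (fun z => u2 z * Zeta 1 Y z + u1 z * (2 * (2 * Y - 2 * u z) - 2 * (u z - Y) + 12 * u z)).
move=> z hz; have hl := regular_notin hz; have dZ := Zeta_deriv 1 Y hl; rewrite mulr1 in dZ; split.
- have := cderivD (cderivM (cderivB (wp_deriv Htau hl) (cderivC Y z)) (dZ)) (dwp_deriv Htau hl).
  by move/cderiv_eq; apply; rewrite subr0.
- have d1 := cderivB (wp_deriv Htau hl) (cderivC Y z).
  have d2 := cderivB (cderivC (2 * Y) z) (cderivZ 2 (wp_deriv Htau hl)).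
  have := cderivD (cderivD (cderivM (dwp_deriv Htau hl) (dZ)) (cderivM d1 d2)) (ddwp_deriv Htau hl).
  by move/cderiv_eq; apply; move: (u z) (u1 z) (u2 z) (Zeta 1 Y z) => a b c d; ring.
rewrite (potentialE hz (erefl acc1)) /numB /numB'.
have := PY_neq; have := wp_neq Htau h2p hz.2; rewrite -subr_eq0.
have E1 := wp_cubic Htau hl; have E2 := wp_cubic Htau (lat_half h2p).
rewrite E2 !(wp_ode Htau) //; try exact: lat_half.
move: E1; rewrite g3E; move: (u z) (u1 z) P g2 (Zeta 1 Y z) => x b y a t E1 d0 y0.
(* Sorted by t = Zeta and b = wp', the coefficients contain b only through b^2, which the cubic
   relation eliminates. *)
transitivity (t * ((6 * x ^+ 2 - a / 2) * (x - y) ^+ 2 - b ^+ 2 * (x - y)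
     + (x - Y) * (3 / 4 * b ^+ 2 - (6 * x ^+ 2 - a / 2) * (x - y) / 2))
  + b * ((2 * (2 * Y - 2 * x) - 2 * (x - Y) + 12 * x) * (x - y) ^+ 2
     - ((x - Y) * (2 * Y - 2 * x) + (6 * x ^+ 2 - a / 2)) * (x - y)
     + (3 / 4 * b ^+ 2 - (6 * x ^+ 2 - a / 2) * (x - y) / 2))); first by field.
by rewrite E1; field; rewrite d0 y0.
Qed.

End CaseOne.
End Numerators.

(** * The meromorphic square root of wp - e *)

Section NumeratorsTwo.
Context {R : realType}.
Notation C := (cplx R).
Variable tau : C.
Hypothesis Htau : 0 < complex.Im tau.
Implicit Types (z w c h : C).
Notation u := (wp tau).
Notation u1 := (dwp tau).
Notation u2 := (ddwp tau).
Notation zt := (zeta tau).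
Notation lat := (lattice tau).
Notation g2 := (g2 tau).
Notation g3 := (g3 tau).
Local Opaque wp zeta dwp ddwp ell eis Defs.g2 Defs.g3.

Lemma half_root c : ~ lat c -> lat (2 * c) -> 4 * u c ^+ 3 - g2 * u c - g3 = 0.
Proof. by move=> hc h2c; rewrite -(wp_cubic Htau hc) half_dwp // expr0n. Qed.

Lemma half_q c : ~ lat c -> u2 c / 2 = 3 * u c ^+ 2 - g2 / 4.
Proof. by move=> hc; rewrite wp_ode //; move: (u c) g2 => a b; field. Qed.

Lemma half_g2 c c' : ~ lat c -> lat (2 * c) -> ~ lat c' -> lat (2 * c') -> u c != u c' ->
  g2 = 4 * (u c ^+ 2 + u c * u c' + u c' ^+ 2).
Proof.
move=> hc h2c hc' h2c'; rewrite -subr_eq0.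
have := half_root hc h2c; have := half_root hc' h2c'.
move: (u c) (u c') g2 g3 => a b i j E1 E2 ne.
have : (a - b) * (4 * (a ^+ 2 + a * b + b ^+ 2) - i) = 0.
  have -> : (a - b) * (4 * (a ^+ 2 + a * b + b ^+ 2) - i) = (4 * a ^+ 3 - i * a - j) - (4 * b ^+ 3 - i * b - j) by ring.
  by rewrite E1 E2 subrr.
by move/eqP; rewrite mulf_eq0 (negPf ne) subr_eq0 => /eqP.
Qed.

Lemma wp_shift_half c x : ~ lat c -> lat (2 * c) -> ~ lat x -> ~ lat (x + c) ->
  u x - u c != 0 /\ u (x + c) = u c + (u2 c / 2) / (u x - u c).
Proof.
move=> hc h2c hx hxc; have E : x + c - c = x by ring.
have hxc' : ~ lat (x + c - c) by rewrite E.
have := half_wp_prod Htau hc h2c hxc hxc'; rewrite E => H.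
have ne : u x - u c != 0.
  apply/eqP => e0; move: H; rewrite e0 mulr0 => /esym/eqP.
  by rewrite mulf_eq0 invr_eq0 pnatr_eq0 orbF (negPf (half_ddwp_neq0 Htau hc h2c)).
split=> //; rewrite -H; move: (u (x + c)) (u x) (u c) ne => a b d ne; by field.
Qed.

Lemma dwp_shift_half c x : ~ lat c -> lat (2 * c) -> ~ lat x -> ~ lat (x + c) ->
  u1 (x + c) = - (u2 c / 2) * u1 x / (u x - u c) ^+ 2.
Proof.
move=> hc h2c hx hxc; have [ne _] := wp_shift_half hc h2c hx hxc.
have e1 := cderiv_shift (wp_deriv Htau hxc).
have dd := cderivB (wp_deriv Htau hx) (cderivC (u c) x).
have e2 := cderivD (cderivC (u c) x) (@cderiv_div _ (fun=> u2 c / 2) (fun y => u y - u c) x _ _ ne (cderivC (u2 c / 2) x) dd).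
have cs : ccont (fun y => y + c) x by apply: ccontD; [exact: ccontI|exact: ccontC].
have n : \forall y \near x, u c + (u2 c / 2) / (u y - u c) = u (y + c).
  have n1 := notin_near Htau hx; have n2 := near_ccont cs (notin_near Htau hxc).
  by apply: filterS2 n1 n2 => y a b; have [_ ->] := wp_shift_half hc h2c a b.
rewrite (cderiv_unique e1 (cderiv_ext n e2)).
by move: (u x) (u c) (u1 x) (u2 c) ne => a b d e ne; field.
Qed.

Variable c : C.
Hypotheses (hc : ~ lat c) (h2c : lat (2 * c)).
Notation e := (u c).
Notation q := (u2 c / 2).

(* A single-valued square root of wp - e: by the duplication formula, wp (2y) - e is a square. *)
Definition sqrt_wp z : C := ((u (z / 2) - e) ^+ 2 - q) / u1 (z / 2).

Let half2 z : 2 * (z / 2) = z. Proof. by field. Qed.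
Let notin_half z : ~ lat z -> ~ lat (2 * (z / 2)). Proof. by rewrite half2. Qed.

Lemma sqrt_wp_sq z : ~ lat z -> sqrt_wp z ^+ 2 = u z - e.
Proof.
move=> /notin_half hz; have hy := lat_half hz; have d0 := dwp_neq0 Htau hz.
rewrite -{2}(half2 z) (wp_dup Htau hz) /sqrt_wp (half_q hc) expr_div_n.
have E := wp_cubic Htau hy; have Er := half_root hc h2c.
rewrite (wp_ode Htau hy).
move: (u (z / 2)) (u1 (z / 2)) e g2 g3 d0 E Er => x b a i j b0 E Er.
have jE : j = 4 * a ^+ 3 - i * a by rewrite -[RHS]subr0 -Er; ring.
rewrite jE in E.
have B0 : b ^+ 2 != 0 by rewrite expf_neq0.
rewrite expr_div_n E; rewrite E in B0; field.
by rewrite -jE; move: B0; rewrite -jE.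
Qed.

Lemma sqrt_wp_cont z : ~ lat z -> ccont sqrt_wp z.
Proof.
move=> /notin_half hz; have hy := lat_half hz; have d0 := dwp_neq0 Htau hz.
have dh : cderiv (fun x : C => x / 2) z (1 * 2^-1 + z * 0) by apply: cderivM; [exact: cderivI|exact: cderivC].
have du := cderivB (cderiv_comp dh (wp_deriv Htau hy)) (cderivC e z).
have du1 := cderiv_comp dh (dwp_deriv Htau hy).
apply: cderiv_cont; exact: (@cderiv_div _ (fun x => (u (x / 2) - e) * (u (x / 2) - e) - q) (fun x => u1 (x / 2)) z _ _ d0 (cderivB (cderivM du du) (cderivC q z)) du1).
Qed.

Lemma sqrt_wp_neq0 z : ~ lat (2 * z) -> sqrt_wp z != 0.
Proof.
move=> h2z; have hz := lat_half h2z; rewrite -sqrf_eq0 sqrt_wp_sq // subr_eq0.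
apply: (half_wp_neq Htau) => // h; apply: h2z.
have -> : 2 * z = (z - c) + (z - c) + 2 * c by ring.
by apply: latticeD => //; apply: latticeD.
Qed.

Definition dsqrt_wp z : C := u1 z / (2 * sqrt_wp z).

Lemma sqrt_wp_deriv z : ~ lat (2 * z) -> cderiv sqrt_wp z (dsqrt_wp z).
Proof.
move=> h2z; have hz := lat_half h2z.
have d := cderivB (wp_deriv Htau hz) (cderivC e z); rewrite subr0 in d.
apply: cderiv_sqrt d; [exact: sqrt_wp_cont|exact: sqrt_wp_neq0|].
by have := notin_near Htau hz; apply: filterS => x; apply: sqrt_wp_sq.
Qed.

Lemma wp_sqrtE z : ~ lat z -> u z = sqrt_wp z ^+ 2 + e.
Proof. by move/sqrt_wp_sq => ->; rewrite subrK. Qed.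

Lemma dwp_sqrtE z : ~ lat (2 * z) -> u1 z = 2 * sqrt_wp z * dsqrt_wp z.
Proof. by move=> /sqrt_wp_neq0; rewrite /dsqrt_wp; move: (u1 z) (sqrt_wp z) => a b b0; field. Qed.

(** In terms of v the cubic relation becomes a Jacobi quartic: the factor wp - e = v^2 cancels and a
    quadratic in v^2 remains. *)
Lemma dsqrt_wp_sq z : ~ lat (2 * z) ->
  dsqrt_wp z ^+ 2 = sqrt_wp z ^+ 4 + 3 * e * sqrt_wp z ^+ 2 + (3 * e ^+ 2 - g2 / 4).
Proof.
move=> h2z; have hz := lat_half h2z; have v0 := sqrt_wp_neq0 h2z.
rewrite /dsqrt_wp expr_div_n (wp_cubic Htau hz) (wp_sqrtE hz).
have := half_root hc h2c; move: (sqrt_wp z) e g2 g3 v0 => v a i j v0 Er.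
have -> : j = 4 * a ^+ 3 - i * a by rewrite -[RHS]subr0 -Er; ring.
by field.
Qed.

Lemma dsqrt_wp_deriv z : ~ lat (2 * z) ->
  cderiv dsqrt_wp z (sqrt_wp z * (2 * sqrt_wp z ^+ 2 + 3 * e)).
Proof.
move=> h2z; have hz := lat_half h2z; have v0 := sqrt_wp_neq0 h2z.
have v20 : 2 * sqrt_wp z != 0 by rewrite mulf_neq0.
have := @cderiv_div _ u1 (fun x => 2 * sqrt_wp x) z _ _ v20 (dwp_deriv Htau hz) (cderivZ 2 (sqrt_wp_deriv h2z)).
move/cderiv_eq; apply; rewrite (wp_ode Htau hz) (wp_sqrtE hz) (dwp_sqrtE h2z).
have := dsqrt_wp_sq h2z; move: (sqrt_wp z) (dsqrt_wp z) e g2 v0 {v20} => v w a i v0 E.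
transitivity (((6 * (v ^+ 2 + a) ^+ 2 - i / 2) * (2 * v) - 4 * v * w ^+ 2) / (2 * v) ^+ 2); first by field.
by rewrite E; field.
Qed.

(** The period 2 c' moves z / 2 by the half period c', where wp and wp' transform by explicit
    fractions; in the quotient defining [sqrt_wp] everything cancels but a sign. This decides the
    signs in part (2). *)
Lemma sqrt_wp_shift c' z : ~ lat c' -> lat (2 * c') -> ~ lat z ->
  sqrt_wp (z + 2 * c') = if u c' == e then sqrt_wp z else - sqrt_wp z.
Proof.
move=> hc' h2c' /notin_half hz; have hy := lat_half hz; have d0 := dwp_neq0 Htau hz.
have hyc : ~ lat (z / 2 + c').
  apply: lat_half; have -> : 2 * (z / 2 + c') = 2 * (z / 2) + 2 * c' by ring.
  by rewrite latticeDl.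
rewrite /sqrt_wp; have -> : (z + 2 * c') / 2 = z / 2 + c' by field.
have [ne ->] := wp_shift_half hc' h2c' hy hyc.
rewrite (dwp_shift_half hc' h2c' hy hyc).
have q0 := half_ddwp_neq0 Htau hc' h2c'.
have q20 : u2 c' / 2 != 0 by rewrite mulf_neq0.
have [E|ne'] := eqVneq (u c') e.
  have E2 : u2 c' / 2 = q by rewrite !half_q // E.
  rewrite E2 E in ne q20 *; move: (u (z / 2)) (u1 (z / 2)) e (q) ne d0 q20 => x b a k ne b0 k0.
  by field; rewrite b0 ne k0.
have := half_g2 hc h2c hc' h2c'; rewrite eq_sym => /(_ ne') G.
move: q20; rewrite !half_q // G => q20.
move: (u (z / 2)) (u1 (z / 2)) e (u c') ne d0 ne' q20 => x b a a' ne b0 ne' q20.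
have q1 : 3 * a' ^+ 2 - 4 * (a ^+ 2 + a * a' + a' ^+ 2) / 4 = (a' - a) * (2 * a' + a) by field.
rewrite q1 in q20 *; move: q20; rewrite mulf_eq0 negb_or => /andP[n1 n2].
by field; rewrite b0 ne n1 n2.
Qed.

Lemma sqrt_wp_quasi w : lat w -> exists2 ep : C, ep ^+ 2 = 1 &
  forall z, ~ lat z -> sqrt_wp (z + w) = ep * sqrt_wp z.
Proof.
move=> hw; have E : w = 2 * (w / 2) by field.
have [hw2|hw2] := pselect (lat (w / 2)).
  exists 1; first by rewrite expr1n.
  move=> z /notin_half hz; have hy := lat_half hz; rewrite mul1r /sqrt_wp.
  have -> : (z + w) / 2 = z / 2 + w / 2 by field.
  by rewrite (wp_per Htau) // (dwp_per Htau).
exists (if u (w / 2) == e then 1 else -1).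
  by case: ifP; rewrite ?sqrrN expr1n.
move=> z hz; rewrite {1}E sqrt_wp_shift // -?E //.
by case: ifP; rewrite ?mul1r ?mulN1r.
Qed.

End NumeratorsTwo.

(** * Pairs of numerators and their behaviour under periods *)

Section SolutionPairs.
Context {R : realType}.
Notation C := (cplx R).
Variable tau : C.
Hypothesis Htau : 0 < complex.Im tau.
Implicit Types (z w c h : C).
Notation u := (wp tau).
Notation u1 := (dwp tau).
Notation u2 := (ddwp tau).
Notation zt := (zeta tau).
Notation lat := (lattice tau).
Notation g2 := (g2 tau).
Notation g3 := (g3 tau).
Local Opaque wp zeta dwp ddwp ell eis Defs.g2 Defs.g3 quasi_period.
Variable p : C.
Hypothesis h2p : ~ lat (2 * p).
Notation P := (u p).
Notation P1 := (u1 p).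
Notation P2 := (u2 p).
Notation eta1 := (quasi_period tau 1).
Notation eta2 := (quasi_period tau 2).

Definition quasi (N1 N2 : C -> C) w ep chi := forall z, regular tau p z ->
  N1 (z + w) = ep * N1 z /\ N2 (z + w) = ep * (N2 z + chi * N1 z).

(** The last clause speaks of all periods, since [monodromy_rep] asks for a matrix along every loop,
    and the lift of a loop may end at any translate of its start. The constant kap becomes the
    Wronskian of the two solutions. *)
Definition solution_pair A (N1 N2 : C -> C) := exists N1' N2' kap,
  [/\ numerator tau p A N1 N1', numerator tau p A N2 N2', kap != 0,
   forall z, regular tau p z -> N1 z * N2' z - N1' z * N2 z = kap * (u z - P) &
   forall w, lat w -> exists ep chi, ep ^+ 2 = 1 /\ quasi N1 N2 w ep chi].

Lemma solutions_one (Y : C) :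
  (6 * Y ^+ 2 - g2 / 2) * P = 2 * Y ^+ 3 + g2 * Y / 2 + g3 -> g2 / 2 - 6 * Y ^+ 2 != 0 ->
  exists A N1 N2, [/\ solution_pair A N1 N2,
    quasi N1 N2 1 1 (2 * (eta1 + Y)) & quasi N1 N2 tau 1 (2 * (eta2 + Y * tau))].
Proof.
move=> rel kap0; exists (acc1 tau p Y), (numA tau Y), (numB tau Y).
have per w z chi : lat w -> ~ lat z -> Zeta tau 1 Y (z + w) = Zeta tau 1 Y z + chi ->
    numA tau Y (z + w) = 1 * numA tau Y z /\ numB tau Y (z + w) = 1 * (numB tau Y z + chi * numA tau Y z).
  move=> hw hz E; rewrite /numA /numB wp_per // dwp_per // E.
  by move: (u z) (u1 z) (Zeta _ _ _) => a b d; split; ring.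
split.
- exists u1, (numB' tau Y), (g2 / 2 - 6 * Y ^+ 2); split=> //.
  + exact: numA_numerator.
  + exact: numB_numerator.
  + move=> z hz; have hl := regular_notin hz; rewrite /numA /numB /numB'.
    have -> : u1 z * ((u z - Y) * Zeta tau 1 Y z + u1 z) = u1 z * (u z - Y) * Zeta tau 1 Y z + u1 z ^+ 2 by ring.
    rewrite wp_cubic // wp_ode // (_ : g3 = (6 * Y ^+ 2 - g2 / 2) * P - (2 * Y ^+ 3 + g2 * Y / 2)).
      by move: (u z) (u1 z) P g2 (Zeta _ _ _) => x b y a t; field.
    by rewrite rel; move: g2 g3 => a b; ring.
  + move=> w hw; have [chi h] := Zeta_quasi Htau 1 Y hw.
    exists 1, chi; split=> [|z hz]; first by rewrite expr1n.
    by apply: per => //; [exact: regular_notin hz|apply: h; exact: regular_notin hz].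
- move=> z hz; have hl := regular_notin hz; apply: per => //; first exact: lattice1.
  by have := Zeta_quasi1 Htau 1 Y hl; rewrite mul1r.
move=> z hz; have hl := regular_notin hz; apply: per => //; first exact: lattice_tau.
by have := Zeta_quasi2 Htau 1 Y hl; rewrite mul1r.
Qed.

Section CaseTwo.
Variable c : C.
Hypotheses (hc : ~ lat c) (h2c : lat (2 * c)).
Notation e := (u c).
Notation v := (sqrt_wp tau c).
Notation w1 := (dsqrt_wp tau c).

Let t := P - e.
Let Q := t ^+ 2 + 3 * e * t + (3 * e ^+ 2 - g2 / 4).
(** The analogue of [acc1] for N1 = v': the fraction is half the derivative of log v'^2 with respect
    to wp, at p. It involves neither al nor Y. *)
Definition acc2 := P1 * ((2 * (P - e) + 3 * e) / (2 * ((P - e) ^+ 2 + 3 * e * (P - e) + (3 * e ^+ 2 - g2 / 4)))) - P2 / (4 * P1).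

Lemma P1_sq : P1 ^+ 2 = 4 * (P - e) * ((P - e) ^+ 2 + 3 * e * (P - e) + (3 * e ^+ 2 - g2 / 4)).
Proof.
rewrite (wp_cubic Htau (lat_half h2p)); have := half_root Htau hc h2c.
move: P e g2 g3 => x a i j E.
have -> : j = 4 * a ^+ 3 - i * a by rewrite -[RHS]subr0 -E; ring.
by field.
Qed.

Definition numV := w1.
Definition numV' z : C := v z * (2 * v z ^+ 2 + 3 * e).

Lemma numV_numerator : numerator tau p acc2 numV numV'.
Proof.
exists (fun z => w1 z * (6 * v z ^+ 2 + 3 * e)) => z hz.
have hl := regular_notin hz; have h2 := hz.1; split.
- exact: dsqrt_wp_deriv.
- have d := sqrt_wp_deriv Htau hc h2c h2.
  have := cderivM d (cderivD (cderivZ 2 (cderivM d d)) (cderivC (3 * e) z)).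
  by move/cderiv_eq; apply; move: (v z) (w1 z) e => a b i; ring.
rewrite (potentialE Htau h2p hz (erefl acc2)) /numV /numV'.
have := wp_neq Htau h2p hz.2; rewrite -subr_eq0.
have := dwp_neq0 Htau h2p; rewrite -sqrf_eq0 P1_sq.
rewrite !(wp_ode Htau) ?(wp_sqrtE Htau hc h2c hl) //; last exact: lat_half.
rewrite (dwp_sqrtE Htau hc h2c h2).
have := dsqrt_wp_sq Htau hc h2c h2.
move: (v z) (w1 z) P e g2 => a b x i j E Q0 d0.
move: Q0; rewrite !mulf_eq0 !negb_or => /andP[_ Q0].
transitivity (b * ((6 * a ^+ 2 + 3 * i) * (a ^+ 2 + i - x) ^+ 2
  - a * (2 * a ^+ 2 + 3 * i) * (2 * a) * (a ^+ 2 + i - x)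
  + (3 * a ^+ 2 * b ^+ 2 - (6 * (a ^+ 2 + i) ^+ 2 - j / 2) * (a ^+ 2 + i - x) / 2))); first by field.
rewrite E; set q := _ + _ + _ in Q0 *.
have qE : j = 4 * ((x - i) ^+ 2 + 3 * i * (x - i) + 3 * i ^+ 2 - q) by rewrite /q; field.
move: qE; clearbody q => ->.
by field; rewrite Q0 d0.
Qed.

Variables al Y : C.
(** The Wronskian is kap v^2 + 2 (3 e^2 - g2 / 4) (2 Y + al e), with kap = 6 e Y + (6 e^2 - g2) al,
    whereas wp - P = v^2 + e - P. Proportionality is therefore this comparison of constant terms,
    linear in (al, Y). *)
Hypothesis relY : (6 * e * Y + (6 * e ^+ 2 - g2) * al) * (e - P) = 2 * (3 * e ^+ 2 - g2 / 4) * (2 * Y + al * e).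

Definition numW z : C := w1 z * Zeta tau al Y z + v z * (2 * al * v z ^+ 2 + (2 * Y + 4 * al * e)).
Definition numW' z : C := numV' z * Zeta tau al Y z + w1 z * (2 * Y - 2 * al * u z)
  + w1 z * (6 * al * v z ^+ 2 + (2 * Y + 4 * al * e)).

Lemma wronskian_two z : regular tau p z ->
  numV z * numW' z - numV' z * numW z = (6 * e * Y + (6 * e ^+ 2 - g2) * al) * (u z - P).
Proof.
move=> hz; have hl := regular_notin hz; have h2 := hz.1.
rewrite /numW' /numW /numV /numV' (wp_sqrtE Htau hc h2c hl).
have := dsqrt_wp_sq Htau hc h2c h2.
have -> : (6 * e * Y + (6 * e ^+ 2 - g2) * al) * (v z ^+ 2 + e - P) = (6 * e * Y + (6 * e ^+ 2 - g2) * al) * v z ^+ 2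
   + 2 * (3 * e ^+ 2 - g2 / 4) * (2 * Y + al * e) by rewrite -relY; move: (v z) e P g2 => a i x j; ring.
move: (v z) (w1 z) e g2 (Zeta _ _ _) => a b i j k E.
transitivity (b ^+ 2 * (2 * Y - 2 * al * (a ^+ 2 + i) + (6 * al * a ^+ 2 + (2 * Y + 4 * al * i)))
  - a ^+ 2 * (2 * a ^+ 2 + 3 * i) * (2 * al * a ^+ 2 + (2 * Y + 4 * al * i))); first by ring.
by rewrite E; field.
Qed.

Lemma numW_numerator : numerator tau p acc2 numW numW'.
Proof.
exists (fun z => w1 z * (6 * v z ^+ 2 + 3 * e) * Zeta tau al Y z
  + 2 * numV' z * (2 * Y - 2 * al * u z) - 2 * al * w1 z * u1 z
  + numV' z * (6 * al * v z ^+ 2 + (2 * Y + 4 * al * e)) + 12 * al * w1 z ^+ 2 * v z) => z hz.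
have hl := regular_notin hz; have h2 := hz.1.
have [N'' hN] := numV_numerator; have [d1 d2 ode] := hN z hz.
have dv := sqrt_wp_deriv Htau hc h2c h2.
have dw : cderiv w1 z (numV' z) := dsqrt_wp_deriv Htau hc h2c h2.
have dZ := Zeta_deriv Htau al Y hl.
have D1 : cderiv numW z (numW' z).
  have := cderivD (cderivM dw dZ) (cderivM dv (cderivD (cderivZ (2 * al) (cderivM dv dv)) (cderivC (2 * Y + 4 * al * e) z))).
  by move/cderiv_eq; apply; rewrite /numW'; move: (numV' z) (v z) (w1 z) e (u z) (Zeta _ _ _) => n a b i k l; ring.
have dV' : cderiv numV' z (w1 z * (6 * v z ^+ 2 + 3 * e)).
  have := cderivM dv (cderivD (cderivZ 2 (cderivM dv dv)) (cderivC (3 * e) z)).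
  by move/cderiv_eq; apply; move: (v z) (w1 z) e => a b i; ring.
have D2 : cderiv numW' z (w1 z * (6 * v z ^+ 2 + 3 * e) * Zeta tau al Y z
  + 2 * numV' z * (2 * Y - 2 * al * u z) - 2 * al * w1 z * u1 z
  + numV' z * (6 * al * v z ^+ 2 + (2 * Y + 4 * al * e)) + 12 * al * w1 z ^+ 2 * v z).
  have du := cderivB (cderivC (2 * Y) z) (cderivZ (2 * al) (wp_deriv Htau hl)).
  have d6 := cderivD (cderivZ (6 * al) (cderivM dv dv)) (cderivC (2 * Y + 4 * al * e) z).
  have := cderivD (cderivD (cderivM dV' dZ) (cderivM dw du)) (cderivM dw d6).
  move/cderiv_eq; apply.
  by move: (numV' z) (v z) (w1 z) e (u z) (u1 z) (Zeta _ _ _) => n a b i k k1 l; ring.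
split=> //.
(* differentiate the Wronskian and cancel numV, which has no zero *)
have w0 : w1 z != 0.
  apply/eqP => w0; have := dwp_neq0 Htau h2.
  by rewrite (dwp_sqrtE Htau hc h2c h2) w0 mulr0 eqxx.
have e1 := cderivB (cderivM dw D2) (cderivM dV' D1).
have e2 := cderivZ (6 * e * Y + (6 * e ^+ 2 - g2) * al) (cderivB (wp_deriv Htau hl) (cderivC P z)).
have n : \forall x \near z, (6 * e * Y + (6 * e ^+ 2 - g2) * al) * (u x - P) = w1 x * numW' x - numV' x * numW x.
  by have := regular_near Htau hz; apply: filterS => x hx; rewrite -wronskian_two.
have W2 := cderiv_unique e1 (cderiv_ext n e2); rewrite subr0 in W2.
have W := wronskian_two hz.
move: ode W W2 w0; have NE : N'' z = w1 z * (6 * v z ^+ 2 + 3 * e) := cderiv_unique d2 dV'.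
rewrite NE; move: (potential _ _ _ _) (6 * e * Y + _ * al) => V kap; rewrite /numV.
set N := w1 z; set N' := numV' z; set M := numW z; set M' := numW' z; set M'' := _ + 12 * _ * _ * _.
set L := N * (6 * v z ^+ 2 + 3 * e).
move=> ode W W2 N0; apply: (mulfI N0).
have W3 : N * M'' = L * M + kap * u1 z.
  by rewrite -W2; clearbody N N' M M' M'' L; ring.
have W1 : N * M' = N' * M + kap * (u z - P).
  by rewrite -W; clearbody N N' M M' M'' L; ring.
clearbody N N' M M' M'' L; move: (u z) (u1 z) (u2 z) P ode W1 W3 => x b b2 y ode W1 W3.
transitivity ((N * M'') * (x - y) ^+ 2 - (N * M') * b * (x - y) + N * (3 / 4 * b ^+ 2 - b2 * (x - y) / 2) * M); first by ring.
rewrite W3 W1.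
transitivity (M * (L * (x - y) ^+ 2 - N' * b * (x - y) + N * (3 / 4 * b ^+ 2 - b2 * (x - y) / 2))); first by ring.
by rewrite ode; ring.
Qed.

Lemma quasi_two w ep chi : lat w -> (forall z, ~ lat z -> v (z + w) = ep * v z) -> ep ^+ 2 = 1 ->
  (forall z, ~ lat z -> Zeta tau al Y (z + w) = Zeta tau al Y z + chi) -> quasi numV numW w ep chi.
Proof.
move=> hw hv ep2 hZ z hz; have hl := regular_notin hz.
have ep0 : ep != 0 by rewrite -sqrf_eq0 ep2 oner_eq0.
have epV : ep^-1 = ep by apply: (mulfI ep0); rewrite divff // -expr2.
have wE : w1 (z + w) = ep * w1 z.
  by rewrite /dsqrt_wp hv // dwp_per // [2 * (ep * _)]mulrCA invfM epV mulrCA.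
rewrite /numV /numW wE hv // hZ //; split=> //.
have -> : (ep * v z) ^+ 2 = v z ^+ 2 by rewrite exprMn ep2 mul1r.
by move: (w1 z) (v z) e (Zeta _ _ _) => a b i k; ring.
Qed.

End CaseTwo.

(* The pair (al, Y) is homogeneous, so that the limit case al = 0, needed for C = tau, is
   included. *)
Lemma solutions_two (c al Y ep1 ep2 : C) : ~ lat c -> lat (2 * c) ->
  (6 * u c * Y + (6 * u c ^+ 2 - g2) * al) * (u c - P) = 2 * (3 * u c ^+ 2 - g2 / 4) * (2 * Y + al * u c) ->
  6 * u c * Y + (6 * u c ^+ 2 - g2) * al != 0 -> ep1 ^+ 2 = 1 -> ep2 ^+ 2 = 1 ->
  (forall z, ~ lat z -> sqrt_wp tau c (z + 1) = ep1 * sqrt_wp tau c z) ->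
  (forall z, ~ lat z -> sqrt_wp tau c (z + tau) = ep2 * sqrt_wp tau c z) ->
  exists A N1 N2, [/\ solution_pair A N1 N2,
    quasi N1 N2 1 ep1 (2 * (al * eta1 + Y)) & quasi N1 N2 tau ep2 (2 * (al * eta2 + Y * tau))].
Proof.
move=> hc h2c rel kap0 s1 s2 h1 h2; exists (acc2 c), (numV c), (numW c al Y); split.
- exists (numV' c), (numW' c al Y), (6 * u c * Y + (6 * u c ^+ 2 - g2) * al); split=> //.
  + exact: numV_numerator.
  + exact: numW_numerator.
  + exact: wronskian_two.
  + move=> w hw; have [ep ep2' hv] := sqrt_wp_quasi Htau hc h2c hw.
    have [chi hZ] := Zeta_quasi Htau al Y hw.
    by exists ep, chi; split=> //; apply: quasi_two.
- by apply: quasi_two => //; [exact: lattice1|apply: Zeta_quasi1].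
by apply: quasi_two => //; [exact: lattice_tau|apply: Zeta_quasi2].
Qed.

End SolutionPairs.

(** * Square roots along paths *)

Section SquareRoots.
Context {R : realType}.
Notation C := (cplx R).
Implicit Types (a b z : C) (t x : R).

(** The sign is fixed so that the real part is nonnegative. On the open right half-plane this is the
    continuous principal root, characterised by [sqr_eq_Re]; it is applied to ratios near 1. *)
Definition psq a : C := if 0 <= complex.Re (sqrtC a : C) then sqrtC a else - sqrtC a.

Lemma psq_sq a : psq a ^+ 2 = a.
Proof. by rewrite /psq; case: ifP; rewrite ?sqrrN sqrtCK. Qed.

Lemma psq_Re_ge0 a : 0 <= complex.Re (psq a).
Proof. by rewrite /psq; case: ifP => // /negbT; rewrite -ltNge ReN oppr_ge0 => /ltW. Qed.

Lemma psq_Re_gt0 a : 0 < complex.Re a -> 0 < complex.Re (psq a).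
Proof.
move=> ha; rewrite lt_neqAle psq_Re_ge0 andbT; apply/eqP => E.
move: ha; rewrite -(psq_sq a) expr2 ReM -E mul0r sub0r oppr_gt0 -expr2.
by rewrite ltNge sqr_ge0.
Qed.

Lemma sqr_eq_Re a b : a ^+ 2 = b ^+ 2 -> 0 < complex.Re a -> 0 < complex.Re b -> a = b.
Proof.
move/eqP; rewrite eqf_sqr => /orP[/eqP //|/eqP ->].
rewrite ReN => h1 h2; exfalso; lra.
Qed.

Lemma psq1 : psq 1 = 1.
Proof. by apply: sqr_eq_Re; rewrite ?psq_sq ?expr1n // ?psq_Re_gt0 //= ltr01. Qed.

Lemma Re_near1 a : cmod (a - 1) < 1 -> 0 < complex.Re a.
Proof.
move=> h; have := Re_le_cmod (a - 1); rewrite ReD ReN /= ler_norml => /andP[+ _].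
by move: h; move: (cmod _) (complex.Re a) => *; lra.
Qed.

Lemma Re_near a : 0 < complex.Re a -> \forall z \near a, 0 < complex.Re z.
Proof.
move=> ha; apply/nearP; exists (complex.Re a) => // z hz.
have := Re_le_cmod (z - a); rewrite ReD ReN ler_norml => /andP[+ _].
by move: hz; move: (cmod _) (complex.Re a) (complex.Re z) => *; lra.
Qed.

Lemma psq_cont a : 0 < complex.Re a -> ccont psq a.
Proof.
move=> ha; have pa := psq_Re_gt0 ha; have /near0P [d d0 hd] := Re_near ha.
move=> e e0; exists (Num.min d (e * complex.Re (psq a))); first by rewrite lt_min d0 mulr_gt0.
move=> h; rewrite lt_min => /andP[/hd /psq_Re_gt0 ph he].
set s := psq (a + h) + psq a.
have hs : complex.Re (psq a) < cmod s.
  apply: lt_le_trans (le_trans (ler_norm _) (Re_le_cmod s)); rewrite /s ReD; lra.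
have s0 : 0 < cmod s := lt_trans pa hs.
have E : (psq (a + h) - psq a) * s = h.
  rewrite /s -subr_sqr !psq_sq; ring.
rewrite -(ltr_pM2r s0) -cmodM E; apply: lt_trans he _.
by rewrite ltr_pM2l.
Qed.

Lemma Re_inv a : 0 < complex.Re a -> 0 < complex.Re (a^-1).
Proof.
case: a => x y /= x0; rewrite /GRing.inv /=.
by apply: divr_gt0 => //; rewrite ltr_pwDl ?sqr_ge0 // exprn_gt0.
Qed.

Lemma Re_ratio a b : cmod a <= 4^-1 -> cmod b <= 4^-1 -> 0 < complex.Re ((1 + a) / (1 + b)).
Proof.
move=> ha hb; have hb1 : 3 / 4 <= cmod (1 + b).
  by have := cmod_lb 1 b; rewrite cmod1; move: hb; move: (cmod _) (cmod _) => *; lra.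
have b0 : 1 + b != 0 by rewrite -cmod_gt0; move: hb1; move: (cmod _) => *; lra.
apply: Re_near1; have -> : (1 + a) / (1 + b) - 1 = (a - b) / (1 + b) by field.
rewrite cmodM cmodV ltr_pdivrMr ?cmod_gt0 // mul1r; apply: le_lt_trans (cmodB _ _) _.
by move: ha hb hb1; move: (cmod a) (cmod b) (cmod _) => *; lra.
Qed.

Definition pcont (f : R -> C) := forall t, 0 <= t <= 1 -> forall e : R, 0 < e ->
  exists2 d : R, 0 < d & forall s, 0 <= s <= 1 -> `|s - t| < d -> cmod (f s - f t) < e.

Lemma within_pcont (l : R -> C) : {within `[0, 1], continuous l} -> pcont l.
Proof.
move=> H t t01 e e0.
have tA : `[0, 1]%classic t by rewrite /= in_itv.
have /subspace_continuousP/(_ t tA)/cvgrPdist_lt := H =>  /(_ (cr e)).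
rewrite -cr0 ltr_cr => /(_ e0); rewrite /prop_near1 /within /= => /nbhs_ballP [d /= d0 hd].
exists d => // s s01 hs; have := hd s; rewrite /ball /= distrC => /(_ hs).
by rewrite in_itv /= => /(_ s01); rewrite cmodE ltr_cr cmodBC.
Qed.

(** Extends a path on [0, 1] to all of [R] by its end values, so that extreme and intermediate value
    theorems apply to globally continuous functions. *)
Definition clamp x : R := Num.max 0 (Num.min x 1).

Lemma clamp01 x : 0 <= clamp x <= 1.
Proof. by rewrite /clamp le_max lexx /= ge_max ler01 /= ge_min lexx orbT. Qed.

Lemma clampE x : 0 <= x <= 1 -> clamp x = x.
Proof. by move=> /andP[a b]; rewrite /clamp min_l // max_r. Qed.

Lemma clamp_lip x y : `|clamp x - clamp y| <= `|x - y|.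
Proof.
rewrite /clamp; have [a|a] := leP x 1; have [b|b] := leP y 1;
have [c|c] := leP 0 x; have [d|d] := leP 0 y;
rewrite ?(max_r c) ?(max_r d) ?(max_l (ltW c)) ?(max_l (ltW d)) ?(max_r ler01) ?subrr ?normr0 ?normr_ge0 //;
rewrite ?ler_norml ?ler_normr; try by apply/orP; (left; lra) || (right; lra).
all: try lra.
all: have [h|h] := leP 0 (x - y); rewrite ?(ger0_norm h) ?(ltr0_norm h) ?ler_norml; try lra.
all: try (apply/andP; split; lra).
Qed.

Lemma pcont_bound f : pcont f -> exists K : R, forall t, 0 <= t <= 1 -> cmod (f t) <= K.
Proof.
move=> H; pose g x := cmod (f (clamp x)).
have gc : continuous g.
  move=> x; apply/cvgrPdist_lt => e e0; have [d d0 hd] := H _ (clamp01 x) e e0.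
  apply/nbhs_ballP; exists d => //= y; rewrite /ball /= => hy.
  apply: le_lt_trans (cmod_dist _ _) _; rewrite cmodBC; apply: hd; first exact: clamp01.
  by apply: le_lt_trans (clamp_lip _ _) _; rewrite distrC.
have [|c _ hc] := @EVT_max R g 0 1 ler01; first exact: continuous_subspaceT.
exists (g c) => t t01; have := hc t; rewrite /g (clampE t01); apply.
by rewrite in_itv.
Qed.

Lemma pcont_comp (g : C -> C) f : pcont f -> (forall t, 0 <= t <= 1 -> ccont g (f t)) ->
  pcont (fun t => g (f t)).
Proof.
move=> hf hg t t01 e e0; have [r r0 hr] := hg t t01 e e0; have [d d0 hd] := hf t t01 r r0.
exists d => // s s01 /(hd s s01) /hr.
by have -> : f t + (f s - f t) = f s by ring.
Qed.

Lemma pcontM f g : pcont f -> pcont g -> pcont (fun t => f t * g t).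
Proof.
move=> hf hg t t01 e e0.
set K := 1 + cmod (f t) + cmod (g t).
have Kf := cmod_ge0 (f t); have Kg := cmod_ge0 (g t).
have K1 : 1 <= K by rewrite /K; lra.
set d := Num.min 1 (e / (2 * K)).
have d0 : 0 < d by rewrite lt_min ltr01 divr_gt0 //; lra.
have d1 : d <= 1 by rewrite ge_min lexx.
have d2 : 2 * K * d <= e.
  by rewrite mulrC -ler_pdivlMr ?ge_min ?lexx ?orbT //; lra.
have [r r0 h] := hf t t01 _ d0; have [s s0 k] := hg t t01 _ d0.
exists (Num.min r s); first by rewrite lt_min r0.
move=> v v01; rewrite lt_min => /andP[/(h v v01) tr /(k v v01) ts].
set x := f v - f t in tr *; set y := g v - g t in ts *.
have -> : f v * g v - (f t * g t) = x * y + x * g t + f t * y by rewrite /x /y; ring.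
apply: le_lt_trans (cmodD _ _) _; rewrite cmodM.
apply: le_lt_trans (lerD (cmodD _ _) (lexx _)) _; rewrite !cmodM.
have x0 := cmod_ge0 x; have y0 := cmod_ge0 y.
clearbody d; move: tr ts d2 x0 y0 K1 Kf Kg d0 d1; rewrite /K.
move: (cmod x) (cmod y) (cmod (f t)) (cmod (g t)) => X Y F G *.
have h1 : X * Y <= d * 1 by rewrite ler_pM //; lra.
have h2 : X * G <= d * G by rewrite ler_wpM2r // ltW.
have h3 : F * Y <= F * d by rewrite ler_wpM2l // ltW.
have h4 : 0 < d * (1 + F + G) by rewrite mulr_gt0 //; lra.
lra.
Qed.

Lemma pcontC (c : C) : pcont (fun=> c).
Proof. by move=> t _ e e0; exists 1 => // s _ _; rewrite subrr cmod0. Qed.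

Lemma ccontV z : z != 0 -> ccont (fun x : C => x^-1) z.
Proof. by move=> z0; apply: cderiv_cont (cderivV z0 (cderivI z)). Qed.

Lemma pcontV f : pcont f -> (forall t, 0 <= t <= 1 -> f t != 0) -> pcont (fun t => (f t)^-1).
Proof. by move=> hf f0; apply: (@pcont_comp (fun x : C => x^-1) f hf) => t /f0; apply: ccontV. Qed.

(** The proposition [close] selects between two uses: [False] for the mere existence of a continuous
    root along a path, [True] when the root must also return to 1. *)
Definition has_sqrt (close : Prop) f := exists s : R -> C,
  [/\ pcont s, forall t, 0 <= t <= 1 -> s t ^+ 2 = f t, s 0 = 1 & close -> s 1 = 1].

Definition unit_path (close : Prop) f :=
  [/\ pcont f, forall t, 0 <= t <= 1 -> f t != 0, f 0 = 1 & close -> f 1 = 1].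

(** A root of g times the principal root of f / g is a root of f; where both paths equal 1 the
    correcting factor is 1, so end values are preserved. *)
Lemma has_sqrt_transfer close f g : unit_path close f -> unit_path close g ->
  (forall t, 0 <= t <= 1 -> 0 < complex.Re (f t / g t)) -> has_sqrt close g -> has_sqrt close f.
Proof.
move=> [cf f0 f1 fe] [cg g0 g1 ge] H [s [cs sE s0 s1]].
have c : pcont (fun t => f t / g t) by apply: pcontM => //; apply: pcontV.
exists (fun t => s t * psq (f t / g t)); split.
- apply: pcontM => //; apply: pcont_comp c _ => t /H; exact: psq_cont.
- by move=> t t01; rewrite exprMn sE // psq_sq mulrC divfK // g0.
- by rewrite s0 f1 g1 divr1 psq1 mulr1.
- by move=> h; rewrite s1 // fe // ge // divr1 psq1 mulr1.
Qed.

(** By transfer in both directions, the set of s whose path has a root is open and closed: its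
    indicator is continuous and would take the value 1/2 between s = 0 and s = 1. *)
Lemma has_sqrt_homotopy close (c : R -> R -> C) :
  (forall s, 0 <= s <= 1 -> unit_path close (c s)) ->
  (forall s0, 0 <= s0 <= 1 -> exists2 d : R, 0 < d & forall s, 0 <= s <= 1 -> `|s - s0| < d ->
     forall t, 0 <= t <= 1 -> 0 < complex.Re (c s t / c s0 t)) ->
  has_sqrt close (c 0) -> has_sqrt close (c 1).
Proof.
move=> cu cl h0; apply: contrapT => h1.
pose ind x : R := if pselect (has_sqrt close (c (clamp x))) then 1 else 0.
have indc : continuous ind.
  move=> x; apply/cvgrPdist_lt => e e0; have [d d0 hd] := cl _ (clamp01 x).
  apply/nbhs_ballP; exists d => //= y; rewrite /ball /= distrC => hy.
  suff -> : ind y = ind x by rewrite subrr normr0.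
  have hxy : `|clamp y - clamp x| < d by apply: le_lt_trans (clamp_lip _ _) _.
  have hr := hd _ (clamp01 y) hxy.
  have e1 := @has_sqrt_transfer close _ _ (cu _ (clamp01 y)) (cu _ (clamp01 x)) hr.
  have hr' t : 0 <= t <= 1 -> 0 < complex.Re (c (clamp x) t / c (clamp y) t).
    by move=> /hr /Re_inv; rewrite invf_div.
  have e2 := @has_sqrt_transfer close _ _ (cu _ (clamp01 x)) (cu _ (clamp01 y)) hr'.
  by rewrite /ind; case: pselect => a; case: pselect => b //; [case: b; apply: e2|case: a; apply: e1].
have i0 : ind 0 = 1.
  by rewrite /ind clampE ?lexx ?ler01 //; case: pselect.
have i1 : ind 1 = 0.
  by rewrite /ind clampE ?lexx ?ler01 //; case: pselect.
have [||x _] := @IVT _ ind 0 1 (2^-1) ler01.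
- exact: continuous_subspaceT.
- by rewrite i0 i1 min_r ?max_l ?ler01 //; lra.
by rewrite /ind; case: pselect => ? /=; lra.
Qed.

Lemma min_lip (s t t' : R) : `|Num.min t' s - Num.min t s| <= `|t' - t|.
Proof.
have [a|a] := leP t' s; have [b|b] := leP t s; rewrite ?subrr ?normr0 ?normr_ge0 //;
by have [h|h] := leP 0 (t' - t); rewrite ler_norml ?(ger0_norm h) ?(ltr0_norm h); lra.
Qed.

(** The homotopy f (min t s) contracts the path to its starting value 1. *)
Lemma has_sqrt_path f : unit_path False f -> has_sqrt False f.
Proof.
move=> [cf f0 f1 _].
have min01 s t : 0 <= s <= 1 -> 0 <= t <= 1 -> 0 <= Num.min t s <= 1.
  by move=> /andP[a b] /andP[c d]; rewrite le_min a c /= ge_min b orbT.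
pose c s t := f (Num.min t s).
have [|||s [cs sE s0 _]] := @has_sqrt_homotopy False c.
- move=> s s01; split=> //.
  + move=> t t01 e e0; have [d d0 hd] := cf _ (min01 _ _ s01 t01) e e0.
    exists d => // t' t'01 ht; apply: hd; first exact: min01.
    by apply: le_lt_trans ht; apply: min_lip.
  + by move=> t t01; apply: f0; apply: min01.
  + by rewrite /c min_l //; case/andP: s01.
- move=> s0 s001; have m0 : 0 < cmod (f s0) by rewrite cmod_gt0 f0.
  have m3 : 0 < cmod (f s0) / 4 by rewrite divr_gt0.
  have [d d0 hd] := cf _ s001 _ m3; exists d => // s s01 hs t t01.
  have close x : 0 <= x <= 1 -> `|x - s0| < d -> cmod (f x / f s0 - 1) <= 4^-1.
    move=> x01 hx; have -> : f x / f s0 - 1 = (f x - f s0) / f s0 by field; apply: f0.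
    by rewrite cmodM cmodV ler_pdivrMr // mulrC ltW // hd.
  (* Either the two truncated times coincide, or both lie within d of s0, where f is close to f
     s0. *)
  have [E|[h1 h2]] : Num.min t s = Num.min t s0 \/ (`|Num.min t s - s0| < d /\ `|Num.min t s0 - s0| < d).
    have [a|a] := leP t s; have [b|b] := leP t s0; [by left| | |by right; rewrite subrr normr0].
      right; rewrite subrr normr0; split=> //.
      by move: hs; rewrite !ltr_norml => /andP[]; lra.
    by right; split=> //; move: hs; rewrite !ltr_norml => /andP[]; lra.
  + rewrite /c E divff ?ltr01 //; apply: f0; exact: min01.
  rewrite /c; have m01 := min01 _ _ s01 t01; have m02 := min01 _ _ s001 t01.
  have -> : f (Num.min t s) / f (Num.min t s0) =
     (1 + (f (Num.min t s) / f s0 - 1)) / (1 + (f (Num.min t s0) / f s0 - 1)).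
    rewrite ![1 + (_ - _)]addrC !subrK; field; rewrite !f0 //.
  by apply: Re_ratio; apply: close.
- exists (fun=> 1); split=> //; first exact: pcontC.
  by move=> t /andP[t0 _]; rewrite /c min_r // f1 expr1n.
by exists s; split=> // t t01; rewrite sE // /c min_l //; case/andP: t01.
Qed.

End SquareRoots.

(** * The sign of the square root along the cycles *)

Section SignOfRoot.
Context {R : realType}.
Notation C := (cplx R).
Variable tau : C.
Hypothesis Htau : 0 < complex.Im tau.
Implicit Types (z w c h : C) (s t : R).
Notation u := (wp tau).
Notation lat := (lattice tau).
Local Opaque wp zeta dwp ddwp ell eis.
Variable p : C.
Hypothesis h2p : ~ lat (2 * p).

Lemma wp_neq_any z q : ~ lat z -> ~ lat q -> ~ lat (z - q) -> ~ lat (z + q) -> u z != u q.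
Proof.
move=> hz hq hm hp; have [h2|h2] := pselect (lat (2 * q)).
  exact: (half_wp_neq Htau hq h2 hz hm).
by apply: (wp_neq Htau h2); split.
Qed.

Lemma wp_path (l : R -> C) : pcont l -> (forall t, 0 <= t <= 1 -> ~ lat (l t)) -> pcont (fun t => u (l t)).
Proof. by move=> cl hl; apply: (@pcont_comp _ u l cl) => t /hl /(wp_deriv Htau) /cderiv_cont. Qed.

(* The branch point p is moved to 0 along the segment, which the loop avoids;
   in the limit the quotient is constant. *)
Lemma segment_sign (l : R -> C) : pcont l ->
  (forall t, 0 <= t <= 1 -> ~ lat (l t)) -> lat (l 1 - l 0) ->
  (forall t s, 0 <= t <= 1 -> 0 <= s <= 1 -> ~ lat (l t - cr s * p) /\ ~ lat (l t + cr s * p)) ->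
  has_sqrt True (fun t => (u (l t) - u p) / (u (l 0) - u p)).
Proof.
move=> cl hl hw hseg.
have I0 : 0 <= (0 : R) <= 1 by rewrite lexx ler01.
have I1 : 0 <= (1 : R) <= 1 by rewrite lexx ler01.
pose q s := cr s * p.
(* When q s is a lattice point, wp (q s) is infinite and the quotient has limit 1, the value
   assigned here; this happens at s = 0. *)
pose c s t : C := if pselect (lat (q s)) then 1 else (u (l t) - u (q s)) / (u (l 0) - u (q s)).
have ne s t : 0 <= s <= 1 -> 0 <= t <= 1 -> ~ lat (q s) -> u (l t) - u (q s) != 0.
  move=> hs ht hq; rewrite subr_eq0; have [a b] := hseg t s ht hs.
  by apply: wp_neq_any => //; apply: hl.
have cu : pcont (fun t => u (l t)) by apply: wp_path.
have u01 : u (l 1) = u (l 0).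
  have -> : l 1 = l 0 + (l 1 - l 0) by ring.
  by rewrite wp_per //; apply: hl.
have c1E t : c 1 t = (u (l t) - u p) / (u (l 0) - u p).
  rewrite /c /q cr1 mul1r; case: pselect => // hp.
  by case: (lat_half h2p).
have c0E t : c 0 t = 1.
  rewrite /c /q cr0 mul0r; case: pselect => // h; case: h; exact: lattice0.
suff [s [cs sE s0 s1]] : has_sqrt True (c 1).
  by exists s; split=> // t ht; rewrite sE // c1E.
apply: has_sqrt_homotopy.
- move=> s hs; rewrite /c; case: pselect => hq.
    by split=> //; exact: pcontC.
  split.
  + apply: pcontM; last exact: pcontC.
    apply: (@pcont_comp _ (fun x => x - u (q s)) _ cu) => t _.
    by apply: ccontD; [exact: ccontI|exact: ccontC].
  + by move=> t ht; rewrite mulf_neq0 ?invr_eq0 ?ne.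
  + by rewrite divff // ne.
  + by rewrite u01 divff // ne.
- move=> s0 hs0; rewrite /c; have K0 : 0 < 1 + cmod p by have := cmod_ge0 p; lra.
  have qd s : q s = q s0 + cr (s - s0) * p by rewrite /q crB; ring.
  have small (d : R) s : 0 < d -> `|s - s0| < d / (1 + cmod p) -> cmod (cr (s - s0) * p) < d.
    move=> d0; rewrite ltr_pdivlMr // cmodM cmod_cr => h; apply: le_lt_trans h.
    by rewrite ler_wpM2l //; lra.
  case: pselect => hq0.
    (* q s0 is a lattice point, hence a pole of wp *)
    have [B hB] := pcont_bound cu.
    (* The factor 4 makes |wp (l t) / wp (q s)| at most 1/4, the margin asked for by [Re_ratio]. *)
    have /nearP [d d0 hd] := wp_large Htau (4 * B).
    exists (d / (1 + cmod p)) => [|s hs /(small d s d0) hsd t ht]; first exact: divr_gt0.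
    case: pselect => hq; first by rewrite divr1 ltr01.
    set h := cr (s - s0) * p in hsd.
    have qh : q s = h + q s0 by rewrite qd addrC.
    have hh : ~ lat h by move=> hh; apply: hq; rewrite qh; apply: latticeD.
    have h0 : h != 0 by apply/eqP => E; apply: hh; rewrite E; apply: lattice0.
    have := hd h; rewrite subr0 => /(_ hsd h0).
    have -> : u h = u (q s) by rewrite qh wp_per.
    move=> big; have B0 : 0 <= B := le_trans (cmod_ge0 _) (hB 0 I0).
    have U0 : u (q s) != 0 by rewrite -cmod_gt0; apply: le_lt_trans big; rewrite mulr_ge0.
    rewrite divr1; have n0 := ne s 0 hs I0 hq.
    have bd x : 0 <= x <= 1 -> cmod (- (u (l x) / u (q s))) <= 4^-1.
      move=> hx; rewrite cmodN cmodM cmodV ler_pdivrMr ?cmod_gt0 //.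
      by apply: le_trans (hB x hx) _; move: big; move: (cmod _) => y; lra.
    have -> : (u (l t) - u (q s)) / (u (l 0) - u (q s)) =
       (1 + - (u (l t) / u (q s))) / (1 + - (u (l 0) / u (q s))).
      move: (u (l t)) (u (l 0)) (u (q s)) U0 n0 => x y z z0 n0; field.
      by rewrite z0 /= n0 -opprB oppr_eq0 n0.
    by apply: Re_ratio; apply: bd.
  (* A uniform distance from wp (q s0) along the compact path, obtained by bounding the
     reciprocal. *)
  have [m m0 hm] : exists2 m : R, 0 < m & forall t, 0 <= t <= 1 -> m <= cmod (u (l t) - u (q s0)).
    have c' : pcont (fun t => (u (l t) - u (q s0))^-1).
      apply: pcontV; last by move=> t ht; apply: ne.
      apply: (@pcont_comp _ (fun x => x - u (q s0)) _ cu) => t _.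
      by apply: ccontD; [exact: ccontI|exact: ccontC].
    have [B hB] := pcont_bound c'.
    have Bp : 0 < B.
      by apply: lt_le_trans (hB 0 I0); rewrite cmod_gt0 invr_eq0 ne.
    exists B^-1 => [|t ht]; first by rewrite invr_gt0.
    have := hB t ht; rewrite cmodV => h; have np : 0 < cmod (u (l t) - u (q s0)) by rewrite cmod_gt0 ne.
    by rewrite -[leRHS]invrK lef_pV2 // posrE invr_gt0.
  have m4 : 0 < m / 4 by rewrite divr_gt0.
  have [d1 d10 h1] := cderiv_cont (wp_deriv Htau hq0) m4.
  have /near0P [d2 d20 h2] := notin_near Htau hq0.
  exists (Num.min d1 d2 / (1 + cmod p)); first by rewrite divr_gt0 // lt_min d10.
  have dd : 0 < Num.min d1 d2 by rewrite lt_min d10.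
  move=> s hs /(small _ s dd); rewrite lt_min => /andP[a b] t ht.
  have hq : ~ lat (q s) by rewrite qd; apply: h2.
  case: pselect => // ? /=; have := h1 _ a; rewrite -qd => hU.
  have bd x : 0 <= x <= 1 -> cmod ((u (q s0) - u (q s)) / (u (l x) - u (q s0))) <= 4^-1.
    move=> hx; rewrite cmodM cmodV ler_pdivrMr ?cmod_gt0 ?ne // cmodBC.
    have := hm x hx; move: hU; move: (cmod _) (cmod _) => *; lra.
  have n1 := ne s 0 hs I0 hq; have n2 := ne s0 0 hs0 I0 hq0; have n3 := ne s0 t hs0 ht hq0.
  have -> : (u (l t) - u (q s)) / (u (l 0) - u (q s)) / ((u (l t) - u (q s0)) / (u (l 0) - u (q s0))) =
     (1 + (u (q s0) - u (q s)) / (u (l t) - u (q s0))) / (1 + (u (q s0) - u (q s)) / (u (l 0) - u (q s0))).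
    move: (u (l t)) (u (l 0)) (u (q s)) (u (q s0)) n1 n2 n3 => x y a' b' n1 n2 n3; field.
    by rewrite n2 n3 addrA subrK n1.
  by apply: Re_ratio; apply: bd.
exists (fun=> 1); split=> //; first exact: pcontC.
by move=> t _; rewrite c0E expr1n.
Qed.

Lemma path_root (l : R -> C) : pcont l ->
  (forall t, 0 <= t <= 1 -> ~ lat (l t) /\ u (l t) != u p) ->
  has_sqrt False (fun t => (u (l t) - u p) / (u (l 0) - u p)).
Proof.
move=> cl hl; have I0 : 0 <= (0 : R) <= 1 by rewrite lexx ler01.
have ne t : 0 <= t <= 1 -> u (l t) - u p != 0 by move=> /hl [_]; rewrite subr_eq0.
apply: has_sqrt_path; split=> //.
- apply: pcontM; last exact: pcontC.
  have cu : pcont (fun t => u (l t)) by apply: wp_path => // t /hl [].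
  apply: (@pcont_comp _ (fun x => x - u p) _ cu) => t _.
  by apply: ccontD; [exact: ccontI|exact: ccontC].
- by move=> t ht; rewrite mulf_neq0 ?invr_eq0 ?ne.
- by rewrite divff // ne.
Qed.

End SignOfRoot.

(** * Analytic continuation and monodromy *)

Section Branches.
Context {R : realType}.
Notation C := (cplx R).
Variable tau : C.
Hypothesis Htau : 0 < complex.Im tau.
Implicit Types (z w c h : C) (s t : R).
Notation u := (wp tau).
Notation u1 := (dwp tau).
Notation lat := (lattice tau).
Local Opaque wp zeta dwp ddwp ell eis.

Lemma torsion2P z : lat (2 * z) -> torsion2 tau z.
Proof.
case=> m [n E].
have [m' [a [Em a1]]] : exists m' (a : bool), m = m' + m' + a%:Z /\ true.
  exists (m %/ 2)%Z, ((m %% 2)%Z == 1); split=> //.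
  by case: eqP => /=; lia.
have [n' [b [En _]]] : exists n' (b : bool), n = n' + n' + b%:Z /\ true.
  exists (n %/ 2)%Z, ((n %% 2)%Z == 1); split=> //.
  by case: eqP => /=; lia.
(* The parities a and b of the two coordinates of 2 z encode the index, as [omega tau (a + 2 b)] is
   a + b tau. *)
exists (a + b.*2)%N; first by case: (a) (b) => [] [].
exists m', n'; have -> : z = (2 * z) / 2 by field.
rewrite E Em En !intrD /omega.
by case: (a) (b) => [] [] /=; field.
Qed.

Variable p : C.
Hypothesis h2p : ~ lat (2 * p).
Notation P := (u p).

Lemma nonsingular_regular z : ~ singular_points tau p z -> regular tau p z.
Proof.
move=> h; have h2 : ~ lat (2 * z) by move=> /torsion2P hz; apply: h; left.
split=> //; split; first exact: lat_half.
  by move=> hz; apply: h; right; left.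
by move=> hz; apply: h; right; right.
Qed.

Lemma regular_neq z : regular tau p z -> u z - P != 0.
Proof. by case=> _ gz; rewrite subr_eq0 (wp_neq Htau h2p gz). Qed.

(* The square root of wp - P near a point where wp - P = b, with value s there. *)
Definition root_near (s b : C) z : C := s * psq ((u z - P) / b).

Lemma root_near_sq (s b : C) z : s ^+ 2 = b -> b != 0 -> root_near s b z ^+ 2 = u z - P.
Proof. by move=> sb b0; rewrite exprMn psq_sq sb mulrC divfK. Qed.

Lemma near_base z : regular tau p z ->
  \forall x \near z, regular tau p x /\ 0 < complex.Re ((u x - P) / (u z - P)).
Proof.
move=> hz; have hl := regular_notin hz; have n0 := regular_neq hz.
have d := cderivM (cderivB (wp_deriv Htau hl) (cderivC P z)) (cderivC (u z - P)^-1 z).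
have a : \forall y \near ((u z - P) / (u z - P)), 0 < complex.Re y.
  by apply: Re_near; rewrite divff // ltr01.
have := near_ccont (cderiv_cont d) a; have := regular_near Htau hz.
by apply: filterS2 => x.
Qed.

Lemma root_near_deriv (s b : C) z : s ^+ 2 = b -> b != 0 -> regular tau p z ->
  0 < complex.Re ((u z - P) / b) -> cderiv (root_near s b) z (u1 z / (2 * root_near s b z)).
Proof.
move=> sb b0 hz hR; have hl := regular_notin hz.
have d := cderivB (wp_deriv Htau hl) (cderivC P z); rewrite subr0 in d.
have d' := cderivM d (cderivC b^-1 z).
apply: cderiv_sqrt d.
- apply: ccontM; first exact: ccontC.
  exact: (@ccont_comp _ (@psq R) (fun x => (u x - P) / b) z (cderiv_cont d') (psq_cont hR)).
- by rewrite -sqrf_eq0 root_near_sq // regular_neq.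
by apply: filterE => x; apply: root_near_sq.
Qed.

Definition branch (s b : C) (N : C -> C) z : C := N z / root_near s b z.

Lemma pcont_Re (f : R -> C) : pcont f -> (forall t, 0 <= t <= 1 -> f t != 0) ->
  forall t, 0 <= t <= 1 -> \forall s \near t, 0 <= s <= 1 -> 0 < complex.Re (f s / f t).
Proof.
move=> cf f0 t ht; have e0 : 0 < cmod (f t) by rewrite cmod_gt0 f0.
have [d d0 hd] := cf t ht _ e0; apply/nbhs_ballP; exists d => //= s.
rewrite /ball /= distrC => hs s01; apply: Re_near1.
have -> : f s / f t - 1 = (f s - f t) / f t by field; apply: f0.
by rewrite cmodM cmodV ltr_pdivrMr // mul1r; apply: hd.
Qed.

(** The numerator is single-valued, so only the root is continued: the germ at l t uses the local
    root whose value at l t is s0 times sg t. At the end point sg 1 squares to 1, so dividing by it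
    is multiplying by it. *)
Lemma continuation_branch (l sg : R -> C) (s0 w ep chi : C) (N N1 N' : C -> C) :
  pcont l -> (forall t, 0 <= t <= 1 -> regular tau p (l t)) -> l 1 = l 0 + w -> lat w ->
  s0 ^+ 2 = u (l 0) - P -> pcont sg -> sg 0 = 1 ->
  (forall t, 0 <= t <= 1 -> sg t ^+ 2 = (u (l t) - P) / (u (l 0) - P)) ->
  (forall z, regular tau p z -> cderiv N z (N' z)) ->
  (forall z, regular tau p z -> N (z + w) = ep * (N z + chi * N1 z)) ->
  continuation l (branch s0 (u (l 0) - P) N)
    (fun z => sg 1 * ep * (branch s0 (u (l 0) - P) N (z - w) +
                           chi * branch s0 (u (l 0) - P) N1 (z - w))).
Proof.
move=> cl hl lw hw s0E csg sg0 sgE dN qN.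
have I0 : 0 <= (0 : R) <= 1 by rewrite lexx ler01.
have I1 : 0 <= (1 : R) <= 1 by rewrite lexx ler01.
have ne t : 0 <= t <= 1 -> u (l t) - P != 0 by move=> ht; apply: regular_neq; apply: hl.
have sE t : 0 <= t <= 1 -> (s0 * sg t) ^+ 2 = u (l t) - P.
  by move=> ht; rewrite exprMn s0E sgE // mulrC divfK // ne.
have sg_neq t : 0 <= t <= 1 -> sg t != 0.
  by move=> ht; rewrite -sqrf_eq0 sgE // mulf_neq0 ?invr_eq0 ?ne.
exists (fun t => branch (s0 * sg t) (u (l t) - P) N); split.
- move=> t ht; have := near_base (hl t ht); apply: filterS => z [hz hR].
  have d := root_near_deriv (sE t ht) (ne t ht) hz hR.
  have n0 : root_near (s0 * sg t) (u (l t) - P) z != 0.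
    by rewrite -sqrf_eq0 root_near_sq ?sE ?ne // regular_neq.
  have := cderiv_div n0 (dN z hz) d.
  by move=> /is_deriveP [].
- by rewrite sg0 mulr1; apply: filterE.
- have hwl : u (l 1) = u (l 0) by rewrite lw wp_per //; apply: regular_notin; apply: hl.
  have sg1 : (sg 1) ^+ 2 = 1 by rewrite sgE // hwl divff // ne.
  have := near_base (hl 1 I1); apply: filterS => z [hz hR].
  have hzw : regular tau p (z - w).
    by apply/(regular_per p (z - w) hw); rewrite subrK.
  have uE : u (z - w) = u z by rewrite -[in RHS](subrK w z) (wp_per Htau (regular_notin hzw) hw).
  have NE := qN _ hzw; rewrite subrK in NE.
  have n0 : root_near s0 (u (l 0) - P) z != 0.
    by rewrite -sqrf_eq0 root_near_sq ?s0E ?ne // regular_neq.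
  have rE : root_near (s0 * sg 1) (u (l 0) - P) z = sg 1 * root_near s0 (u (l 0) - P) z.
    by rewrite /root_near mulrA (mulrC s0).
  rewrite /branch hwl NE rE /root_near uE -/(root_near s0 (u (l 0) - P) z).
  have g0 := sg_neq 1 I1.
  have gV : (sg 1)^-1 = sg 1 by apply: (mulfI g0); rewrite divff // -expr2.
  rewrite invfM gV; move: (root_near _ _ _) n0 (N _) (N1 _) (sg 1) => r r0 a b g; field.
  exact: r0.
move=> t ht; have cd : pcont (fun t => u (l t) - P).
  apply: (@pcont_comp _ (fun x => x - P) (fun t => u (l t))); last first.
    by move=> *; apply: ccontD; [exact: ccontI|exact: ccontC].
  by apply: (wp_path Htau) => // x hx; apply: regular_notin; apply: hl.
have := pcont_Re csg sg_neq ht; have := pcont_Re cd ne ht.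
apply: filterS2 => s ha hb hs; have {ha} ha := ha hs; have {hb} hb := hb hs.
have hz := hl s hs; have hls := regular_notin hz.
have dd b : ccont (fun x => (u x - P) / b) (l s).
  exact: cderiv_cont (cderivM (cderivB (wp_deriv Htau hls) (cderivC P _)) (cderivC b^-1 _)).
have Rt : \forall z \near l s, 0 < complex.Re ((u z - P) / (u (l t) - P)).
  by apply: (near_ccont (dd _) (P := fun x => 0 < complex.Re x)); apply: Re_near; apply: ha.
have one : (u (l s) - P) / (u (l s) - P) = 1 by rewrite divff // ne.
have cB : ccont (fun z => sg s / sg t * psq ((u z - P) / (u (l s) - P))) (l s).
  apply: ccontM; first exact: ccontC.
  apply: (@ccont_comp _ (@psq R) (fun z => (u z - P) / (u (l s) - P))) => //.
  by apply: psq_cont; rewrite one ltr01.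
have RB : \forall z \near l s, 0 < complex.Re (sg s / sg t * psq ((u z - P) / (u (l s) - P))).
  by apply: (near_ccont cB (P := fun x => 0 < complex.Re x)); apply: Re_near; rewrite one psq1 mulr1.
apply: filterS2 Rt RB => z /psq_Re_gt0 r1 r2.
(* Both roots have the same square and positive real part near l s, so they agree there and the
   neighbouring germs match. *)
suff E : psq ((u z - P) / (u (l t) - P)) = sg s / sg t * psq ((u z - P) / (u (l s) - P)).
  rewrite /branch /root_near E; congr (_ / _).
  have := sg_neq t ht; move: (psq _) (sg t) (sg s) => a b c b0; field.
  exact: b0.
apply: sqr_eq_Re => //; rewrite exprMn !psq_sq expr_div_n !sgE //.
have := ne t ht; have := ne s hs; have := ne 0 I0.
move: (u z) (u (l t)) (u (l s)) (u (l 0)) P => x y x' y' P n1 n2 n3; field.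
by rewrite n1 n2 n3.
Qed.

End Branches.

(** * Local bases from the Wronskian *)

Section LocalBasis.
Context {R : realType}.
Notation C := (cplx R).
Variable tau : C.
Hypothesis Htau : 0 < complex.Im tau.
Implicit Types (z w c h : C).
Notation u := (wp tau).
Notation u1 := (dwp tau).
Notation u2 := (ddwp tau).
Notation lat := (lattice tau).
Local Opaque wp zeta dwp ddwp ell eis.
Variables p A : C.
Notation P := (u p).
Notation V := (potential tau p A).

Lemma cderiv_derive1 (f : C -> C) z (d : C) : cderiv f z d -> derivable f z 1 /\ derive1 f z = d.
Proof. by move=> /is_deriveP [? ?]; rewrite derive1E. Qed.

Lemma derive1_cderiv (f : C -> C) z : derivable f z 1 -> cderiv f z (derive1 f z).
Proof. by move=> h; apply/is_deriveP; rewrite derive1E; split. Qed.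

Lemma local_solutionP q0 (y dy : C -> C) :
  (\forall z \near q0, cderiv y z (dy z) /\ cderiv dy z (V z * y z)) -> local_solution tau p A q0 y.
Proof.
move=> H; have := near_join H; apply: filterS => z hz.
have [a b] := near_at hz; have [da _] := cderiv_derive1 a.
have b' : cderiv (derive1 y) z (V z * y z).
  apply: cderiv_ext b; apply: filterS hz => x [c _].
  by have [_ ->] := cderiv_derive1 c.
by have [e1 e2] := cderiv_derive1 b'; split.
Qed.

(** Variation of constants: the Wronskians a and b of f with the two solutions have zero derivative,
    hence are constant near q0, and divided by kap they are the coefficients of f. *)
Lemma wronskian_basis q0 (y dy : 'I_2 -> C -> C) (kap : C) : kap != 0 ->
  (forall i, \forall z \near q0, cderiv (y i) z (dy i z) /\ cderiv (dy i) z (V z * y i z)) ->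
  (\forall z \near q0, y 0 z * dy 1 z - dy 0 z * y 1 z = kap) ->
  local_basis tau p A q0 y.
Proof.
move=> k0 hy hW; split=> [i|f hf]; first exact: local_solutionP (hy i).
pose f1 := derive1 f.
have hf1 : \forall z \near q0, cderiv f z (f1 z) /\ cderiv f1 z (V z * f z).
  apply: filterS hf => z [a b <-]; split; exact: derive1_cderiv.
pose a z := f z * dy 1 z - f1 z * y 1 z.
pose b z := y 0 z * f1 z - dy 0 z * f z.
have H : \forall z \near q0, [/\ cderiv a z 0, cderiv b z 0 & f z * kap = a z * y 0 z + b z * y 1 z].
  refine (filterS _ (filterI (filterI (hy 0) (hy 1)) (filterI hf1 hW))).
  move=> z [[[y0 d0] [y1 d1]] [[fz f1z] <-]]; split.
  - apply: (@cderiv_eq _ a _ _ _ (cderivB (cderivM fz d1) (cderivM f1z y1))).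
    by move: (V z) => v; ring.
  - apply: (@cderiv_eq _ b _ _ _ (cderivB (cderivM y0 f1z) (cderivM d0 fz))).
    by move: (V z) => v; ring.
  - by rewrite /a /b; ring.
pose cc : 'rV[C]_2 := \row_j (if j == 0 then a q0 / kap else b q0 / kap).
have sumE (c : 'rV[C]_2) z : \sum_j c 0 j * y j z = c 0 0 * y 0 z + c 0 1 * y 1 z.
  by rewrite !big_ord_recl big_ord0 addr0; congr (_ + c 0 _ * y _ _); apply: val_inj.
exists cc; split.
  have /near0P [d d0 hd] := H; apply/near0P; exists d => // h hh.
  have ball t : 0 <= t <= 1 -> cmod (cr t * h) < d.
    move=> /andP[t0 t1]; apply: le_lt_trans hh; rewrite cmodM cmod_cr ger0_norm //.
    by rewrite -[leRHS]mul1r ler_wpM2r ?cmod_ge0.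
  have aE : a (q0 + h) = a q0 by apply: cderiv0_const => t /ball /hd [].
  have bE : b (q0 + h) = b q0 by apply: cderiv0_const => t /ball /hd [].
  have [_ _] := hd h hh; rewrite aE bE sumE !mxE /= => E.
  by apply: (mulIf k0); rewrite E; field.
move=> c hc.
have [y0 d0] := near_at (hy 0); have [y1 d1] := near_at (hy 1).
have [fz _] := near_at hf1; have W := near_at hW.
have f0E : f q0 = c 0 0 * y 0 q0 + c 0 1 * y 1 q0 by rewrite -sumE; apply: near_at hc.
have f1E : f1 q0 = c 0 0 * dy 0 q0 + c 0 1 * dy 1 q0.
  apply: cderiv_unique fz _.
  apply: cderiv_ext (cderivD (cderivZ (c 0 0) y0) (cderivZ (c 0 1) y1)).
  by apply: filterS hc => z ->; rewrite sumE.
apply/rowP => j; rewrite mxE; case: ifP => [/eqP ->|jn].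
  apply: (mulIf k0); rewrite divfK // /a f0E f1E -W; ring.
have -> : j = 1 by case: j jn => [[|[|]]] // *; apply: val_inj.
apply: (mulIf k0); rewrite divfK // /b f0E f1E -W; ring.
Qed.

Hypothesis h2p : ~ lat (2 * p).
Notation eta1 := (quasi_period tau 1).

(** Dividing both numerators by the root r divides their Wronskian by r^2 = wp - P, so that it
    becomes the constant kap; D is the derivative of N / r. *)
Lemma branch_basis q0 s0 (N1 N2 : C -> C) : regular tau p q0 -> s0 ^+ 2 = u q0 - P ->
  solution_pair tau p A N1 N2 ->
  local_basis tau p A q0 (fun i : 'I_2 => branch tau p s0 (u q0 - P) (if i == 0 then N1 else N2)).
Proof.
move=> hq s0E [N1' [N2' [kap [num1 num2 k0 W _]]]].
have b0 := regular_neq Htau h2p hq.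
set r := root_near tau p s0 (u q0 - P).
pose D (N N' : C -> C) z := (N' z - N z * u1 z / (2 * (u z - P))) / r z.
have nb := near_base Htau h2p hq.
have rsq z : r z ^+ 2 = u z - P by apply: root_near_sq.
have key (N N' : C -> C) : numerator tau p A N N' -> \forall z \near q0,
    cderiv (branch tau p s0 (u q0 - P) N) z (D N N' z) /\
    cderiv (D N N') z (V z * branch tau p s0 (u q0 - P) N z).
  case=> N'' hN; apply: filterS nb => z [hz hR].
  have [dN dN' ode] := hN z hz; have hl := regular_notin hz.
  have d0 := regular_neq Htau h2p hz.
  have r0 : r z != 0 by rewrite -sqrf_eq0 rsq.
  have dr := root_near_deriv Htau h2p s0E b0 hz hR; rewrite -/r in dr.
  split.
    apply: cderiv_eq (cderiv_div r0 dN dr) _.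
    rewrite /D -rsq; move: (N z) (N' z) (r z) (u1 z) r0 => n n' x x1 x0; field.
    exact: x0.
  have du := cderivB (wp_deriv Htau hl) (cderivC P z).
  have d2 : 2 * (u z - P) != 0 by rewrite mulf_neq0 // pnatr_eq0.
  have dq := @cderiv_div _ (fun x => N x * u1 x) (fun x => 2 * (u x - P)) z _ _ d2 (cderivM dN (dwp_deriv Htau hl)) (cderivZ 2 du).
  apply: cderiv_eq (cderiv_div r0 (cderivB dN' dq) dr) _.
  rewrite /branch -/r.
  have -> : V z * (N z / r z) = (V z * (u z - P) ^+ 2 * N z) / ((u z - P) ^+ 2 * r z).
    move: (V z) (N z) (r z) r0 (u z - P) d0 => v n x x0 d d0; field.
    by rewrite x0 d0.
  rewrite -ode -rsq.
  move: (N z) (N' z) (N'' z) (r z) (u1 z) (u2 z) r0 => n n' n'' x x1 x2 x0; field.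
  exact: x0.
apply: (@wronskian_basis _ _ (fun i : 'I_2 => if i == 0 then D N1 N1' else D N2 N2') kap k0).
  by move=> i; case: ifP => _; apply: key.
apply: filterS nb => z [hz _] /=.
have d0 := regular_neq Htau h2p hz.
have r0 : r z != 0 by rewrite -sqrf_eq0 rsq.
apply: (mulIf d0); rewrite -(W z hz) /branch -/r /D -rsq.
move: (N1 z) (N1' z) (N2 z) (N2' z) (r z) (u1 z) r0 => a a' b b' x x1 x0; field.
exact: x0.
Qed.

End LocalBasis.

(** * Monodromy matrices of a pair *)

Section MonodromyOfPair.
Context {R : realType}.
Notation C := (cplx R).
Variable tau : C.
Hypothesis Htau : 0 < complex.Im tau.
Implicit Types (z w c h : C).
Notation u := (wp tau).
Notation lat := (lattice tau).
Local Opaque wp zeta dwp ddwp ell eis.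
Variables p A : C.
Hypothesis h2p : ~ lat (2 * p).
Notation P := (u p).

Lemma sum_lower_unip (m chi : C) (f : 'I_2 -> C) (i : 'I_2) :
  \sum_j (m *: lower_unip chi) i j * f j = m * (f i + (if i == 0 then 0 else chi) * f 0).
Proof.
have sumE (F : 'I_2 -> C) : \sum_j F j = F 0 + F 1.
  by rewrite !big_ord_recl big_ord0 addr0; congr (F _ + F _); apply: val_inj.
have [->|->] : i = 0 \/ i = 1.
  by case: i => [[|[|]]] // hi; [left|right]; apply: val_inj.
all: rewrite sumE !mxE.
  rewrite (_ : (0 == 0 :> 'I_2) = true) // (_ : (0 == 1 :> 'I_2) = false) //.
  by rewrite (_ : ((1%R : 'I_2) < (0%R : 'I_2))%N = false) //; ring.
rewrite (_ : (1 == 0 :> 'I_2) = false) // (_ : (1 == 1 :> 'I_2) = true) //.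
by rewrite (_ : ((0%R : 'I_2) < (1%R : 'I_2))%N = true) //; ring.
Qed.

Section Pair.
Variables N1 N2 : C -> C.
Hypothesis hN : solution_pair tau p A N1 N2.
Variables q0 s0 : C.
Hypotheses (hq0 : regular tau p q0) (s0E : s0 ^+ 2 = u q0 - P).

Definition pair_basis (i : 'I_2) := branch tau p s0 (u q0 - P) (if i == 0 then N1 else N2).

(** The matrix is the one of the numerators times the final value m of the continued root. Along an
    arbitrary loop m is left unspecified; for a closing root it is 1. *)
Lemma pair_continuation (l : R -> C) (close : Prop) w (ep chi : C) : pcont l -> l 0 = q0 ->
  (forall t, 0 <= t <= 1 -> regular tau p (l t)) -> l 1 = q0 + w -> lat w ->
  quasi tau p N1 N2 w ep chi ->
  has_sqrt close (fun t => (u (l t) - P) / (u (l 0) - P)) ->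
  exists2 m : C, (close -> m = 1) & forall i, continuation l (pair_basis i)
    (fun z => \sum_j ((m * ep) *: lower_unip chi) i j * pair_basis j (z - (l 1 - l 0))).
Proof.
move=> cl l0 hl l1 hw hQ [sg [csg sgE sg0 sg1]]; exists (sg 1); first exact: sg1.
have [N1' [N2' [kap [[? num1] [? num2] k0 W _]]]] := hN.
move=> i; have -> : (fun z => \sum_j ((sg 1 * ep) *: lower_unip chi) i j * pair_basis j (z - (l 1 - l 0))) =
   (fun z => sg 1 * ep * (pair_basis i (z - w) + (if i == 0 then 0 else chi) * pair_basis 0 (z - w))).
  by apply: funext => z; rewrite sum_lower_unip l1 l0 (addrC q0) addrK.
rewrite /pair_basis eqxx -{1 2 3}l0.
apply: (@continuation_branch _ _ Htau _ h2p _ sg _ _ ep _ _ _ (if i == 0 then N1' else N2')) => //.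
- by rewrite l1 l0.
- by rewrite l0.
- by move=> z hz; have [a _ _] := num1 z hz; have [b _ _] := num2 z hz; case: (i == 0).
- move=> z hz; have [a b] := hQ z hz; case: (i == 0); rewrite ?a ?b //; ring.
Qed.

(** [monodromy_rep] is a condition on each loop separately, so rho is assembled by choice with its
    values on l1 and l2 prescribed; different end points ensure that these two prescriptions do not
    clash. *)
Lemma pair_monodromy (l1 l2 : R -> C) (M1 M2 : 'M[C]_2) : l1 1 <> l2 1 ->
  (forall i, continuation l1 (pair_basis i) (fun z => \sum_j M1 i j * pair_basis j (z - (l1 1 - l1 0)))) ->
  (forall i, continuation l2 (pair_basis i) (fun z => \sum_j M2 i j * pair_basis j (z - (l2 1 - l2 0)))) ->
  exists rho, [/\ monodromy_rep tau p q0 pair_basis rho, rho l1 = M1 & rho l2 = M2].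
Proof.
move=> l12 h1 h2.
have : forall l : R -> C, exists M : 'M[C]_2, [/\ l = l1 -> M = M1, l = l2 -> M = M2 &
   torus_loop tau (~` singular_points tau p) q0 l -> forall i, continuation l (pair_basis i)
     (fun z => \sum_j M i j * pair_basis j (z - (l 1 - l 0)))].
  move=> l; have [->|n1] := pselect (l = l1).
    by exists M1; split=> [_|E|_]; [|case: l12; rewrite E|].
  have [->|n2] := pselect (l = l2); first by exists M2; split=> [E|_|_]; [case: l12; rewrite E| |].
  have [[cl l0 lw hl]|nt] := pselect (torus_loop tau (~` singular_points tau p) q0 l); last first.
    by exists 0; split=> h; [case: n1|case: n2|case: nt].
  have hr t : 0 <= t <= 1 -> regular tau p (l t).
    by move=> /hl; apply: nonsingular_regular.
  have pl := within_pcont cl.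
  have [N1' [N2' [kap [_ _ _ _ hq]]]] := hN.
  have [ep [chi [_ hQ]]] := hq _ lw.
  have [] := @pair_continuation l False _ ep chi pl l0 hr _ lw hQ.
  - by ring.
  - apply: (path_root Htau) => // t /hr h; split; first exact: regular_notin h.
    by have := regular_neq Htau h2p h; rewrite subr_eq0.
  by move=> m _ h; exists ((m * ep) *: lower_unip chi); split=> [E|E|_]; [case: n1|case: n2|].
move=> /boolp.choice [rho hrho]; exists rho; split.
- by move=> l hl; have [_ _ h] := hrho l; apply: h.
- by have [h _ _] := hrho l1; apply: h.
- by have [_ h _] := hrho l2; apply: h.
Qed.

End Pair.

Lemma segment_avoid (l : R -> C) q0 :
  torus_loop tau (~` singular_points tau p `&` ~` segment_translates tau p) q0 l ->
  forall t s : R, 0 <= t <= 1 -> 0 <= s <= 1 -> ~ lat (l t - cr s * p) /\ ~ lat (l t + cr s * p).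
Proof.
move=> [_ _ _ hl] t s /hl [_ ns] /andP[s0 s1]; split=> hlat; apply: ns.
  (* The segment from p to -p passes through s p at parameter (1 - s) / 2 and through - s p at (1 +
     s) / 2. *)
  exists ((1 - s) / 2); first by apply/andP; split; lra.
  have -> : (1 - cr ((1 - s) / 2)) * p + cr ((1 - s) / 2) * - p = cr s * p; last exact: hlat.
  by rewrite crM crB crV cr1 cr_nat; field.
exists ((1 + s) / 2); first by apply/andP; split; lra.
have -> : (1 - cr ((1 + s) / 2)) * p + cr ((1 + s) / 2) * - p = - (cr s * p); last by rewrite opprK.
by rewrite crM crD crV cr1 cr_nat; field.
Qed.

Lemma monodromy_of_pair (N1 N2 : C -> C) q0 (l1 l2 : R -> C) (ep1 ep2 chi1 chi2 : C) :
  ~ singular_points tau p q0 -> fundamental_cycles tau p q0 l1 l2 ->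
  solution_pair tau p A N1 N2 ->
  quasi tau p N1 N2 1 ep1 chi1 -> quasi tau p N1 N2 tau ep2 chi2 ->
  monodromy_conj tau p A q0 l1 l2 (ep1 *: lower_unip chi1) (ep2 *: lower_unip chi2).
Proof.
move=> hq0 [[T1 l11] [T2 l21] _] hN Q1 Q2.
have rq0 : regular tau p q0 by apply: nonsingular_regular.
pose s0 := sqrtC (u q0 - P); have s0E : s0 ^+ 2 = u q0 - P by rewrite sqrtCK.
have key (l : R -> C) w ep chi : torus_loop tau (~` singular_points tau p `&` ~` segment_translates tau p) q0 l ->
    l 1 = q0 + w -> lat w -> quasi tau p N1 N2 w ep chi ->
    forall i, continuation l (pair_basis N1 N2 q0 s0 i)
     (fun z => \sum_j (ep *: lower_unip chi) i j * pair_basis N1 N2 q0 s0 j (z - (l 1 - l 0))).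
  move=> T lw hw hQ; have seg := segment_avoid T; have [cl l0 lw' hl] := T.
  have hr t : 0 <= t <= 1 -> regular tau p (l t).
    by move=> /hl [h _]; apply: nonsingular_regular.
  have pl := within_pcont cl.
  have [] := @pair_continuation N1 N2 hN q0 s0 s0E l True w ep chi pl l0 hr lw hw hQ.
    apply: (segment_sign Htau h2p pl) => //; last by rewrite l0.
    by move=> t /hr; apply: regular_notin.
  by move=> m -> // h i; have := h i; rewrite mul1r.
have [|||rho [hrho e1 e2]] := @pair_monodromy N1 N2 hN q0 s0 s0E l1 l2 (ep1 *: lower_unip chi1) (ep2 *: lower_unip chi2).
- rewrite l11 l21 => /addrI; rewrite /omega /= => E; by move: Htau; rewrite -E /= ltxx.
- by apply: (key _ 1) => //; apply: lattice1.
- by apply: (key _ tau) => //; apply: lattice_tau.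
exists (pair_basis N1 N2 q0 s0), rho; split=> //; first exact: branch_basis.
exists 1%:M; first exact: unitmx1.
by rewrite e1 e2 invmx1 !mul1mx !mulmx1.
Qed.

Lemma solution_pairZ (N1 N2 : C -> C) lam : lam != 0 -> solution_pair tau p A N1 N2 ->
  solution_pair tau p A N1 (fun z => lam * N2 z).
Proof.
move=> lam0 [N1' [N2' [kap [num1 [N2'' num2] k0 W hq]]]].
exists N1', (fun z => lam * N2' z), (lam * kap); split=> //.
- exists (fun z => lam * N2'' z) => z /num2 [a b E]; split; [exact: cderivZ|exact: cderivZ|].
  rewrite [RHS]mulrCA -E; move: (u z) (dwp tau z) (ddwp tau z) => x b1 b2; ring.
- by rewrite mulf_neq0.
- by move=> z /W E; rewrite -mulrA -E; ring.
move=> w /hq [ep [chi [e2 Q]]]; exists ep, (lam * chi); split=> // z /Q [-> ->].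
by split=> //; ring.
Qed.

Lemma quasiZ (N1 N2 : C -> C) lam w ep chi : quasi tau p N1 N2 w ep chi ->
  quasi tau p N1 (fun z => lam * N2 z) w ep (lam * chi).
Proof. by move=> Q z /Q [-> ->]; split=> //; ring. Qed.

(* The common conjugation of the theorem is the rescaling of N2. *)
Lemma monodromy_normalised (N1 N2 : C -> C) q0 (l1 l2 : R -> C) (ep1 ep2 chi1 chi2 : C) (c : option C) :
  ~ singular_points tau p q0 -> fundamental_cycles tau p q0 l1 l2 ->
  solution_pair tau p A N1 N2 ->
  quasi tau p N1 N2 1 ep1 chi1 -> quasi tau p N1 N2 tau ep2 chi2 ->
  (if c is Some c0 then chi1 != 0 /\ chi2 = c0 * chi1 else chi1 = 0 /\ chi2 != 0) ->
  monodromy_conj tau p A q0 l1 l2 (ep1 *: mono1 c) (ep2 *: mono2 c).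
Proof.
move=> hq0 hl hN Q1 Q2; case: c => [c0|] [].
  move=> x0 E; have lam0 : chi1^-1 != 0 by rewrite invr_eq0.
  have := monodromy_of_pair hq0 hl (solution_pairZ lam0 hN) (quasiZ _ Q1) (quasiZ _ Q2).
  have e1 : chi1^-1 * chi1 = 1 by rewrite mulVf.
  have e2 : chi1^-1 * chi2 = c0 by rewrite E mulrCA e1 mulr1.
  by rewrite e1 e2 => h; exact: h.
move=> E x0; have lam0 : chi2^-1 != 0 by rewrite invr_eq0.
have := monodromy_of_pair hq0 hl (solution_pairZ lam0 hN) (quasiZ _ Q1) (quasiZ _ Q2).
have e2 : chi2^-1 * chi2 = 1 by rewrite mulVf.
rewrite E mulr0 e2 => h.
have e0 : 1%:M = lower_unip 0 :> 'M[C]_2; last by rewrite /mono1 /mono2 e0; exact: h.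
by apply/matrixP => i j; rewrite !mxE; case: eqP => //= _; case: ifP.
Qed.

End MonodromyOfPair.

(** * The condition on wp p *)

Section Values.
Context {R : realType}.
Notation C := (cplx R).
Variable tau : C.
Hypothesis Htau : 0 < complex.Im tau.
Implicit Types (z w x h : C) (k : nat).
Notation u := (wp tau).
Notation lat := (lattice tau).
Notation g2 := (g2 tau).
Notation g3 := (g3 tau).
Notation eta1 := (quasi_period tau 1).
Notation eta2 := (quasi_period tau 2).
Local Opaque wp zeta dwp ddwp ell eis Defs.g2 Defs.g3 quasi_period.

Lemma half_omega k : (1 <= k <= 3)%N -> ~ lat (omega tau k / 2) /\ lat (2 * (omega tau k / 2)).
Proof.
have E w : 2 * (w / 2) = w by field.
case: k => [|[|[|[|]]]] // _; rewrite E /omega /=; split.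
- by rewrite div1r; apply: half_notin1.
- exact: lattice1.
- have -> : tau / 2 = cr 0 + cr 2^-1 * tau by rewrite cr0 crV cr_nat; field.
  by apply: (half_notin Htau); right; apply: half_nint.
- exact: lattice_tau.
- have -> : (1 + tau) / 2 = cr 2^-1 + cr 2^-1 * tau by rewrite crV cr_nat; field.
  by apply: (half_notin Htau); right; apply: half_nint.
- by apply: latticeD; [exact: lattice1|exact: lattice_tau].
Qed.

Lemma ek_neq : [/\ u (omega tau 1 / 2) != u (omega tau 2 / 2),
  u (omega tau 1 / 2) != u (omega tau 3 / 2) & u (omega tau 2 / 2) != u (omega tau 3 / 2)].
Proof.
have [a1 b1] := @half_omega 1 isT; have [a2 b2] := @half_omega 2 isT; have [a3 b3] := @half_omega 3 isT.
split; rewrite eq_sym; apply: (half_wp_neq Htau) => //; rewrite /omega /=.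
- have -> : tau / 2 - 1 / 2 = cr (- 2^-1) + cr 2^-1 * tau by rewrite crN crV cr_nat; field.
  by apply: (half_notin Htau); right; apply: half_nint.
- have -> : (1 + tau) / 2 - 1 / 2 = cr 0 + cr 2^-1 * tau by rewrite cr0 crV cr_nat; field.
  by apply: (half_notin Htau); right; apply: half_nint.
- have -> : (1 + tau) / 2 - tau / 2 = cr 2^-1 + cr 0 * tau by rewrite cr0 crV cr_nat; field.
  by apply: (half_notin Htau); left; apply: half_nint.
Qed.

Lemma sqrt_wp_epsilon k : (1 <= k <= 3)%N -> forall z, ~ lat z ->
  sqrt_wp tau (omega tau k / 2) (z + 1) = (epsilon k).1 * sqrt_wp tau (omega tau k / 2) z /\
  sqrt_wp tau (omega tau k / 2) (z + tau) = (epsilon k).2 * sqrt_wp tau (omega tau k / 2) z.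
Proof.
move=> hk z hz; have [hc h2c] := half_omega hk.
have [a1 b1] := @half_omega 1 isT; have [a2 b2] := @half_omega 2 isT.
have := sqrt_wp_shift Htau hc h2c a1 b1 hz; have := sqrt_wp_shift Htau hc h2c a2 b2 hz.
rewrite (_ : 2 * (omega tau 1 / 2) = 1); last by rewrite /omega /=; field.
rewrite (_ : 2 * (omega tau 2 / 2) = tau); last by rewrite /omega /=; field.
move=> -> ->; have [n12 n13 n23] := ek_neq.
case: k hk {hc h2c} => [|[|[|[|]]]] // _ /=.
- by rewrite eqxx eq_sym (negbTE n12) mul1r mulN1r.
- by rewrite eqxx (negbTE n12) mul1r mulN1r.
- by rewrite (negbTE n13) (negbTE n23) !mulN1r.
Qed.

(* Otherwise 4x^3 - g2 x - g3 = 4 (x + h)^2 (x - 2h) would have a double root. *)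
Lemma discriminant_neq h : g2 = 12 * h ^+ 2 -> g3 = 8 * h ^+ 3 -> False.
Proof.
move=> E2 E3.
have key k : (1 <= k <= 3)%N -> u (omega tau k / 2) = 2 * h.
  move=> /half_omega [hc h2c]; have := half_root Htau hc h2c; have := half_ddwp_neq0 Htau hc h2c.
  have -> : ddwp tau (omega tau k / 2) = 2 * (ddwp tau (omega tau k / 2) / 2) by field.
  rewrite (half_q Htau hc) E2 E3; move: (u _) => x q0 E.
  have : (x + h) ^+ 2 * (x - 2 * h) = 0.
    apply: (mulfI (_ : (4 : C) != 0)); first by rewrite pnatr_eq0.
    by rewrite mulr0 -E; ring.
  move/eqP; rewrite mulf_eq0 sqrf_eq0 => /orP[/eqP F|]; last by rewrite subr_eq0 => /eqP.
  case/eqP: q0; have -> : x = - h by apply/eqP; rewrite -addr_eq0 F.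
  by field.
by have [] := ek_neq; rewrite !key // eqxx.
Qed.

(** The limit is recorded without division, as n 0 = v * d 0, because d 0 may still be zero at this
    stage; [discriminant_neq] rules that out afterwards. *)
Lemma value_infty (num den n d : C -> C) (v : C) m :
  ratfun_value num den None v -> ccont n 0 -> ccont d 0 ->
  (forall x, x != 0 -> num x^-1 = n x / x ^+ m) -> (forall x, x != 0 -> den x^-1 = d x / x ^+ m) ->
  (\forall x \near (0 : C), x != 0 -> d x != 0) -> n 0 = v * d 0.
Proof.
rewrite /ratfun_value => hv cn cd hn hd dn0; apply/eqP; rewrite -subr_eq0; apply/negPn/negP => g0.
have K0 : 0 < cmod (d 0) + 1 by have := cmod_ge0 (d 0); lra.
have e0 : 0 < cmod (n 0 - v * d 0) / 2 by rewrite divr_gt0 // cmod_gt0.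
have cg : ccont (fun x => n x + (- v) * d x) 0 by apply: ccontD => //; apply: ccontM => //; exact: ccontC.
have [r1 r10 h1] := cg _ e0; have [r2 r20 h2] := cd 1 ltr01.
have := hv; move/cvgrPdist_lt => /(_ (cr (cmod (n 0 - v * d 0) / 2 / (cmod (d 0) + 1)))).
rewrite -cr0 ltr_cr divr_gt0 // => /(_ isT).
move=> hf; have /near0P [r r0 hr] : \forall x \near (0 : C),
    (x != 0 -> `|v - num x^-1 / den x^-1| < cr (cmod (n 0 - v * d 0) / 2 / (cmod (d 0) + 1))) /\ (x != 0 -> d x != 0).
  have hf' : \forall x \near (0 : C), x != 0 -> `|v - num x^-1 / den x^-1| <
      cr (cmod (n 0 - v * d 0) / 2 / (cmod (d 0) + 1)) by exact: hf.
  by apply: filterS2 hf' dn0.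
set s := Num.min r (Num.min r1 r2).
have s0 : 0 < s by rewrite !lt_min r0 r10.
pose x := cr (s / 2); have x0 : x != 0 by rewrite cr_eq0 gt_eqF // divr_gt0.
have : cmod x < s by rewrite cmod_cr ger0_norm; [lra|apply: ltW; rewrite divr_gt0].
rewrite !lt_min => /and3P[/hr + /h1 + /h2]; rewrite !add0r => -[/(_ x0) a /(_ x0) dx] b c.
rewrite hn // hd // in a; have xm : x ^+ m != 0 by rewrite expf_neq0.
have E : n x / x ^+ m / (d x / x ^+ m) = n x / d x.
  by move: (n x) (d x) dx (x ^+ m) xm => i j j0 y y0; field; rewrite y0 j0.
rewrite E cmodE ltr_cr cmodBC ltr_pdivlMr // in a.
have c' : cmod (d x) <= cmod (d 0) + 1.
  by have := cmod_lb (d x) (- d 0); rewrite cmodN; move: c; move: (cmod _) (cmod (d x)) => *; lra.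
have a' : cmod (n x - v * d x) < cmod (n 0 - v * d 0) / 2.
  have -> : n x - v * d x = (n x / d x - v) * d x by rewrite mulrBl divfK.
  by rewrite cmodM; apply: le_lt_trans a; rewrite ler_wpM2l ?cmod_ge0.
have := cmodB (n x + - v * d x) (n x + - v * d x - (n 0 + - v * d 0)).
rewrite subKr !mulNr; move: b; rewrite !mulNr; move: a'.
by move: (cmod _) (cmod _) (cmod _) => *; lra.
Qed.

Lemma ccont_lin (a b : C) : ccont (fun x => a + x * b) 0.
Proof. by apply: ccontD; [exact: ccontC|apply: ccontM; [exact: ccontI|exact: ccontC]]. Qed.

Lemma near_neq0 (f : C -> C) : ccont f 0 -> f 0 != 0 -> \forall x \near (0 : C), f x != 0.
Proof. exact: ccont_near_neq. Qed.

Lemma value_one (c : option C) (P : C) :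
  ratfun_value
    (fun X => 2 * g3 * (X - tau) ^+ 3 - 4 * (X * eta1 - eta2) ^+ 3
              - g2 * (X * eta1 - eta2) * (X - tau) ^+ 2)
    (fun X => (X - tau) * (12 * (X * eta1 - eta2) ^+ 2 - g2 * (X - tau) ^+ 2)) c P ->
  exists Y : C, [/\ (6 * Y ^+ 2 - g2 / 2) * P = 2 * Y ^+ 3 + g2 * Y / 2 + g3, g2 / 2 - 6 * Y ^+ 2 != 0 &
    if c is Some c0 then 2 * (eta1 + Y) != 0 /\ 2 * (eta2 + Y * tau) = c0 * (2 * (eta1 + Y))
    else 2 * (eta1 + Y) = 0 /\ 2 * (eta2 + Y * tau) != 0].
Proof.
have leg := legendre_neq Htau.
case: c => [c0|] H.
  have [den0 ->] := H; move: g2 g3 eta1 eta2 leg den0 => a b x y leg den0.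
  have [E0 F0] : c0 - tau != 0 /\ 12 * (c0 * x - y) ^+ 2 - a * (c0 - tau) ^+ 2 != 0.
    by move: den0; rewrite mulf_eq0 negb_or => /andP.
  have n2 : (2 : C) != 0 by rewrite pnatr_eq0.
  have xY : 2 * (x + - (c0 * x - y) / (c0 - tau)) = - (2 * (tau * x - y)) / (c0 - tau) by field.
  exists (- (c0 * x - y) / (c0 - tau)); rewrite xY; split.
  - by field; rewrite E0 F0.
  - apply/eqP => Z; case/eqP: F0.
    transitivity (- 2 * (c0 - tau) ^+ 2 * (a / 2 - 6 * (- (c0 * x - y) / (c0 - tau)) ^+ 2)); first by field.
    by rewrite Z mulr0.
  - split; last by field.
    by rewrite mulf_neq0 ?invr_eq0 // oppr_eq0 mulf_neq0.
pose L x := 1 + x * - tau; pose S x := eta1 + x * - eta2.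
have cL : ccont L 0 := ccont_lin _ _; have cS : ccont S 0 := ccont_lin _ _.
pose n x := 2 * g3 * (L x * (L x * L x)) + (- 4 * (S x * (S x * S x)) + - g2 * (S x * (L x * L x))).
pose q x := 12 * (S x * S x) + - g2 * (L x * L x).
pose d x := L x * q x.
have cq : ccont q 0.
  by apply: ccontD; apply: ccontM; [exact: ccontC|exact: ccontM|exact: ccontC|exact: ccontM].
have cd : ccont d 0 by apply: ccontM.
have cn : ccont n 0.
  apply: ccontD; first by apply: ccontM; [exact: ccontC|apply: ccontM => //; exact: ccontM].
  by apply: ccontD; apply: ccontM; try exact: ccontC; apply: ccontM => //; exact: ccontM.
have L0 : L 0 = 1 by rewrite /L mul0r addr0.
have S0 : S 0 = eta1 by rewrite /S mul0r addr0.
(* Even if q 0 = 0 the zero is isolated: q x is then a nonzero multiple of x (tau eta_1 - eta_2)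
   times a factor affine in x that does not vanish for small x <> 0. *)
have dn : \forall x \near (0 : C), x != 0 -> d x != 0.
  have nL : \forall x \near (0 : C), L x != 0 by apply: near_neq0; rewrite // L0 oner_eq0.
  have [q0|q0] := eqVneq (q 0) 0; last first.
    have := near_neq0 cq q0; move: nL; apply: filterS2 => x a b _; exact: mulf_neq0.
  have gE : g2 = 12 * eta1 ^+ 2.
    by move: q0; rewrite /q L0 S0 !mulr1 -expr2 => /eqP; rewrite subr_eq0 => /eqP ->.
  have qE x : q x = 12 * x * (tau * eta1 - eta2) * (- (2 * eta1 + x * - (eta2 + eta1 * tau))) * -1.
    by rewrite /q gE /S /L; move: eta1 eta2 => i j; ring.
  have nT : \forall x \near (0 : C), x != 0 -> 2 * eta1 + x * - (eta2 + eta1 * tau) != 0.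
    have [e0|e0] := eqVneq eta1 0.
      apply: filterE => x x0; rewrite e0 mulr0 mul0r add0r addr0 mulf_neq0 // oppr_eq0.
      by move: leg; rewrite e0 mulr0 sub0r oppr_eq0.
    have := near_neq0 (ccont_lin (2 * eta1) (- (eta2 + eta1 * tau))).
    by rewrite mul0r addr0 mulf_neq0 ?pnatr_eq0 // => /(_ isT); apply: filterS.
  move: nL nT; apply: filterS2 => x a b x0; apply: mulf_neq0 => //; rewrite qE.
  by rewrite !mulf_neq0 ?oppr_eq0 ?oner_eq0 ?pnatr_eq0 ?b.
have := @value_infty _ _ n d P 3 H cn cd.
have -> : n 0 = 2 * g3 - 4 * eta1 ^+ 3 - g2 * eta1.
  by rewrite /n L0 S0; move: g2 g3 eta1 => i j k; ring.
have -> : d 0 = 12 * eta1 ^+ 2 - g2 by rewrite /d /q L0 S0; move: g2 eta1 => i k; ring.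
move=> /(_ _ _ dn) E.
have {}E : 2 * g3 - 4 * eta1 ^+ 3 - g2 * eta1 = P * (12 * eta1 ^+ 2 - g2).
  apply: E => x x0; rewrite /n /d /q /S /L; move: g2 g3 eta1 eta2 => i j k l; field; exact: x0.
exists (- eta1); split.
- move: E; move: g2 g3 eta1 => i j k E.
  transitivity (P * (12 * k ^+ 2 - i) / 2); first by field.
  by rewrite -E; field.
(* A vanishing denominator at infinity forces the numerator to vanish as well, hence g2 = 12 eta_1^2
   and g3 = 8 eta_1^3, a double root of the cubic. *)
- apply/eqP => Z; have gE : g2 = 12 * eta1 ^+ 2.
    transitivity (2 * (g2 / 2 - 6 * (- eta1) ^+ 2) + 12 * eta1 ^+ 2); last by rewrite Z mulr0 add0r.
    by move: g2 eta1 => i k; field.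
  apply: (@discriminant_neq eta1 gE); move: E; rewrite gE subrr mulr0.
  move: g3 eta1 => j k E.
  transitivity ((2 * j - 4 * k ^+ 3 - 12 * k ^+ 2 * k) / 2 + 8 * k ^+ 3); first by field.
  by rewrite E mul0r add0r.
- split; first by rewrite subrr mulr0.
  have -> : 2 * (eta2 + - eta1 * tau) = - (2 * (tau * eta1 - eta2)) by move: eta1 eta2 => i j; ring.
  by rewrite oppr_eq0 mulf_neq0 // pnatr_eq0.
Qed.

Lemma value_two k (c : option C) (P : C) : (1 <= k <= 3)%N ->
  ratfun_value
    (fun X => (g2 / 2 - 3 * ek tau k ^+ 2) * (X * eta1 - eta2) + g2 / 4 * ek tau k * (X - tau))
    (fun X => 3 * ek tau k * (X * eta1 - eta2) + (g2 / 2 - 3 * ek tau k ^+ 2) * (X - tau)) c P ->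
  exists al Y : C, [/\ (6 * ek tau k * Y + (6 * ek tau k ^+ 2 - g2) * al) * (ek tau k - P) =
      2 * (3 * ek tau k ^+ 2 - g2 / 4) * (2 * Y + al * ek tau k),
    6 * ek tau k * Y + (6 * ek tau k ^+ 2 - g2) * al != 0 &
    if c is Some c0 then 2 * (al * eta1 + Y) != 0 /\ 2 * (al * eta2 + Y * tau) = c0 * (2 * (al * eta1 + Y))
    else 2 * (al * eta1 + Y) = 0 /\ 2 * (al * eta2 + Y * tau) != 0].
Proof.
have leg := legendre_neq Htau; have n2 : (2 : C) != 0 by rewrite pnatr_eq0.
move=> hk; have [hc h2c] := half_omega hk; case: c => [c0|] H.
  (* With this scaling the first unipotent entry is - 2 (tau eta_1 - eta_2) whatever c0 is. *)
  have [den0 ->] := H; exists (c0 - tau), (- (c0 * eta1 - eta2)).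
  move: g2 (ek tau k) eta1 eta2 leg den0 => a e x y leg den0; split.
  - field.
    have -> : 3 * e * (c0 * x - y) * 2 + (a + - (3 * e ^+ 2) * 2) * (c0 - tau) =
      2 * (3 * e * (c0 * x - y) + (a / 2 - 3 * e ^+ 2) * (c0 - tau)) by field.
    by apply: mulf_neq0.
  - apply/eqP => Z; case/eqP: den0; apply: (mulfI n2); rewrite mulr0 -oppr0 -Z; by field.
  - split; last by ring.
    apply/eqP => Z; case/eqP: leg; apply: (mulfI n2); rewrite mulr0 -oppr0 -Z; ring.
have root := half_root Htau hc h2c; rewrite -/(ek tau k) in root.
have q0 : 3 * ek tau k ^+ 2 - g2 / 4 != 0.
  rewrite -(half_q Htau hc) mulf_neq0 ?invr_eq0 //; exact: half_ddwp_neq0.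
pose a := g2 / 2 - 3 * ek tau k ^+ 2.
pose n x := (a * eta1 + g2 / 4 * ek tau k) + x * - (a * eta2 + g2 / 4 * ek tau k * tau).
pose d x := (3 * ek tau k * eta1 + a) + x * - (3 * ek tau k * eta2 + a * tau).
have dn : \forall x \near (0 : C), x != 0 -> d x != 0.
  have [d0|d0] := eqVneq (3 * ek tau k * eta1 + a) 0; last first.
    have := near_neq0 (ccont_lin (3 * ek tau k * eta1 + a) (- (3 * ek tau k * eta2 + a * tau))).
    by rewrite mul0r addr0 => /(_ d0); apply: filterS.
  have aE : a = - (3 * ek tau k * eta1) by apply/eqP; rewrite -addr_eq0 addrC d0.
  apply: filterE => x x0; rewrite /d d0 add0r mulf_neq0 // oppr_eq0 aE.
  have -> : 3 * ek tau k * eta2 + - (3 * ek tau k * eta1) * tau = - (3 * ek tau k * (tau * eta1 - eta2)).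
    by move: (ek tau k) eta1 eta2 => i j l; ring.
  rewrite oppr_eq0 !mulf_neq0 ?pnatr_eq0 //; apply/eqP => e0.
  case/eqP: q0; transitivity (- a / 2 + 3 / 2 * ek tau k ^+ 2); first by rewrite /a; move: g2 (ek tau k) => i j; field.
  by rewrite aE e0; ring.
have := @value_infty _ _ n d P 1 H (ccont_lin _ _) (ccont_lin _ _).
move=> /(_ _ _ dn); rewrite /n /d !mul0r !addr0 => E.
have {}E : a * eta1 + g2 / 4 * ek tau k = P * (3 * ek tau k * eta1 + a).
  by apply: E => x x0; rewrite /a; move: g2 (ek tau k) eta1 eta2 => i e l m; field.
exists 1, (- eta1); split.
- move: E; rewrite /a; move: g2 (ek tau k) eta1 => i e l E.
  transitivity (e * (6 * e * - l + (6 * e ^+ 2 - i)) + 2 * (P * (3 * e * l + (i / 2 - 3 * e ^+ 2)))); first by field.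
  by rewrite -E; field.
(* If the denominator vanished at infinity, then g2 = 12 eta_1^2 and e_k would be 2 eta_1 or -
   eta_1; in both cases the root equation gives g3 = 8 eta_1^3, excluded as before. *)
- apply/eqP => Z.
  have aE : a = - (3 * ek tau k * eta1).
    apply: (mulfI n2); rewrite -[LHS]addr0 -Z /a; move: g2 (ek tau k) eta1 => i e l; by field.
  have E0 : ek tau k * (g2 / 4 - 3 * eta1 ^+ 2) = 0.
    transitivity (a * eta1 + g2 / 4 * ek tau k); last by rewrite E aE subrr mulr0.
    by rewrite aE; move: g2 (ek tau k) eta1 => i e l; by field.
  have e0 : ek tau k != 0.
    apply/eqP => e0; case/eqP: q0; transitivity (- a / 2 + 3 / 2 * ek tau k ^+ 2).
      by rewrite /a; move: g2 (ek tau k) => i j; field.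
    by rewrite aE e0; ring.
  have gE : g2 = 12 * eta1 ^+ 2.
    move/eqP: E0; rewrite mulf_eq0 (negbTE e0) subr_eq0 => /eqP F.
    by transitivity (4 * (g2 / 4)); [move: g2 => i; field|rewrite F; ring].
  apply: (@discriminant_neq eta1 gE); rewrite gE in root.
  have : (2 * eta1 - ek tau k) * (eta1 + ek tau k) = 0.
    transitivity ((a + 3 * ek tau k * eta1) / 3); last by rewrite aE addNr mul0r.
    by rewrite /a gE; move: (ek tau k) eta1 => i j; field.
  have -> : g3 = 4 * ek tau k ^+ 3 - 12 * eta1 ^+ 2 * ek tau k - (4 * ek tau k ^+ 3 - 12 * eta1 ^+ 2 * ek tau k - g3).
    by move: g3 (ek tau k) eta1 => i j l; ring.
  rewrite root subr0 => /eqP; rewrite mulf_eq0 => /orP[|].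
    by rewrite subr_eq0 => /eqP <-; ring.
  by rewrite addrC addr_eq0 => /eqP ->; ring.
- rewrite !mul1r subrr mulr0; split=> //.
  have -> : 2 * (eta2 + - eta1 * tau) = - (2 * (tau * eta1 - eta2)) by move: eta1 eta2 => i j; ring.
  by rewrite oppr_eq0 mulf_neq0.
Qed.

End Values.

Theorem theorem1p2 (R : realType) (tau p : cplx R)
  (Htau : 0 < complex.Im tau) (Hp : ~ torsion2 tau p)
  (q0 : cplx R) (Hq0 : ~ singular_points tau p q0)
  (l1 l2 : R -> cplx R) (Hl : fundamental_cycles tau p q0 l1 l2) :
  (forall c : option (cplx R),
     ratfun_value
       (fun C => 2 * g3 tau * (C - tau) ^+ 3
                 - 4 * (C * quasi_period tau 1 - quasi_period tau 2) ^+ 3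
                 - g2 tau * (C * quasi_period tau 1 - quasi_period tau 2) * (C - tau) ^+ 2)
       (fun C => (C - tau) * (12 * (C * quasi_period tau 1 - quasi_period tau 2) ^+ 2
                              - g2 tau * (C - tau) ^+ 2))
       c (wp tau p) ->
     exists A : cplx R,
       monodromy_conj tau p A q0 l1 l2 (mono1 c) (mono2 c))
  /\
  (forall (k : nat) (c : option (cplx R)), (1 <= k <= 3)%N ->
     ratfun_value
       (fun C => (g2 tau / 2 - 3 * ek tau k ^+ 2) * (C * quasi_period tau 1 - quasi_period tau 2)
                 + g2 tau / 4 * ek tau k * (C - tau))
       (fun C => 3 * ek tau k * (C * quasi_period tau 1 - quasi_period tau 2)
                 + (g2 tau / 2 - 3 * ek tau k ^+ 2) * (C - tau))
       c (wp tau p) ->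
     exists A : cplx R,
       monodromy_conj tau p A q0 l1 l2
         ((epsilon k).1 *: mono1 c) ((epsilon k).2 *: mono2 c)).
Proof.
have h2p : ~ lattice tau (2 * p) by move=> /torsion2P /Hp.
split=> [c /(value_one Htau) [Y [rel kap0 hchi]]|k c hk].
  have [A [N1 [N2 [hN Q1 Q2]]]] := solutions_one Htau h2p rel kap0; exists A.
  by have := monodromy_normalised Htau h2p Hq0 Hl hN Q1 Q2 hchi; rewrite !scale1r.
move=> /(value_two Htau hk) [al [Y [rel kap0 hchi]]].
have [hc h2c] := half_omega Htau hk; have hs := sqrt_wp_epsilon Htau hk.
have [e1 e2] : (epsilon k).1 ^+ 2 = 1 :> cplx R /\ (epsilon k).2 ^+ 2 = 1 :> cplx R.
  by case: (k) => [|[|[|?]]] /=; rewrite ?sqrrN ?expr1n.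
have [A [N1 [N2 [hN Q1 Q2]]]] := solutions_two Htau h2p hc h2c rel kap0 e1 e2
  (fun z hz => (hs z hz).1) (fun z hz => (hs z hz).2).
by exists A; apply: (monodromy_normalised Htau h2p Hq0 Hl hN Q1 Q2 hchi).
Qed.
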